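(* Consider the interconnection of $n$ impulsive subsystems $$\dot x_i(t)=f_i(x_1(t),\dots,x_n(t),u_i(t)),\ t\ne t_k,\qquad x_i(t)=g_i(x_1^-(t),\dots,x_n^-(t),u_i^-(t)),\ t=t_k,$$ $k\in\mathbb{N}$, $i=1,\dots,n$, viewed as the single system $\dot x=f(x,u)$, $t\neq t_k$, $x(t)=g(x^-(t),u^-(t))$, $t=t_k$, with $x=(x_1^T,\dots,x_n^T)^T$, $u=(u_1^T,\dots,u_n^T)^T$, $f=(f_1^T,\dots,f_n^T)^T$, $g=(g_1^T,\dots,g_n^T)^T$. Assume each subsystem has an exponential ISS-Lyapunov function $V_i$ with linear gains $\gamma_{ij}(r)=\gamma_{ij}r$ ($\gamma_{ij}\ge0$, $\gamma_{ii}=0$), gains $\gamma_i$, and rate coefficients $c_i,d_i$ with $d_i\ne0$. If the matrix $\Gamma=(\gamma_{ij})_{n\times n}$ satisfies the small-gain condition $\Gamma(v)\not\ge v$ for all $v\in\mathbb{R}^n_+\setminus\{0\}$, then for any $s=(s_1,\dots,s_n)^T\in\mathbb{R}^n$ with $s>0$ and $\Gamma(s)<s$, the function $$V(x):=\max_i\Big\{\tfrac{1}{s_i}V_i(x_i)\Big\}$$ is an exponential ISS-Lyapunov function for the whole system with gain $\gamma(r):=\max\{e^d,1\}\max_i\frac{1}{s_i}\gamma_i(r)$ and rate coefficients $c:=\min_i c_i$ and $d:=\min_{i,j,\,j\ne i}\{d_i,-\ln(\tfrac{s_j}{s_i}\gamma_{ij})\}$. In particular, for all $\mu,\lambda>0$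 the system is uniformly ISS over $\mathcal{S}[\mu,\lambda]$, the class of impulse time sequences satisfying $-dN(t,s')-(c-\lambda)(t-s')\le\mu$ for all $t\ge s'\ge t_0$.
   Context: $x_i\in\mathbb{R}^{N_i}$ is absolutely continuous between impulses, $u_i\in\mathbb{R}^{M_i}$ are locally bounded, Lebesgue measurable inputs; all signals are right-continuous with left limits, $x_i^-(t)=\lim_{s\nearrow t}x_i(s)$, $u_i^-(t)=\lim_{s\nearrow t}u_i(s)$. Each $f_i$ is locally Lipschitz. The impulse times (common to all subsystems) form a strictly increasing sequence in $(t_0,\infty)$, finite or infinite and unbounded, with no finite accumulation point; $N(t,s)$ is the number of impulse times in $(s,t]$. $\mathbb{R}_+=[0,\infty)$; for vectors, $x\ge y$ means $x_i\ge y_i$ for all $i$, $x\not\ge y$ means $x_i<y_i$ for some $i$, and $x>y$ means $x_i>y_i$ for all $i$. The gain operator is $\Gamma(v):=(\max_j\gamma_{1j}v_j,\dots,\max_j\gamma_{nj}v_j)^T$ for $v\in\mathbb{R}^n_+$. $\mathcal{K}_\infty$ is the class of continuous, strictly increasing, unbounded $\gamma:\mathbb{R}_+\to\mathbb{R}_+$ with $\gamma(0)=0$; $\mathcal{KL}$ is the class of $\beta$ with $\beta(\cdot,t)$ continuous strictly increasing with $\beta(0,t)=0$ and $\beta(r,\cdot)$ continuous decreasing to $0$. Subsystem Lyapunov functions: $V_i:\mathbb{R}^{N_i}\to\mathbb{R}_+$ is continuous, proper, positive definite and locally Lipschitz on $\mathbb{R}^{N_i}\setminus\{0\}$; it is an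 exponential ISS-Lyapunov function with rate coefficients $c_i,d_i\in\mathbb{R}$ if there are $\gamma_{ij},\gamma_i\in\mathcal{K}_\infty$ (here $\gamma_{ij}$ linear) such that whenever $V_i(x_i)\ge\max\{\max_{j\ne i}\gamma_{ij}(V_j(x_j)),\gamma_i(|u_i|)\}$ then $\nabla V_i(x_i)\cdot f_i(x,u_i)\le-c_iV_i(x_i)$ for almost all $x$ and all $u_i$, and for all $x,u_i$: $V_i(g_i(x,u_i))\le\max\{e^{-d_i}V_i(x_i),\max_{j\ne i}\gamma_{ij}(V_j(x_j)),\gamma_i(|u_i|)\}$. Whole-system exponential ISS-Lyapunov function with rate coefficients $c,d$ and gain $\gamma\in\mathcal{K}_\infty$: $V:\mathbb{R}^N\to\mathbb{R}_+$ locally Lipschitz, positive definite, radially unbounded, such that whenever $V(x)\ge\gamma(|u|)$: $\nabla V(x)\cdot f(x,u)\le-cV(x)$ for almost all $x$ and all $u$, and $V(g(x,u))\le e^{-d}V(x)$ for all $x,u$. Uniformly ISS over a class $\mathcal{S}$: there exist $\beta\in\mathcal{KL}$, $\tilde\gamma\in\mathcal{K}_\infty$ independent of the sequence in $\mathcal{S}$ such that for every sequence in $\mathcal{S}$, every initial condition and input, the solution exists globally and $|x(t)|\le\max\{\beta(|x(t_0)|,t-t_0),\tilde\gamma(\|u\|_{[t_0,t]})\}$ for all $t\ge t_0$.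
   Formalization: The whole-system V is shown to be continuous and locally Lipschitz away from the origin rather than locally Lipschitz everywhere, since the V_i are only assumed locally Lipschitz off 0 (e.g. V_1(x)=sqrt|x| gives a V not Lipschitz at 0). *)

(* Defs.v *)
From HB Require Import structures.
From mathcomp Require Import all_boot all_order all_algebra.
From mathcomp Require Import all_classical all_reals all_analysis.

Set Implicit Arguments.
Unset Strict Implicit.
Unset Printing Implicit Defensive.
Import Order.TTheory GRing.Theory Num.Theory numFieldNormedType.Exports.
Local Open Scope classical_set_scope.
Local Open Scope ring_scope.

Section ImpulsiveDefs.
Context {R : realType}.

(** ** Finite min / max over the index set 'I_n (meaningful for n > 0). *)
Definition fmin {n : nat} (F : 'I_n -> R) : R :=
  \big[Num.min/head 0 [seq F i | i <- enum 'I_n]]_(i < n) F i.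
Definition fmax {n : nat} (F : 'I_n -> R) : R :=
  \big[Num.max/head 0 [seq F i | i <- enum 'I_n]]_(i < n) F i.

Definition in_box {N : nat} (a b : 'rV[R]_N) : set 'rV[R]_N :=
  [set y | forall j, a 0 j <= y 0 j <= b 0 j].
Definition box_vol {N : nat} (a b : 'rV[R]_N) : R := \prod_(j < N) (b 0 j - a 0 j).
Definition null_set {N : nat} (A : set 'rV[R]_N) : Prop :=
  forall eps : R, 0 < eps ->
  exists a b : nat -> 'rV[R]_N,
    [/\ (forall k j, a k 0 j <= b k 0 j),
        A `<=` \bigcup_k in_box (a k) (b k) &
        (forall m, \sum_(k < m) box_vol (a k) (b k) <= eps)].

Definition pos_def {N : nat} (V : 'rV[R]_N -> R) : Prop :=
  V 0 = 0 /\ (forall x, x != 0 -> 0 < V x).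
Definition radially_unbounded {N : nat} (V : 'rV[R]_N -> R) : Prop :=
  forall K : R, exists r : R, forall x, r <= `|x| -> K <= V x.
Definition loc_lip_off0 {N : nat} (V : 'rV[R]_N -> R) : Prop :=
  forall x, x != 0 -> exists r L : R, 0 < r /\
    forall y z, `|y - x| < r -> `|z - x| < r -> `|V y - V z| <= L * `|y - z|.
Definition loc_lip2 {A B C : normedModType R} (h : A -> B -> C) : Prop :=
  forall x u, exists r L : R, 0 < r /\
    forall y1 y2 v1 v2, `|y1 - x| < r -> `|y2 - x| < r -> `|v1 - u| < r -> `|v2 - u| < r ->
      `|h y1 v1 - h y2 v2| <= L * (`|y1 - y2| + `|v1 - v2|).

Definition classK (gam : R -> R) : Prop :=
  [/\ gam 0 = 0, {within [set r | 0 <= r], continuous gam} &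
      (forall r1 r2, 0 <= r1 -> r1 < r2 -> gam r1 < gam r2)].
Definition classKinf (gam : R -> R) : Prop :=
  classK gam /\ (forall K : R, exists r, 0 <= r /\ K <= gam r).
Definition classKL (beta : R -> R -> R) : Prop :=
  (forall t, 0 <= t -> classK (fun r => beta r t)) /\
  (forall r, 0 <= r ->
     [/\ {within [set t | 0 <= t], continuous (beta r)},
         (forall t1 t2, 0 <= t1 -> t1 <= t2 -> beta r t2 <= beta r t1) &
         beta r t @[t --> +oo] --> 0]).

Definition blk {n : nat} {N : 'I_n -> nat} (x : 'rV[R]_(\sum_(i < n) N i)) (i : 'I_n)
  : 'rV[R]_(N i) := submxrow x i.

Definition stack {n : nat} {N M : 'I_n -> nat}
  (hs : forall i, 'rV[R]_(\sum_(j < n) N j) -> 'rV[R]_(M i) -> 'rV[R]_(N i))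
  (x : 'rV[R]_(\sum_(j < n) N j)) (u : 'rV[R]_(\sum_(j < n) M j))
  : 'rV[R]_(\sum_(j < n) N j) :=
  mxrow (fun i => hs i x (blk u i)).

Definition Gamma_op {n : nat} (G : 'I_n -> 'I_n -> R) (v : 'I_n -> R) (i : 'I_n) : R :=
  \big[Num.max/0]_(j < n) (G i j * v j).

Definition small_gain {n : nat} (G : 'I_n -> 'I_n -> R) : Prop :=
  forall v : 'I_n -> R, (forall i, 0 <= v i) -> (exists i, v i != 0) ->
    exists i, Gamma_op G v i < v i.

Definition interaction {n : nat} {N : 'I_n -> nat}
  (Vs : forall i, 'rV[R]_(N i) -> R) (G : 'I_n -> 'I_n -> R)
  (x : 'rV[R]_(\sum_(j < n) N j)) (i : 'I_n) : R :=
  \big[Num.max/0]_(j < n | j != i) (G i j * Vs j (blk x j)).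

Definition sub_eISS_LF {n : nat} {N M : 'I_n -> nat}
  (fs gs : forall i, 'rV[R]_(\sum_(j < n) N j) -> 'rV[R]_(M i) -> 'rV[R]_(N i))
  (Vs : forall i, 'rV[R]_(N i) -> R) (G : 'I_n -> 'I_n -> R)
  (gam : 'I_n -> R -> R) (c d : 'I_n -> R) (i : 'I_n) : Prop :=
  [/\ [/\ continuous (Vs i), pos_def (Vs i), radially_unbounded (Vs i),
      loc_lip_off0 (Vs i) & classKinf (gam i)],
      (exists E : set 'rV[R]_(\sum_(j < n) N j), null_set E /\
         forall x, ~ E x ->
           differentiable (Vs i) (blk x i) /\
           forall ui : 'rV[R]_(M i),
             Num.max (interaction Vs G x i) (gam i `|ui|) <= Vs i (blk x i) ->
             'd (Vs i) (blk x i) (fs i x ui) <= - c i * Vs i (blk x i)) &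
      (forall x (ui : 'rV[R]_(M i)),
         Vs i (gs i x ui) <=
         Num.max (expR (- d i) * Vs i (blk x i))
                 (Num.max (interaction Vs G x i) (gam i `|ui|)))].

Definition eISS_LF {NN MM : nat} (f g : 'rV[R]_NN -> 'rV[R]_MM -> 'rV[R]_NN)
  (V : 'rV[R]_NN -> R) (gamma : R -> R) (c d : R) : Prop :=
  [/\ [/\ continuous V, loc_lip_off0 V, pos_def V, radially_unbounded V &
      classKinf gamma],
      (exists E : set 'rV[R]_NN, null_set E /\
         forall x, ~ E x ->
           differentiable V x /\
           forall u : 'rV[R]_MM, gamma `|u| <= V x -> 'd V x (f x u) <= - c * V x) &
      (forall x (u : 'rV[R]_MM), gamma `|u| <= V x -> V (g x u) <= expR (- d) * V x)].

(* The set of impulse times: contained in (t0, oo), finitely many in every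
   bounded interval (= a finite or unbounded strictly increasing sequence
   with no finite accumulation point). *)
Definition impulse_times (t0 : R) (T : set R) : Prop :=
  T `<=` [set t | t0 < t] /\ (forall a b : R, finite_set (T `&` `[a, b]%classic)).

Definition Nimp (T : set R) (t s : R) (k : nat) : Prop :=
  exists l : seq R, [/\ uniq l, (forall r, r \in l <-> (T r /\ s < r <= t)) & size l = k].

Definition class_S (t0 c d mu lam : R) : set (set R) :=
  [set T | impulse_times t0 T /\
     forall t s k, t0 <= s -> s <= t -> Nimp T t s k ->
       - d * k%:R - (c - lam) * (t - s) <= mu].

(* admissible inputs: right-continuous with left limits (hence Lebesgue measurable
   and locally bounded) *)
Definition admissible_input {MM : nat} (u : R -> 'rV[R]_MM) : Prop :=
  forall t, u s @[s --> at_right t] --> u t /\ exists l : 'rV[R]_MM, u s @[s --> at_left t] --> l.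

(* x is a solution on [t0, oo) of  x' = f(x,u) (t not impulse), x(t) = g(x^-(t), u^-(t))
   (t impulse), with x(t0) = x0.  Between impulses x is absolutely continuous:
   it satisfies the integral equation on every [a,b] with no impulse in (a,b]. *)
Definition is_solution {NN MM : nat} (f g : 'rV[R]_NN -> 'rV[R]_MM -> 'rV[R]_NN)
  (t0 : R) (T : set R) (u : R -> 'rV[R]_MM) (x0 : 'rV[R]_NN) (x : R -> 'rV[R]_NN) : Prop :=
  [/\ x t0 = x0,
      (forall a b, t0 <= a -> a <= b -> (forall r, T r -> ~ (a < r <= b)) ->
         forall j : 'I_NN,
           (@lebesgue_measure R).-integrable `[a, b]%classic
              (fun s => ((f (x s) (u s)) 0 j)%:E) /\
           x b 0 j = x a 0 j + Rintegral (@lebesgue_measure R) `[a, b]%classic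
                                         (fun s => (f (x s) (u s)) 0 j)) &
      (forall t, T t -> exists xl ul,
         [/\ x s @[s --> at_left t] --> xl, u s @[s --> at_left t] --> ul & x t = g xl ul])].

Definition UISS {NN MM : nat} (f g : 'rV[R]_NN -> 'rV[R]_MM -> 'rV[R]_NN)
  (t0 : R) (S : set (set R)) : Prop :=
  exists (beta : R -> R -> R) (gt : R -> R),
    [/\ classKL beta, classKinf gt &
        forall T, S T -> forall (x0 : 'rV[R]_NN) (u : R -> 'rV[R]_MM), admissible_input u ->
          (exists x, is_solution f g t0 T u x0 x) /\
          (forall x, is_solution f g t0 T u x0 x ->
             forall t, t0 <= t ->
               `|x t| <= Num.max (beta `|x0| (t - t0))
                                 (gt (sup [set `|u s| | s in `[t0, t]%classic])))].

End ImpulsiveDefs.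

(* Main.v *)
Require Import Defs.
From HB Require Import structures.
From mathcomp Require Import all_boot all_order all_algebra.
From mathcomp Require Import all_classical all_reals all_analysis.
From mathcomp Require Import measurable_realfun lra ring.
Import Order.TTheory GRing.Theory Num.Theory numFieldNormedType.Exports.
Local Open Scope classical_set_scope.
Local Open Scope ring_scope.

(** With [s] such that [Gamma s < s], a maximizing index [i] of [V_i(x_i)/s_i] automatically
satisfies [V_i(x_i) >= gamma_ij V_j(x_j)], so each subsystem dissipation inequality applies
to the maximum. The maximum is differentiable off a null set because the ties
[{h = 0, dh <> 0}] of two differentiable functions are locally Lipschitz graphs.

For stability, a trajectory may stay inside the exceptional null set, so the almost
everywhere decay is first turned into a pointwise one-sided Dini inequality: by Tonelli,
lines parallel to a given direction and arbitrarily close to a given one meet the null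
set in a set of small length, and a Lipschitz function is controlled along such lines.
Since inputs are right-continuous, solutions have right derivatives everywhere and the Dini
inequality integrates between impulses. Peeling off the first impulse inductively yields
[V(x(t)) <= exp(-d N(t,s) - c (t-s)) V(x(s))] from [s = t0], or from the last time [s] at which
[V] was of the order of the input gain; the condition defining the class of impulse
sequences then concludes. The same a priori bound gives global existence. *)

Set Implicit Arguments.
Unset Strict Implicit.
Unset Printing Implicit Defensive.

(** * Row vectors and differentials *)

Section RowNorm.
Context {R : realType}.

(** The jump clause of [eISS_LF] is silent about jumps from states below the gain, which could lead
    anywhere. Stability is therefore derived from [eISS_LF] together with the jump estimate in max
    form, valid at all states, which the subsystem inequalities provide for the maximum. A jump from
    below the gain then costs at most the constant factor [kappa], absorbed in the input gain. Null
    sets of the state space are described by coverings with boxes of small total volume, so no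
    measure on that space is available. The averaging argument is instead run one coordinate at a
    time, the base point of a generic line being chosen coordinate by coordinate. *)

Lemma rV_norm_leP n (x : 'rV[R]_n) (r : R) : 0 <= r ->
  (`|x| <= r) <-> (forall j, `|x 0 j| <= r).
Proof.
move=> r0; rewrite [`|x|]mx_normrE; split=> [/bigmax_leP[_ H] j|H].
  exact: (H (0, j)).
by apply/bigmax_leP; split=> // -[i j] _ /=; rewrite ord1.
Qed.

Lemma rV_coord_le n (x : 'rV[R]_n) j : `|x 0 j| <= `|x|.
Proof. by move: j; apply/rV_norm_leP. Qed.

Lemma differentiable_norm_le (V W : normedModType R) (f : V -> W) (x : V) :
  differentiable f x -> forall e : R, 0 < e -> exists2 d : R, 0 < d &
  forall y, `|y - x| < d -> `|f y - f x - 'd f x (y - x)| <= e * `|y - x|.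
Proof.
move=> df e e0; have := diff_locally df => /eqaddoP /(_ _ e0) /nbhs_normP[d /= d0 H].
exists d => // y yx; have := H (y - x); rewrite /= sub0r normrN => /(_ yx).
by rewrite !fctE /= subrK opprD addrA.
Qed.

Lemma diff_of_norm_le (V W : normedModType R) (f : V -> W) (df : {linear V -> W}) (x : V) :
  continuous df ->
  (forall e : R, 0 < e -> exists2 d : R, 0 < d &
    forall y, `|y - x| < d -> `|f y - f x - df (y - x)| <= e * `|y - x|) ->
  differentiable f x /\ 'd f x = df :> (V -> W).
Proof.
move=> cdf H.
have fo : f \o shift x = cst (f x) + df +o_ (0 : V) id.
  apply/eqaddoP => e e0; have [d d0 Hd] := H e e0.
  apply/nbhs_normP; exists d => //= h; rewrite /= sub0r normrN => hd.
  have := Hd (h + x); rewrite addrK => /(_ hd).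
  by rewrite !fctE opprD addrA.
have ddf := diff_unique cdf fo.
by split=> //; apply/diff_locallyP; rewrite ddf.
Qed.

End RowNorm.

(** * Dini inequalities on the line *)

Section RealLine.
Context {R : realType}.
Implicit Types (a b c r s t : R) (W : R -> R).

(** The supremum of the points up to which [P] holds satisfies [P] by the left-limit step, and the
    right step forbids it to lie below [b]. *)
Lemma real_induction a b (P : R -> Prop) : P a ->
  (forall s, a <= s -> s < b -> (forall r, a <= r -> r <= s -> P r) ->
    exists2 e, 0 < e & forall t, s < t -> t < s + e -> t <= b -> P t) ->
  (forall s, a < s -> s <= b -> (forall r, a <= r -> r < s -> P r) -> P s) ->
  forall t, a <= t -> t <= b -> P t.
Proof.
move=> Pa Pr Pl t at_ tb.
pose A := [set s | [/\ a <= s, s <= b & forall r, a <= r -> r <= s -> P r]].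
have Aa : A a.
  by split; [|lra|move=> r ar ra; have -> : r = a by lra].
have ubA : has_ubound A by exists b => s [].
have supA : has_sup A by split => //; exists a.
set m := sup A.
have am : a <= m by exact: ub_le_sup.
have mb : m <= b by apply: ge_sup; [exists a|move=> s []].
have Pm r : a <= r -> r < m -> P r.
  move=> ar rm; have e0 : 0 < m - r by lra.
  have [s [as_ sb Ps] ms] := sup_adherent e0 supA.
  by apply: Ps => //; rewrite -/m in ms; lra.
have Am : A m.
  split=> // r ar rm; case: (ltP r m) => [|mr]; first exact: Pm.
  have -> : r = m by lra.
  case: (ltP a m) => [am'|ma]; first by apply: Pl => // r' ? ?; exact: Pm.
  by have -> : m = a by lra.
case: (ltP m b) => [mb'|bm]; last by case: Am => _ _; apply=> //; lra.
case: Am => _ _ Pm'; have [e e0 Pe] := Pr _ am mb' Pm'.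
pose s := Num.min b (m + e / 2).
have [sb sm] : s <= b /\ s <= m + e / 2 by split; rewrite /s ge_min lexx ?orbT.
have ms : m < s by rewrite /s lt_min; lra.
have As : A s.
  split=> //; first lra; move=> r ar rs; case: (leP r m) => rm; first exact: Pm'.
  by apply: Pe => //; lra.
by have := ub_le_sup ubA As; rewrite -/m; lra.
Qed.

Lemma ler_mul_expR_gt0 (x m k : R) : 0 <= m -> 0 <= k ->
  (forall e, 0 < e -> x <= m * expR (e * k)) -> x <= m.
Proof.
move=> m0 k0 H.
have h : (fun e => m * expR (e * k)) e @[e --> (0:R)^'+] --> m.
  apply: cvg_at_right_filter.
  have -> : nbhs m = nbhs (m * expR (0 * k)) by rewrite mul0r expR0 mulr1.
  by apply: cvgM; [exact: cvg_cst|apply: continuous_cvg; [exact: continuous_expR|apply: cvgM; [exact: cvg_id|exact: cvg_cst]]].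
by apply: (ler_cvg_to (cvg_cst x) h); near=> e; apply: H; near: e; exact: nbhs_right_gt.
Unshelve. all: by end_near. Qed.

(* With the slack [e * W t] the Dini inequality integrates in multiplicative form,
   through [1 + x <= expR x]. *)
Lemma dini_decay_pos c s t W : s <= t ->
  (forall q, s < q -> q <= t -> W x @[x --> q^'-] --> W q) ->
  (forall q, s <= q -> q <= t -> 0 < W q) ->
  (forall q, s <= q -> q < t -> forall e, 0 < e -> exists2 del, 0 < del &
     forall h, 0 < h -> h < del -> q + h <= t -> W (q + h) <= W q + (- c * W q + e) * h) ->
  W t <= expR (- c * (t - s)) * W s.
Proof.
move=> st Wl W0 WD.
rewrite mulrC.
have Ws0 : 0 < W s by apply: W0.
rewrite mulrC; apply: (@ler_mul_expR_gt0 _ _ (t - s)); rewrite ?subr_ge0 //.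
  by rewrite mulr_ge0 ?expR_ge0 // ltW.
move=> e e0.
pose k := c - e.
suff : W t <= expR (- k * (t - s)) * W s.
  move/le_trans; apply; rewrite mulrAC -expRD.
  by rewrite ler_pM2r // ler_expR /k; lra.
move: (lexx t); pose P q := W q <= expR (- k * (q - s)) * W s.
apply: (@real_induction s t P _ _ _ t st).
- by rewrite /P subrr mulr0 expR0 mul1r.
- move=> q sq qt Pq.
  have Wq0 : 0 < W q by apply: W0 => //; lra.
  have [del del0 H] := WD q sq qt (e * W q) (mulr_gt0 e0 Wq0).
  exists del => // p qp pq pt.
  have := H (p - q); rewrite (addrC q) subrK => /(_ ltac:(lra) ltac:(lra) pt) /le_trans; apply.
  have -> : W q + (- c * W q + e * W q) * (p - q) = (1 + (- k * (p - q))) * W q.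
    by rewrite /k; lra.
  apply: (@le_trans _ _ (expR (- k * (p - q)) * W q)).
    by rewrite ler_pM2r // expR_ge1Dx.
  have -> : - k * (p - s) = - k * (p - q) + - k * (q - s) by lra.
  by rewrite expRD -mulrA ler_pM2l ?expR_gt0 //; apply: Pq.
- move=> q sq qt H.
  have h : (fun p => expR (- k * (p - s)) * W s) p @[p --> q^'-] --> expR (- k * (q - s)) * W s.
    apply: cvg_at_left_filter; apply: cvgM; last exact: cvg_cst.
    apply: continuous_cvg; first exact: continuous_expR.
    by apply: cvgM; [exact: cvg_cst|apply: cvgB; [exact: cvg_id|exact: cvg_cst]].
  apply: (ler_cvg_to (Wl q sq qt) h); near=> p; apply: H; near: p.
    exact: nbhs_left_ge.
  exact: nbhs_left_lt.
Unshelve. all: by end_near. Qed.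

(** The decay integrates along the last stretch before [b] on which [W] exceeds [r]; this stretch
    starts either at [a] or at a time where [W] is at most [r]. The value [w] is only a left limit,
    since [b] may be an impulse time. *)
Lemma dini_decay c a b r w W : a < b -> 0 <= r ->
  (forall q, a <= q -> q < b -> W x @[x --> q^'+] --> W q) ->
  (forall q, a < q -> q < b -> W x @[x --> q^'-] --> W q) ->
  W x @[x --> b^'-] --> w ->
  (forall q, a <= q -> q < b -> r < W q -> forall e, 0 < e -> exists2 del, 0 < del &
     forall h, 0 < h -> h < del -> q + h < b -> W (q + h) <= W q + (- c * W q + e) * h) ->
  w <= expR (- c * (b - a)) * W a \/
  exists s, [/\ a <= s, s <= b & w <= expR (- c * (b - s)) * r].
Proof.
move=> ab r0 Wr Wl Wb WD.
case: (leP w r) => [wr|rw].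
  by right; exists b; rewrite (ltW ab) lexx subrr mulr0 expR0 mul1r.
have expl (s x : R) : (fun p => expR (- c * (p - s)) * W s) p @[p --> x^'-] --> expR (- c * (x - s)) * W s.
    apply: cvg_at_left_filter; apply: cvgM; last exact: cvg_cst.
    apply: continuous_cvg; first exact: continuous_expR.
    by apply: cvgM; [exact: cvg_cst|apply: cvgB; [exact: cvg_id|exact: cvg_cst]].
(* Starting points of stretches above [r] that reach [b]; the infimum is the start of the longest
   one. *)
pose A := [set s | [/\ a <= s, s < b & forall t, s <= t -> t < b -> r < W t]].
have [s0 As0] : A !=set0.
  have /cvgr_gt := Wb; move=> /(_ _ rw) Wgt.
  have : \forall x \near b^'-, a <= x by apply: nbhs_left_ge.
  move: Wgt => [e /= e0 He] [e' /= e'0 He'].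
  pose s := Num.max a (Num.max (b - e / 2) (b - e' / 2)).
  have [sa sb] : a <= s /\ s < b.
    by rewrite /s le_max lexx; split=> //; rewrite !gt_max; lra.
  exists s; split=> // t st tb; apply: He => //=.
  rewrite ger0_norm; last lra.
  have : b - e / 2 <= s by rewrite /s !le_max lexx !orbT.
  lra.
have lbA : has_lbound A by exists a => s [].
have infA : has_inf A by split => //; exists s0.
set m := inf A.
have am : a <= m by apply: lb_le_inf; [exists s0|move=> s []].
have mb : m < b.
  by apply: (@le_lt_trans _ _ s0); [exact: ge_inf|case: As0].
have Wm t : m < t -> t < b -> r < W t.
  move=> mt tb; have e0 : 0 < t - m by lra.
  have [s [as_ sb Ps] ms] := inf_adherent e0 infA.
  by apply: Ps => //; rewrite -/m in ms; lra.
have dec s : m < s -> s < b -> w <= expR (- c * (b - s)) * W s.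
  move=> ms sb; apply: (ler_cvg_to Wb (expl s b)); near=> t.
  have st : s <= t by near: t; exact: nbhs_left_ge.
  have tb : t < b by near: t; exact: nbhs_left_lt.
  apply: dini_decay_pos => //.
  - by move=> q sq qt; apply: Wl; lra.
  - by move=> q sq qt; apply: (le_lt_trans r0); apply: Wm; lra.
  - move=> q sq qt e e0; have rWq : r < W q by apply: Wm; lra.
    have [del del0 H] := WD q ltac:(lra) ltac:(lra) rWq e e0.
    by exists del => // h h0 hd qh; apply: H => //; lra.
have wm : w <= expR (- c * (b - m)) * W m.
  have h : (fun s => expR (- c * (b - s)) * W s) s @[s --> m^'+] --> expR (- c * (b - m)) * W m.
    apply: cvgM; last exact: Wr.
    apply: cvg_at_right_filter; apply: continuous_cvg; first exact: continuous_expR.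
    by apply: cvgM; [exact: cvg_cst|apply: cvgB; [exact: cvg_cst|exact: cvg_id]].
  apply: (ler_cvg_to (cvg_cst w) h); near=> s; apply: dec; near: s.
    exact: nbhs_right_gt.
  exact: nbhs_right_lt.
case: (leP (W m) r) => [Wmr|rWm].
  right; exists m; split=> //; first exact: ltW.
  by apply: (le_trans wm); rewrite ler_pM2l ?expR_gt0.
left; case: (ltP a m) => [am'|ma]; last by have <- : m = a by lra.
(* If [W m] exceeded [r] with [a < m], left continuity would start the stretch before its
   infimum. *)
exfalso.
have /cvgr_gt := Wl m am' mb; move=> /(_ _ rWm) [e /= e0 He].
pose s := Num.max a (m - e / 2).
have as_ : a <= s by rewrite /s le_max lexx.
have es : m - e / 2 <= s by rewrite /s le_max lexx orbT.
have sm : s < m by rewrite /s !gt_max; lra.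
have As : A s.
  split=> //; first lra.
  move=> t st tb; case: (ltgtP t m) => [tm|mt|->//]; last exact: Wm.
  by apply: He => //=; rewrite ger0_norm; lra.
by have := ge_inf lbA As; rewrite -/m; lra.
Unshelve. all: by end_near. Qed.

End RealLine.

(** * Increments of a Lipschitz function whose slope is bounded off a small set *)

Section LipschitzLine.
Context {R : realType}.
Notation mu := (@lebesgue_measure R).

(** On [U] the slope is bounded by [K] only. Using [K] in place of [m] on a set of measure at most
    [M] costs at most [(K + |m|) * M], the absolute value covering a negative [m]. Openness of [U]
    leaves room to the right of each of its points, as real induction requires. *)
Lemma lipschitz_increment_le (h K m M : R) (phi : R -> R) (U : set R) :
  0 < h -> 0 <= K -> open U -> (mu U <= M%:E)%E ->
  (forall s t, 0 <= s -> s <= t -> t <= h -> `|phi t - phi s| <= K * (t - s)) ->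
  (forall s, 0 <= s -> s < h -> ~ U s -> forall e, 0 < e -> exists2 del, 0 < del &
     forall k, 0 < k -> k < del -> s + k <= h -> phi (s + k) <= phi s + (m + e) * k) ->
  phi h - phi 0 <= m * h + (K + `|m|) * M.
Proof.
move=> h0 K0 oU UM lip dphi.
have mU : measurable U by exact: open_measurable.
have mUI s : measurable (U `&` `[0, s]%classic) by exact: measurableI.
have lem (A B : set R) : measurable A -> measurable B -> A `<=` B -> (mu A <= mu B)%E.
  by move=> mA mB AB; apply: le_measure; rewrite ?inE.
have gfin s : mu (U `&` `[0, s]%classic) \is a fin_num.
  rewrite ge0_fin_numE //; apply: (le_lt_trans _ (ltry M)); apply: le_trans UM.
  by apply: lem => // x [].
pose g s := fine (mu (U `&` `[0, s]%classic)).
have g0 s : 0 <= g s by exact: fine_ge0.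
have gM s : g s <= M.
  rewrite -lee_fin fineK //; apply: le_trans UM.
  by apply: lem => // x [].
have gmono s t : s <= t -> g s <= g t.
  move=> st; rewrite fine_le //; apply: lem => //.
  by apply: setIS => x /=; rewrite !in_itv /=; lra.
have gadd s t : 0 <= s -> s < t -> (forall r, s < r -> r <= t -> U r) -> g s + (t - s) <= g t.
  move=> s0 st HU.
  have -> : t - s = fine (mu `]s, t]%classic).
    by rewrite lebesgue_measure_itv /= lte_fin st.
  rewrite /g -fineD //; last by rewrite lebesgue_measure_itv /= lte_fin st.
  rewrite fine_le //; first by rewrite fin_numD gfin lebesgue_measure_itv /= lte_fin st.
  rewrite -measureU; [|exact: mUI|exact: measurable_itv|]; last first.
    by apply/seteqP; split=> x //= -[[_ ]]; rewrite !in_itv /=; lra.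
  apply: lem => //; first exact: measurableU.
  move=> x [[Ux]|]; rewrite /= !in_itv /= => xs; first by split=> //; lra.
  by split; [apply: HU; lra|lra].
suff H e : 0 < e -> phi h - phi 0 <= m * h + (K + `|m|) * M + e * h.
  apply/ler_addgt0Pr => e e0; have := H _ (divr_gt0 e0 h0); by rewrite divfK ?gt_eqF.
move=> e0.
(* The invariant charges the error due to [U] to its measure [g s] up to time [s]. *)
pose P s := phi s <= phi 0 + (m + e) * s + (K + `|m|) * g s.
have Km0 : 0 <= K + `|m| by rewrite addr_ge0.
have : P h.
  apply: (@real_induction R 0 h P) => //; last exact: ltW.
  - by rewrite /P mulr0 addr0 lerDl mulr_ge0.
  - move=> s s0 sh HP.
    have Ps : P s by apply: HP.
    case: (pselect (U s)) => Us.
      move: oU; rewrite openE => /(_ s Us) /= [d /= d0 Hd].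
      exists d => // t st td th.
      have := gadd s t s0 st; move=> /(_ _)/wrap[].
        by move=> r sr rt; apply: Hd => /=; rewrite ltr0_norm; lra.
      move=> gst; have := lip s t s0 (ltW st) th.
      rewrite ler_norml => /andP[_]; rewrite /P in Ps *.
      have : (K + `|m|) * (g s + (t - s)) <= (K + `|m|) * g t by rewrite ler_wpM2l.
      have : - `|m| * (t - s) <= m * (t - s).
        by rewrite ler_wpM2r; [lra|lra|rewrite lerNl -normrN ler_norm].
      have : 0 <= e * (t - s) by rewrite mulr_ge0 //; lra.
      nra.
    have [d d0 Hd] := dphi s s0 sh Us e e0.
    exists d => // t st td th.
    have := Hd (t - s); rewrite (addrC s) subrK => /(_ ltac:(lra) ltac:(lra) th).
    have : (K + `|m|) * g s <= (K + `|m|) * g t by rewrite ler_wpM2l // gmono ?ltW.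
    rewrite /P in Ps *; nra.
  - move=> s s0 sh HP; rewrite /P; apply/ler_addgt0Pr => e' e'0.
    pose C := K + `|m + e| + 1.
    have C0 : 0 < C by rewrite /C; have := normr_ge0 (m + e); lra.
    pose r := Num.max 0 (s - e' / C).
    have r0 : 0 <= r by rewrite /r le_max lexx.
    have rs : r < s by rewrite /r gt_max s0; have := divr_gt0 e'0 C0; lra.
    have sr : s - r <= e' / C.
      have : s - e' / C <= r by rewrite /r le_max lexx orbT.
      lra.
    have := HP r r0 rs; rewrite /P.
    have := lip r s r0 (ltW rs) sh; rewrite ler_norml => /andP[_].
    have : (K + `|m|) * g r <= (K + `|m|) * g s by rewrite ler_wpM2l // gmono ?ltW.
    have : (m + e) * (r - s) <= `|m + e| * (s - r).
      have -> : (m + e) * (r - s) = - (m + e) * (s - r) by lra.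
      by rewrite ler_wpM2r; [lra|lra|rewrite -normrN ler_norm].
    have : C * (s - r) <= e' by rewrite mulrC -ler_pdivlMr.
    rewrite /C; nra.
rewrite /P => Ph.
have : (K + `|m|) * g h <= (K + `|m|) * M by rewrite ler_wpM2l.
lra.
Qed.

End LipschitzLine.

(** * Null sets *)

Section NullSets.
Context {R : realType}.

Lemma null_set_sub N (A B : set 'rV[R]_N) : A `<=` B -> Defs.null_set B -> Defs.null_set A.
Proof.
move=> AB nB e e0; have [a [b [ab Bab vol]]] := nB e e0.
by exists a, b; split=> //; exact: subset_trans Bab.
Qed.

Lemma box_vol_ge0 N (a b : 'rV[R]_N) : (forall j, a 0 j <= b 0 j) -> 0 <= box_vol a b.
Proof. by move=> ab; apply: prodr_ge0 => j _; rewrite subr_ge0. Qed.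

Lemma null_set_count N (A : set 'rV[R]_N) : (0 < N)%N ->
  (forall e : R, 0 < e -> exists (I : countType) (a b : I -> 'rV[R]_N),
    [/\ forall i j, a i 0 j <= b i 0 j, A `<=` \bigcup_i in_box (a i) (b i) &
        forall s : seq I, uniq s -> \sum_(i <- s) box_vol (a i) (b i) <= e]) ->
  Defs.null_set A.
Proof.
move=> N0 H e e0; have [I [a [b [ab Aab vol]]]] := H e e0.
(* Numbers that code no index are padded with the box reduced to the point 0, whose volume vanishes
   because [0 < N]. *)
pose a' k := oapp a 0 (pickle_inv k); pose b' k := oapp b 0 (pickle_inv k).
exists a', b'; split.
- by move=> k j; rewrite /a' /b'; case: (pickle_inv k) => /=.
- move=> x /Aab [i _ xi]; exists (pickle i) => //.
  by rewrite /a' /b' pickleK_inv.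
- move=> m; apply: le_trans (vol (pmap (@pickle_inv I) (iota 0 m)) _); last first.
    exact: (pmap_uniq pickle_invK (iota_uniq _ _)).
  rewrite big_pmap -(big_mkord xpredT (fun k => box_vol (a' k) (b' k))) /index_iota subn0.
  apply: ler_sum => k _; rewrite /a' /b'; case: (pickle_inv k) => //=.
  by rewrite /box_vol; case: N N0 {A H a b ab Aab vol a' b'} => // N _; rewrite big_ord_recl subrr mul0r.
Qed.

Lemma ler_sum_uniq_sub (I : eqType) (s s' : seq I) (F : I -> R) :
  uniq s -> uniq s' -> {subset s <= s'} -> (forall i, 0 <= F i) ->
  \sum_(i <- s) F i <= \sum_(i <- s') F i.
Proof.
move=> us us' ss' F0.
have -> : \sum_(i <- s) F i = \sum_(i <- s' | i \in s) F i.
  rewrite -[RHS]big_filter; apply: perm_big; apply: uniq_perm => //.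
    exact: filter_uniq.
  by move=> i; rewrite mem_filter; case: (boolP (i \in s)) => //= /ss'.
by rewrite [leRHS](bigID (fun i => i \in s)) /= lerDl sumr_ge0.
Qed.

Lemma sum_half_expr_le1 m : \sum_(k < m) (2^-1 : R) ^+ k.+1 <= 1.
Proof.
suff -> : \sum_(k < m) (2^-1 : R) ^+ k.+1 = 1 - 2^-1 ^+ m.
  by rewrite gerBl exprn_ge0.
elim: m => [|m IH]; first by rewrite big_ord0 expr0 subrr.
by rewrite big_ord_recr /= IH exprS; lra.
Qed.

Lemma null_set_bigcup N (I : countType) (A : I -> set 'rV[R]_N) : (0 < N)%N ->
  (forall i, Defs.null_set (A i)) -> Defs.null_set (\bigcup_i A i).
Proof.
move=> N0 nA; apply: null_set_count => // e e0.
pose w i := e * (2^-1) ^+ (pickle (i : I)).+1 : R.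
have w0 i : 0 < w i by rewrite mulr_gt0 // exprn_gt0.
have /choice[F HF] : forall i, exists ab : (nat -> 'rV[R]_N) * (nat -> 'rV[R]_N),
    [/\ forall k j, ab.1 k 0 j <= ab.2 k 0 j, A i `<=` \bigcup_k in_box (ab.1 k) (ab.2 k) &
        forall m, \sum_(k < m) box_vol (ab.1 k) (ab.2 k) <= w i].
  by move=> i; have [a [b ?]] := nA i (w i) (w0 i); exists (a, b).
exists (I * nat)%type, (fun p => (F p.1).1 p.2), (fun p => (F p.1).2 p.2); split.
- by move=> [i k] j /=; case: (HF i).
- move=> x [i _ Aix]; case: (HF i) => _ /(_ x Aix) [k _ xk] _.
  by exists (i, k).
- move=> s us.
  (* A finite list of pairs lies in a rectangle [t] by [iota 0 K], on which the partial sums of each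
     covering bound the total. *)
  pose K := (\max_(p <- s) p.2).+1.
  pose t := undup (map fst s).
  pose G (p : I * nat) := box_vol ((F p.1).1 p.2) ((F p.1).2 p.2).
  have G0 p : 0 <= G p by apply: box_vol_ge0 => j; case: (HF p.1).
  apply: (@le_trans _ _ (\sum_(p <- [seq (i, k) | i <- t, k <- iota 0 K]) G p)).
    apply: ler_sum_uniq_sub => //.
      by apply: allpairs_uniq; [exact: undup_uniq|exact: iota_uniq|move=> [? ?] [? ?]].
    move=> [i k] iks; apply/allpairsP; exists (i, k); split=> //.
      by rewrite mem_undup; apply/mapP; exists (i, k).
    by rewrite mem_iota add0n ltnS /=; exact: (@leq_bigmax_seq _ _ _ snd _ iks).
  rewrite big_allpairs_dep /=.
  apply: (@le_trans _ _ (\sum_(i <- t) w i)).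
    apply: ler_sum => i _; case: (HF i) => _ _ /(_ K).
    by rewrite -(big_mkord xpredT (fun k => box_vol ((F i).1 k) ((F i).2 k))) /index_iota subn0.
  rewrite -mulr_sumr -[leRHS]mulr1 ler_pM2l //.
  rewrite -(big_map pickle xpredT (fun k => 2^-1 ^+ k.+1)).
  pose K' := (\max_(k <- map pickle t) k).+1.
  apply: le_trans (sum_half_expr_le1 K').
  rewrite -(big_mkord xpredT (fun k => 2^-1 ^+ k.+1)) /index_iota subn0.
  apply: ler_sum_uniq_sub.
  + by rewrite map_inj_uniq ?undup_uniq //; exact: (pcan_inj pickleK_inv).
  + exact: iota_uniq.
  + by move=> k kt; rewrite mem_iota add0n ltnS /=; exact: (@leq_bigmax_seq _ _ _ id _ kt).
  + by move=> k; rewrite exprn_ge0.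
Qed.

(** [S] lies on a Lipschitz graph over the coordinates other than [l]. In dimension [N.+1], cutting
    each of these [N] coordinates into [K.+1] pieces and centring a box at one point of each cell
    gives [K.+1 ^ N] boxes of volume of order [1 / K.+1 ^ N.+1], hence a total of order
    [1 / K.+1]. *)
Lemma null_set_lipschitz_graph N (l : 'I_N) (C rho : R) (c : 'rV[R]_N) (S : set 'rV[R]_N) :
  0 < rho -> 0 < C ->
  (forall x, S x -> forall j, c 0 j <= x 0 j < c 0 j + rho) ->
  (forall x y, S x -> S y -> forall q, 0 <= q ->
     (forall j, j != l -> `|y 0 j - x 0 j| <= q) -> `|y 0 l - x 0 l| <= C * q) ->
  Defs.null_set S.
Proof.
move=> rho0 C0 Sc Slip.
case: N l c S Sc Slip => [[]//|N] l c S Sc Slip.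
have N0 : (0 < N.+1)%N by [].
suff H K : exists a b : {ffun 'I_N -> 'I_K.+1} -> 'rV[R]_N.+1,
    [/\ forall i j, a i 0 j <= b i 0 j, S `<=` \bigcup_i in_box (a i) (b i) &
        forall s, uniq s -> \sum_(i <- s) box_vol (a i) (b i) <= 2 ^+ N.+1 * C * rho ^+ N.+1 / K.+1%:R].
  apply: null_set_count => // e e0.
  pose D := 2 ^+ N.+1 * C * rho ^+ N.+1.
  have D0 : 0 < D by rewrite !mulr_gt0 ?exprn_gt0.
  pose K := Num.truncn (D / e).
  have DK : D / K.+1%:R <= e.
    by rewrite ler_pdivrMr // mulrC -ler_pdivrMr // ltW // truncnS_gt.
  have [a [b [ab Sab vol]]] := H K.
  exists {ffun 'I_N -> 'I_K.+1}, a, b; split=> // t ut.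
  exact: le_trans (vol t ut) DK.
set w := rho / K.+1%:R.
have w0 : 0 < w by rewrite divr_gt0.
pose cell (f : {ffun 'I_N -> 'I_K.+1}) : set 'rV[R]_N.+1 :=
  [set x | S x /\ forall j, c 0 (lift l j) + w * (f j)%:R <= x 0 (lift l j) < c 0 (lift l j) + w * (f j).+1%:R].
(* One point of each nonempty cell; an empty cell gets the default 0, and its box only adds to the
   volume count. *)
pose z f : 'rV[R]_N.+1 := xget (0 : 'rV[R]_N.+1) (cell f).
pose v : 'rV[R]_N.+1 := \row_j (if j == l then C * w else w).
have v0 j : 0 < v 0 j by rewrite mxE; case: ifP => _ //; rewrite mulr_gt0.
exists (fun f => z f - v), (fun f => z f + v); split.
- by move=> f j; rewrite !mxE; have := v0 j; rewrite mxE; lra.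
- move=> x Sx.
  pose tr (j : 'I_N) := Num.truncn ((x 0 (lift l j) - c 0 (lift l j)) / w).
  have tlt j : (tr j < K.+1)%N.
    have /andP[h1 h2] := Sc x Sx (lift l j).
    rewrite truncn_lt_nat; last by rewrite divr_ge0 ?(ltW w0) // subr_ge0.
    by rewrite ltr_pdivrMr // /w mulrCA divff // mulr1; lra.
  pose f := [ffun j => Ordinal (tlt j)].
  have cx : cell f x.
    split=> // j; rewrite ffunE /=.
    have /andP[h1 h2] := Sc x Sx (lift l j).
    have /truncn_itv/andP[] : 0 <= (x 0 (lift l j) - c 0 (lift l j)) / w.
      by rewrite divr_ge0 ?(ltW w0) // subr_ge0.
    set T := Num.truncn _; rewrite ler_pdivlMr // ltr_pdivrMr // => t1 t2.
    by rewrite mulrC (mulrC w); lra.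
  have cz : cell f (z f) by rewrite /z; apply: xgetPex; exists x.
  exists f => // j /=; rewrite !mxE.
  have dist j' : `|x 0 (lift l j') - z f 0 (lift l j')| <= w.
    case: cx => _ /(_ j'); case: cz => _ /(_ j').
    by rewrite -!natr1 !mulrDr !mulr1 ler_norml; lra.
  suff : `|x 0 j - z f 0 j| <= v 0 j by rewrite mxE ler_norml; lra.
  rewrite mxE; case: eqP => [->|/eqP jl].
    apply: (Slip (z f) x cz.1 cx.1) => [|i il]; first exact: ltW.
    by case: (unliftP l i) il => [i' ->|->]; rewrite ?eqxx.
  by case: (unliftP l j) jl => [i' ->|->]; rewrite ?eqxx.
- move=> s us.
  have volE f : box_vol (z f - v) (z f + v) = 2 ^+ N.+1 * C * w ^+ N.+1.
    rewrite /box_vol (eq_bigr (fun j => 2 * v 0 j)); last first.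
      by move=> j _; rewrite !mxE; lra.
    rewrite big_split /= prodr_const card_ord -mulrA; congr (_ * _).
    rewrite (bigD1 l) //= mxE eqxx -mulrA; congr (_ * _).
    rewrite (eq_bigr (fun => w)); last by move=> j /negbTE jl; rewrite mxE jl.
    rewrite prodr_const exprS; congr (_ * _ ^+ _).
    by rewrite cardC1 card_ord.
  rewrite (eq_bigr _ (fun f _ => volE f)) big_const_seq count_predT iter_addr addr0.
  rewrite -[leLHS]mulr_natr {1}expr_div_n.
  have sz : (size s <= K.+1 ^ N)%N.
    by rewrite -(card_uniqP us) (leq_trans (max_card _)) // card_ffun !card_ord.
  apply: (@le_trans _ _ (2 ^+ N.+1 * C * (rho ^+ N.+1 / K.+1%:R ^+ N.+1) * K.+1%:R ^+ N)).
    rewrite ler_wpM2l -?natrX ?ler_nat //.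
    by rewrite !mulr_ge0 ?invr_ge0 ?exprn_ge0 // ltW.
  rewrite le_eqVlt; apply/orP; left; apply/eqP.
  rewrite -!mulrA; do 3 congr (_ * _).
  by rewrite exprS invfM -mulrA mulVf ?mulr1 // expf_neq0.
Qed.

(** Differentiability is assumed only at the points in question, so no implicit function theorem
    applies. Each point records the coordinate [l] of its largest partial derivative, a scale [d] up
    to which the linear approximation is good, and a cube of side [d / 2]. Points with the same
    record satisfy the Lipschitz-graph inequality, and there are countably many records. *)
Lemma null_set_zero_regular N (h : 'rV[R]_N -> R) : (0 < N)%N ->
  Defs.null_set [set x | [/\ h x = 0, differentiable h x & exists v, 'd h x v != 0]].
Proof.
move=> N0; set A := [set x | _].
(* With [p] the largest partial derivative, [t] the difference along [l] and [q] a bound of the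
   other differences, an approximation error of [p / 2] per unit gives
   [p * t <= N * p * q + p / 2 * (t + q)], that is [t <= (2 * N + 1) * q]. *)
pose C : R := 2 * N%:R + 1.
have C0 : 0 < C by rewrite /C ltr_wpDl // mulr_ge0.
pose B (i : 'I_N * nat * {ffun 'I_N -> int}) : set 'rV[R]_N :=
  let: (l, k, z) := i in let d : R := k.+1%:R^-1 in
  [set x | [/\ A x, (forall y, A y -> `|y - x| < d -> forall q, 0 <= q ->
     (forall j, j != l -> `|y 0 j - x 0 j| <= q) -> `|y 0 l - x 0 l| <= C * q) &
     forall j, d / 2 * (z j)%:~R <= x 0 j < d / 2 * (z j)%:~R + d / 2]].
apply: (@null_set_sub _ _ (\bigcup_i B i)); last first.
  apply: null_set_bigcup => // -[[l k] z].
  have d0 : (0 : R) < k.+1%:R^-1 by rewrite invr_gt0.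
  set d : R := k.+1%:R^-1 in d0.
  apply: (@null_set_lipschitz_graph _ l C (d / 2) (\row_j (d / 2 * (z j)%:~R))) => //.
  - by rewrite divr_gt0.
  - by move=> x [_ _ Hz] j; rewrite mxE; exact: Hz.
  - move=> x y [_ Hx zx] [Ay _ zy] q q0 Hq; apply: Hx => //.
    apply: (@le_lt_trans _ _ (d / 2)); last by rewrite ltr_pdivrMr // ltr_pMr // ltr1n.
    apply/rV_norm_leP => [|j]; first by rewrite divr_ge0 // ltW.
    by rewrite !mxE ler_norml; move: (zx j) (zy j); rewrite -/d; lra.
move=> x Ax; have [hx dh [v hv]] := Ax.
pose p j := `|'d h x ('e_j)|.
have dE y : 'd h x y = \sum_(j < N) y 0 j * 'd h x 'e_j.
  rewrite {1}[y]row_sum_delta linear_sum; apply: eq_bigr => j _.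
  by rewrite linearZ.
pose j0 : 'I_N := Ordinal N0.
have [l lmax] : exists l, forall j, p j <= p l.
  exists [arg max_(i > j0) p i]%O; case: arg_maxP => // i _ H j; exact: H.
have pl0 : 0 < p l.
  rewrite lt_neqAle normr_ge0 andbT eq_sym; apply: contra hv => /eqP pl.
  rewrite dE big1 // => j _; have := lmax j; rewrite pl normr_le0 => /eqP ->.
  by rewrite mulr0.
have [d d0 Hd] := differentiable_norm_le dh (divr_gt0 pl0 (ltr0Sn _ 1)).
pose k := Num.truncn d^-1.
have kd : k.+1%:R^-1 < d.
  by rewrite -[d]invrK ltf_pV2 ?posrE ?invr_gt0 // truncnS_gt.
set d' : R := k.+1%:R^-1 in kd.
have d'0 : 0 < d' by rewrite invr_gt0.
pose z := [ffun j => Num.floor (x 0 j / (d' / 2))].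
exists ((l, k), z) => //; split=> // [y [hy _ _] yx q q0 Hq|j]; last first.
  rewrite ffunE -/d'; have := floor_itv (x 0 j / (d' / 2)).
  have d'2 : 0 < d' / 2 by rewrite divr_gt0.
  rewrite ler_pdivlMr // ltr_pdivrMr // intrD mulrDl mul1r => /andP[h1 h2].
  by rewrite [X in X <= _]mulrC h1 [X in _ < X + _]mulrC h2.
have := Hd y (lt_trans yx kd); rewrite hy hx subrr sub0r normrN dE (bigD1 l) //=.
set t := `|y 0 l - x 0 l|.
rewrite !mxE; set rest := \sum_(i < N | _) _ => Hn.
have rest_le : `|rest| <= N%:R * p l * q.
  apply: le_trans (ler_norm_sum _ _ _) _.
  apply: (@le_trans _ _ (\sum_(i < N | i != l) p l * q)).
    apply: ler_sum => i il; rewrite normrM mulrC !mxE.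
    by rewrite ler_pM //; [exact: lmax|exact: Hq].
  rewrite sumr_const -[leLHS]mulr_natr [leLHS]mulrC -[leRHS]mulrA.
  rewrite ler_wpM2r ?ler_nat //; first by rewrite mulr_ge0 // ltW.
  by rewrite (leq_trans (max_card _)) // card_ord.
have nyx : `|y - x| <= t + q.
  apply/rV_norm_leP => [|j]; first by rewrite addr_ge0 // normr_ge0.
  rewrite !mxE; case: (eqVneq j l) => [->|jl]; first by rewrite lerDl.
  by apply: (le_trans (Hq j jl)); rewrite lerDr normr_ge0.
have E : `|(y 0 l - x 0 l) * 'd h x 'e_l| = t * p l by rewrite normrM.
have Hn2 : t * p l - `|rest| <= p l / 2 * (t + q).
  apply: le_trans (le_trans Hn _); last by rewrite ler_pM2l // divr_gt0.
  by rewrite -E; have := lerB_normD ((y 0 l - x 0 l) * 'd h x 'e_l) rest.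
rewrite -(ler_pM2r pl0) /C; nra.
Qed.

End NullSets.

(** * Lipschitz functions along almost every line *)

Section GenericLine.
Context {R : realType}.
Notation mu := (@lebesgue_measure R).

(* The times at which the coordinate [y + s * v] of a moving point lies in [[lo, hi]]. *)
Definition strip (lo hi v y : R) : set R := [set s : R | lo <= y + s * v <= hi].

(* Averaging over [y] and exchanging the integrals over [y] and [s] replaces the strip by the
   factor [hi k - lo k]; Markov's inequality then selects [y]. *)
Lemma generic_coordinate (A : nat -> set R) (w lo hi : nat -> R) (v p del C : R) :
  0 < del -> 0 < C -> (forall k, measurable (A k)) -> (forall k, 0 <= w k) ->
  (forall k, lo k <= hi k) ->
  (\sum_(k <oo) ((w k)%:E * ((hi k - lo k)%:E * mu (A k))) <= C%:E)%E ->
  exists2 y, p <= y <= p + del &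
  (\sum_(k <oo) ((w k)%:E * mu (A k `&` strip (lo k) (hi k) v y)) <= (2 / del * C)%:E)%E.
Proof.
move=> del0 C0 mA w0 lohi HC.
apply: contrapT => Hn0.
have Hn y : p <= y <= p + del ->
    ((2 / del * C)%:E <= \sum_(k <oo) ((w k)%:E * mu (A k `&` strip (lo k) (hi k) v y)))%E.
  by move=> py; rewrite leNgt; apply/negP => /ltW H; apply: Hn0; exists y.
have D0 : (0 : R) <= 2 / del * C by rewrite !mulr_ge0 ?invr_ge0 // ltW.
pose B0 k : set (R * R) := [set z | [/\ `[p, p + del]%classic z.1, A k z.2 &
   lo k <= z.1 + z.2 * v <= hi k]].
have mB0 k : measurable (B0 k).
  have -> : B0 k = (`[p, p + del]%classic `*` A k) `&`
      (setT `&` (fun z : R * R => z.1 + z.2 * v) @^-1` `[lo k, hi k]%classic).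
    apply/seteqP; split=> -[y s] /=; rewrite !in_itv /=.
      by move=> [? ? ?].
    by move=> [[? ?] [_ ?]].
  apply: measurableI; first by apply: measurableX => //; exact: measurable_itv.
  have mf : measurable_fun setT (fun z : R * R => z.1 + z.2 * v).
    apply: measurable_funD; first exact: measurable_fst.
    by apply: measurable_funM; [exact: measurable_snd|exact: measurable_cst].
  by apply: mf => //; exact: measurable_itv.
pose B k : set (measurableTypeR R * measurableTypeR R) := B0 k.
have mB k : measurable (B k) by exact: mB0.
pose F k y := mu (xsection (B k) y).
pose G k s := mu (ysection (B k) s).
have FG k : (\int[mu]_y F k y = \int[mu]_s G k s)%E.
  have := indic_fubini_tonelli mu mu (mB k).
  by rewrite indic_fubini_tonelli_FE // indic_fubini_tonelli_GE.
have mF k : measurable_fun setT (F k) by exact: measurable_fun_xsection.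
have mG k : measurable_fun setT (G k) by exact: measurable_fun_ysection.
have GE k s : (G k s <= (hi k - lo k)%:E * (\1_(A k) s)%:E)%E.
  rewrite /G indicE; have [sA|sA] := boolP (s \in A k); last first.
    rewrite mule0 (_ : ysection _ _ = set0) ?measure0 //.
    apply/seteqP; split=> // y /= /set_mem[_ /= As _].
    by case/negP: sA; exact/mem_set.
  rewrite mule1.
  have -> : (hi k - lo k)%:E = mu `[lo k - s * v, hi k - s * v]%classic.
    rewrite lebesgue_measure_itv /= lte_fin; case: ltP => [_|].
      by congr (_%:E); lra.
    by move=> h; congr (_%:E); have := lohi k; lra.
  apply: le_measure; rewrite ?inE; [exact: measurable_ysection|exact: measurable_itv|].
  move=> y /= /set_mem[_ _ /=]; rewrite in_itv /=; lra.
have intG k : (\int[mu]_s G k s <= (hi k - lo k)%:E * mu (A k))%E.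
  apply: (@le_trans _ _ (\int[mu]_s ((hi k - lo k)%:E * (\1_(A k) s)%:E))%E).
    apply: ge0_le_integral => //.
    apply: measurable_funeM; apply/measurable_EFinP; apply: measurable_indic; exact: mA.
  rewrite ge0_integralZl_EFin ?subr_ge0 //.
  - rewrite integral_indic; [by rewrite setIT|exact: measurableT|exact: mA]. 
  - apply/measurable_EFinP; apply: measurable_indic; exact: mA.
have mwF k : measurable_fun setT (fun y => (w k)%:E * F k y)%E by exact: measurable_funeM.
have wF0 k y : (0 <= (w k)%:E * F k y)%E by rewrite mule_ge0 // lee_fin.
have intF : (\int[mu]_y (\sum_(k <oo) ((w k)%:E * F k y)) <= C%:E)%E.
  rewrite integral_nneseries //.
  apply: le_trans HC; apply: lee_nneseries => [k _ _|k _].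
    by apply: integral_ge0.
  rewrite ge0_integralZl_EFin // FG; apply: lee_wpmul2l; rewrite ?lee_fin //.
have sec k y : p <= y <= p + del ->
    xsection (B k) y = A k `&` strip (lo k) (hi k) v y.
  move=> py; apply/seteqP; split=> s; rewrite /xsection /= inE.
    by move=> [_ /= ? ?].
  by move=> [? ?]; split=> //=; rewrite in_itv.
pose D : set (measurableTypeR R) := `[p, p + del]%classic.
have mD : measurable D by exact: measurable_itv.
(* If every [y] in [[p, p + del]] violated the bound, integration over this interval of length [del]
   would give [2 * C <= C], against [0 < C]. *)
have : ((2 * C)%R%:E <= C%:E)%E.
  apply: le_trans intF.
  apply: (@le_trans _ _ (\int[mu]_(y in D) (\sum_(k <oo) ((w k)%:E * F k y)))%E); last first.
    apply: ge0_subset_integral => //.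
      by apply: ge0_emeasurable_sum.
    by move=> y _; apply: nneseries_ge0.
  apply: (@le_trans _ _ (\int[mu]_(y in D) (cst (2 / del * C)%:E y))%E).
    rewrite integral_cst; last exact: mD.
    rewrite [X in (_ <= _ * X)%E](_ : _ = del%:E); last first.
      by rewrite /= lebesgue_measure_itv /= lte_fin ltrDl del0 -EFinB; congr (_%:E); lra.
    by rewrite -EFinM lee_fin mulrAC divfK // gt_eqF.
  apply: ge0_le_integral => //.
  - apply: measurable_funTS; exact: ge0_emeasurable_sum.
  move=> y; rewrite /D /= in_itv /= => py.
  have -> : (\sum_(k <oo) ((w k)%:E * F k y))%E = 
    (\sum_(k <oo) ((w k)%:E * mu (A k `&` strip (lo k) (hi k) v y)))%E.
    by apply: eq_eseriesr => k _; rewrite /F sec.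
  exact: Hn.
by rewrite lee_fin; lra.
Qed.

Lemma strip_measurable lo hi v y : measurable (strip lo hi v y).
Proof.
apply: is_interval_measurable => s t /andP[s1 s2] /andP[t1 t2] r /andP[sr rt].
apply/andP; case: (leP 0 v) => v0.
  have : s * v <= r * v by rewrite ler_wpM2r.
  have : r * v <= t * v by rewrite ler_wpM2r.
  by split; lra.
have : r * v <= s * v by rewrite ler_wnM2r // ltW.
have : t * v <= r * v by rewrite ler_wnM2r // ltW.
by split; lra.
Qed.

Lemma nneseries_le_sum (u : nat -> \bar R) (C : \bar R) : (forall k, 0 <= u k)%E ->
  (forall m, \sum_(k < m) u k <= C)%E -> (\sum_(k <oo) u k <= C)%E.
Proof.
move=> u0 H; apply: lime_le; first exact: is_cvg_nneseries.
by apply: nearW => m; rewrite big_mkord.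
Qed.

Definition box_times N (a b y v : 'rV[R]_N) (h : R) : set R :=
  `[0, h]%classic `&` [set s : R | in_box a b (y + s *: v)].

(** Induction on the number [m] of coordinates already chosen: [A m y k] keeps the times compatible
    with the first [m] sides of box [k], and [w m k] is the product of its remaining sides. Each
    choice trades one side length for a factor [2 / del]; at [m = 0] the sum is [h] times the volume
    of the covering. *)
Lemma generic_line_boxes N (a b : nat -> 'rV[R]_N) (x v : 'rV[R]_N) (h del C e : R) :
  0 < del -> 0 < h -> 0 < C -> h * e <= C ->
  (forall k j, a k 0 j <= b k 0 j) ->
  (forall m, \sum_(k < m) box_vol (a k) (b k) <= e) ->
  exists y : 'rV[R]_N, (forall j, x 0 j <= y 0 j <= x 0 j + del) /\
   (\sum_(k <oo) mu (box_times (a k) (b k) y v h)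
     <= ((2 / del) ^+ N * C)%:E)%E.
Proof.
move=> del0 h0 C0 heC ab vol.
pose A m (y : 'rV[R]_N) k := `[0, h]%classic `&`
  [set s | forall j : 'I_N, (j < m)%N -> strip (a k 0 j) (b k 0 j) (v 0 j) (y 0 j) s].
pose w m k := \prod_(j < N | (m <= j)%N) (b k 0 j - a k 0 j).
have w0 m k : 0 <= w m k by apply: prodr_ge0 => j _; rewrite subr_ge0.
have mA m y k : measurable (A m y k).
  apply: measurableI; first exact: measurable_itv.
  rewrite (_ : mkset _ = \bigcap_(j in [set j : 'I_N | (j < m)%N])
     strip (a k 0 j) (b k 0 j) (v 0 j) (y 0 j)); last by apply/seteqP; split=> s.
  apply: fin_bigcap_measurable; first exact: finite_finset.
  by move=> j _; exact: strip_measurable.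
suff H m : (m <= N)%N -> exists y : 'rV[R]_N, (forall j, x 0 j <= y 0 j <= x 0 j + del) /\
   (\sum_(k <oo) ((w m k)%:E * mu (A m y k)) <= ((2 / del) ^+ m * C)%:E)%E.
  have [y [xy Hy]] := H N (leqnn N); exists y; split=> //.
  apply: le_trans Hy; rewrite le_eqVlt; apply/orP; left; apply/eqP.
  apply: eq_eseriesr => k _; rewrite /w big_pred0 ?mul1e; last first.
    by move=> j; rewrite leqNgt ltn_ord.
  congr (mu _); apply/seteqP; split=> s [? H2]; split=> //.
    by move=> j _; have := H2 j; rewrite !mxE.
  by move=> j; rewrite !mxE; exact: H2.
elim: m => [_|m IH mN].
  exists x; split; first by move=> j; rewrite lexx lerDl ltW.
  apply: nneseries_le_sum => [k|m]; first by rewrite mule_ge0 // lee_fin.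
  apply: (@le_trans _ _ (\sum_(k < m) (h * w 0%N k)%:E)%E).
    apply: lee_sum => k _; rewrite mulrC EFinM; apply: lee_wpmul2l; first by rewrite lee_fin.
    have -> : h%:E = mu `[0, h]%classic.
      by rewrite lebesgue_measure_itv /= lte_fin h0 sube0.
    apply: le_measure; rewrite ?inE; [exact: mA|exact: measurable_itv|].
    by move=> s [].
  rewrite sumEFin lee_fin -mulr_sumr expr0 mul1r; apply: le_trans heC.
  by rewrite ler_pM2l.
have [y [xy Hy]] := IH (ltnW mN).
pose jm := Ordinal mN.
have [|||||z xz Hz] := @generic_coordinate (A m y) (w m.+1) (fun k => a k 0 jm)
   (fun k => b k 0 jm) (v 0 jm) (x 0 jm) del ((2 / del) ^+ m * C) del0.
- by rewrite mulr_gt0 // exprn_gt0 // divr_gt0.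
- exact: mA.
- exact: w0.
- by move=> k; exact: ab.
- apply: le_trans Hy; rewrite le_eqVlt; apply/orP; left; apply/eqP.
  apply: eq_eseriesr => k _; rewrite muleA -EFinM; congr (_%:E * _)%E.
  rewrite /w [RHS](bigD1 jm) //= mulrC; congr (_ * _); apply: eq_bigl => j.
  by rewrite ltn_neqAle -val_eqE /= eq_sym andbC.
exists (\row_j (if j == jm then z else y 0 j)); split.
  by move=> j; rewrite mxE; case: eqP => [->|].
rewrite exprS -mulrA; apply: le_trans Hz; rewrite le_eqVlt; apply/orP; left; apply/eqP.
apply: eq_eseriesr => k _; congr (_ * mu _)%E.
apply/seteqP; split=> s.
  move=> [? H]; split; first split=> // j jm'.
    have := H j (ltnW jm'); rewrite mxE; case: eqP => // E.
    by move: jm'; rewrite E /= ltnn.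
  by have := H jm (ltnSn _); rewrite mxE eqxx.
move=> [[? H1] H2]; split=> // j; rewrite ltnS leq_eqVlt mxE => /orP[/eqP E|jm'].
  by have -> : j = jm; [exact: val_inj|rewrite eqxx].
case: eqP => [->//|_]; exact: H1.
Qed.

Lemma generic_line N (E : set 'rV[R]_N) (x v : 'rV[R]_N) (h del eta : R) :
  Defs.null_set E -> 0 < del -> 0 < h -> 0 < eta ->
  exists (y : 'rV[R]_N) (U : set R), [/\ forall j, x 0 j <= y 0 j <= x 0 j + del,
    open U, (mu U <= eta%:E)%E & forall s, 0 <= s <= h -> E (y + s *: v) -> U s].
Proof.
move=> nE del0 h0 eta0.
pose q := (2 / del) ^+ N.
have q0 : 0 < q by rewrite exprn_gt0 // divr_gt0.
(* The choice of [N] coordinates costs the factor [q], so a covering of volume [C / h] leaves bad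
   times of measure at most [eta / 2]; the other half of [eta] pays for the open superset given by
   outer regularity. *)
pose C := eta / 2 / q.
have C0 : 0 < C by rewrite !divr_gt0.
have [a [b [ab Eab vol]]] := nE (C / h) (divr_gt0 C0 h0).
have [|y [xy Hy]] := generic_line_boxes x v del0 h0 C0 _ ab vol.
  by rewrite mulrC divfK // gt_eqF.
rewrite -/q mulrC divfK ?gt_eqF // in Hy.
pose A k := box_times (a k) (b k) y v h.
have mA k : measurable (A k).
  apply: measurableI; first exact: measurable_itv.
  rewrite (_ : mkset _ = \bigcap_(j in [set: 'I_N])
     strip (a k 0 j) (b k 0 j) (v 0 j) (y 0 j)); last first.
    by apply/seteqP; split=> s H j; [move=> _|]; have := H j; rewrite !mxE //; apply.
  apply: fin_bigcap_measurable; first exact: finite_finset.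
  by move=> j _; exact: strip_measurable.
pose D := \bigcup_k A k.
have mD : measurable D by exact: bigcup_measurable.
have muD : (mu D <= (eta / 2)%:E)%E.
  apply: le_trans Hy; apply: measure_sigma_subadditive => //.
have [||U [oU DU UD]] := @lebesgue_regularity_outer R D (eta / 2) mD.
- exact: le_lt_trans muD (ltry _).
- by rewrite divr_gt0.
exists y, U; split=> //.
- rewrite -(setDUK DU).
  have mU : measurable U by exact: open_measurable.
  apply: le_trans (measureU2 _ _ _) _; [exact: mD|exact: measurableD|].
  rewrite (_ : eta%:E = (eta / 2)%:E + (eta / 2)%:E)%E; last by rewrite -EFinD; congr (_%:E); lra.
  by rewrite leeD // ltW.
- move=> s sh Es; apply: DU; have [k _ Hk] := Eab _ Es; exists k.
  by []. split; [by rewrite /= in_itv|exact: Hk].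
Qed.

End GenericLine.

(** * From almost everywhere decay to a pointwise Dini inequality *)

Section DirectionalDecay.
Context {R : realType}.

Lemma diff_norm_le (W : normedModType R) (V : W -> R) (y w : W) (L r : R) :
  0 <= L -> 0 < r -> differentiable V y ->
  (forall z, `|z - y| < r -> `|V z - V y| <= L * `|z - y|) ->
  `|'d V y w| <= L * `|w|.
Proof.
move=> L0 r0 dV lip.
have [->|w0] := eqVneq w 0; first by rewrite linear0 !normr0 mulr0.
have nw0 : 0 < `|w| by rewrite normr_gt0.
apply/ler_addgt0Pr => e e0.
have [d d0 Hd] := differentiable_norm_le dV (divr_gt0 e0 nw0).
pose t := Num.min d r / 2 / `|w|.
have t0 : 0 < t by rewrite !divr_gt0 // lt_min d0.
have ntw : `|t *: w| = Num.min d r / 2.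
  by rewrite normrZ gtr0_norm // /t divfK // gt_eqF.
have mtw : `|t *: w| < Num.min d r.
  by rewrite ntw ltr_pdivrMr // ltr_pMr ?ltr1n // lt_min d0.
have E1 : y + t *: w - y = t *: w by rewrite addrC addKr.
have E2 : 'd V y (t *: w) = t * 'd V y w by rewrite linearZ.
have := Hd (y + t *: w); have := lip (y + t *: w).
rewrite E1 E2; move: mtw; rewrite lt_min => /andP[td tr] /(_ tr) h1 /(_ td) h2.
have : `|t * 'd V y w| <= L * `|t *: w| + e / `|w| * `|t *: w|.
  by move: h1 h2; rewrite !ler_norml; lra.
have -> : `|t *: w| = t * `|w| by rewrite normrZ gtr0_norm.
have -> : `|t * 'd V y w| = t * `|'d V y w| by rewrite normrM gtr0_norm.
have -> : L * (t * `|w|) + e / `|w| * (t * `|w|) = t * (L * `|w| + e).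
  by field; rewrite gt_eqF.
by rewrite ler_pM2l.
Qed.

Lemma ae_directional_increment N (V : 'rV[R]_N -> R) (E : set 'rV[R]_N)
    (x0 v : 'rV[R]_N) (m L r : R) :
  Defs.null_set E -> 0 <= L -> 0 < r ->
  (forall y z, `|y - x0| < r -> `|z - x0| < r -> `|V y - V z| <= L * `|y - z|) ->
  (forall y, `|y - x0| < r -> ~ E y -> differentiable V y /\ 'd V y v <= m) ->
  exists2 d, 0 < d & forall h, 0 < h -> h < d -> V (x0 + h *: v) <= V x0 + m * h.
Proof.
move=> nE L0 r0 lip dV.
have v1 : 0 < `|v| + 1 by rewrite ltr_wpDl.
exists (r / 2 / (`|v| + 1)); first by rewrite !divr_gt0.
move=> h h0; rewrite ltr_pdivlMr // => hd.
have hv s : 0 <= s -> s <= h -> `|s *: v| < r / 2.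
  move=> s0 sh; rewrite normrZ ger0_norm //; apply: le_lt_trans hd.
  by rewrite ler_pM // lerDl.
apply/ler_addgt0Pr => e e0.
pose L1 := 4 * (L + 1).
have L10 : 0 < L1 by rewrite mulr_gt0 // ltr_wpDl.
pose K := L * `|v|.
have K0 : 0 <= K by rewrite mulr_ge0.
pose K1 := 2 * (K + `|m| + 1).
have K10 : 0 < K1 by rewrite mulr_gt0 // ltr_wpDl // addr_ge0.
(* Half of the error [e] pays for moving both ends of the segment, at cost [2 * L * del]; the other
   half pays for the bad times, of measure at most [e / K1]. The bound [r / 4] keeps the parallel
   segment in the ball. *)
pose del := Num.min (r / 4) (e / L1).
have del0 : 0 < del by rewrite lt_min !divr_gt0.
have [y [U [xy oU muU EU]]] := generic_line x0 v nE del0 h0 (divr_gt0 e0 K10).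
have yx : `|y - x0| <= del.
  apply/rV_norm_leP; first exact: ltW.
  by move=> j; rewrite !mxE ler_norml; have := xy j; lra.
have delr : del <= r / 4 by rewrite /del ge_min lexx.
have dele : del <= e / L1 by rewrite /del ge_min lexx orbT.
have yr s : 0 <= s -> s <= h -> `|y + s *: v - x0| < r.
  move=> s0 sh; rewrite addrAC; apply: le_lt_trans (ler_normD _ _) _.
  by have := hv s s0 sh; lra.
pose phi s := V (y + s *: v).
have := @lipschitz_increment_le R h K m (e / K1) phi U h0 K0 oU muU.
have philip s t : 0 <= s -> s <= t -> t <= h -> `|phi t - phi s| <= K * (t - s).
  move=> s0 st th; apply: le_trans (lip _ _ _ _) _; [apply: yr; lra|apply: yr; lra|].
  rewrite opprD addrACA subrr add0r -scalerBl normrZ ger0_norm ?subr_ge0 //.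
  by rewrite /K; lra.
move=> /(_ philip) /(_ _)/wrap[].
  move=> s s0 sh nU e' e'0.
  have nEs : ~ E (y + s *: v) by move=> /EU; rewrite s0 (ltW sh) => /(_ isT).
  have [dVs dVm] := dV _ (yr s s0 (ltW sh)) nEs.
  have [d d0 Hd] := differentiable_norm_le dVs (divr_gt0 e'0 v1).
  exists (d / (`|v| + 1)); first by rewrite divr_gt0.
  move=> k k0; rewrite ltr_pdivlMr // => kd skh.
  have nk : `|k *: v| <= k * (`|v| + 1).
    by rewrite normrZ gtr0_norm // ler_pM2l // lerDl.
  have := Hd (y + (s + k) *: v).
  have -> : y + (s + k) *: v - (y + s *: v) = k *: v.
    by rewrite scalerDl addrA (addrC _ (k *: v)) addrK.
  have E2 : 'd V (y + s *: v) (k *: v) = k * 'd V (y + s *: v) v by rewrite linearZ.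
  move=> /(_ (le_lt_trans nk kd)); rewrite E2 -/(phi _) -/(phi _).
  rewrite ler_norml => /andP[_ H].
  have : e' / (`|v| + 1) * `|k *: v| <= e' * k.
    rewrite -mulrA ler_pM2l // mulrC ler_pdivrMr //.
  have : k * 'd V (y + s *: v) v <= k * m by rewrite ler_pM2l.
  by lra.
move=> main.
have e1 : `|V (x0 + h *: v) - phi h| <= L * del.
  apply: le_trans (lip _ _ _ _) _.
  - have -> : x0 + h *: v - x0 = h *: v by rewrite addrAC subrr add0r.
    by have := hv h (ltW h0) (lexx h); lra.
  - exact: yr (ltW h0) (lexx h).
  by rewrite opprD addrACA subrr addr0 -normrN opprB ler_wpM2l.
have e2 : `|phi 0 - V x0| <= L * del.
  rewrite /phi scale0r addr0; apply: le_trans (lip _ _ _ _) _; last by rewrite ler_wpM2l.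
    by lra.
  by rewrite subrr normr0.
have Ld : 4 * (L * del) <= e.
  have : L1 * del <= e by rewrite mulrC -ler_pdivlMr.
  by rewrite /L1; lra.
have Km : 2 * ((K + `|m|) * (e / K1)) <= e.
  have : K1 * (e / K1) = e by rewrite mulrC divfK // gt_eqF.
  have : 0 <= e / K1 by rewrite divr_ge0 // ltW.
  by rewrite /K1; move: (e / _) => q; nra.
move: e1 e2; rewrite !ler_norml; lra.
Qed.

(** Decay at a nearby point [y] concerns the direction [f y u0], whereas the increment needs the
    fixed direction [f x0 u0]; the local Lipschitz bounds of [f] and [V] absorb the change. The
    strict inequality at [x0] keeps the gain condition true at the points [y]. *)
Lemma dini_decay_flow N M (f : 'rV[R]_N -> 'rV[R]_M -> 'rV[R]_N) (V : 'rV[R]_N -> R)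
    (gamma : R -> R) (c : R) (E : set 'rV[R]_N) (x0 : 'rV[R]_N) (u0 : 'rV[R]_M) :
  loc_lip2 f -> loc_lip_off0 V -> Defs.null_set E ->
  (forall x, ~ E x -> differentiable V x /\
     forall u, gamma `|u| <= V x -> 'd V x (f x u) <= - c * V x) ->
  x0 != 0 -> gamma `|u0| < V x0 ->
  forall e, 0 < e -> exists2 d, 0 < d & forall h, 0 < h -> h < d ->
    V (x0 + h *: f x0 u0) <= V x0 + (- c * V x0 + e) * h.
Proof.
move=> lipf lipV nE dV x00 gV e e0.
have [r [L0 [r0 HL0]]] := lipV x0 x00.
have [rf [Lf0 [rf0 HLf0]]] := lipf x0 u0.
pose L := Num.max 0 L0; pose Lf := Num.max 0 Lf0.
have L_ge0 : 0 <= L by rewrite /L le_max lexx.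
have Lf_ge0 : 0 <= Lf by rewrite /Lf le_max lexx.
have HL y z : `|y - x0| < r -> `|z - x0| < r -> `|V y - V z| <= L * `|y - z|.
  by move=> yr zr; apply: le_trans (HL0 y z yr zr) _; rewrite ler_wpM2r // /L le_max lexx orbT.
have HLf y : `|y - x0| < rf -> `|f y u0 - f x0 u0| <= Lf * `|y - x0|.
  move=> yr; apply: le_trans (HLf0 y x0 u0 u0 yr _ _ _) _; rewrite ?subrr ?normr0 //.
  by rewrite addr0 ler_wpM2r // /Lf le_max lexx orbT.
(* [L * Lf] accounts for replacing [f y u0] by [f x0 u0] under the differential, [|c| * L] for
   replacing [V y] by [V x0]. *)
pose C := L * Lf + `|c| * L + 1.
have C0 : 0 < C by rewrite ltr_wpDl // addr_ge0 // mulr_ge0.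
pose g := V x0 - gamma `|u0|.
have g0 : 0 < g by rewrite subr_gt0.
pose rho := Num.min (Num.min r rf) (Num.min (e / C) (g / (L + 1))).
have L1 : 0 < L + 1 by rewrite ltr_wpDl.
have rho0 : 0 < rho by rewrite !lt_min r0 rf0 !divr_gt0.
apply: (@ae_directional_increment N V E x0 (f x0 u0) (- c * V x0 + e) L rho) => //.
  move=> y z; rewrite !lt_min => /andP[/andP[yr _] _] /andP[/andP[zr _] _].
  exact: HL.
move=> y; rewrite !lt_min => /andP[/andP[yr yrf] /andP[ye yg]] nEy.
have [dVy Hy] := dV y nEy; split=> //.
have Vy : `|V y - V x0| <= L * `|y - x0| by apply: HL => //; rewrite subrr normr0.
have gVy : gamma `|u0| <= V y.
  move: yg; rewrite ltr_pdivlMr // => yg.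
  have : L * `|y - x0| <= `|y - x0| * (L + 1) by have := normr_ge0 (y - x0); nra.
  by move: Vy; rewrite ler_norml /g in yg *; lra.
have := Hy u0 gVy => H1.
have H2 : `|'d V y (f x0 u0 - f y u0)| <= L * `|f x0 u0 - f y u0|.
  have r1 : 0 < r - `|y - x0| by rewrite subr_gt0.
  apply: (@diff_norm_le _ V y _ L _ L_ge0 r1 dVy) => z zy; apply: HL => //.
  have -> : z - x0 = (z - y) + (y - x0) by rewrite addrA subrK.
  by apply: le_lt_trans (ler_normD _ _) _; lra.
have H3 : `|f x0 u0 - f y u0| <= Lf * `|y - x0| by rewrite distrC; exact: HLf.
have -> : f x0 u0 = f y u0 + (f x0 u0 - f y u0) by rewrite addrC subrK.
rewrite linearD /=.
have H4 : L * `|f x0 u0 - f y u0| <= L * (Lf * `|y - x0|) by rewrite ler_wpM2l.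
have H5 : - c * V y <= - c * V x0 + `|c| * (L * `|y - x0|).
  have : `|c * (V x0 - V y)| <= `|c| * (L * `|y - x0|).
    by rewrite normrM ler_wpM2l // distrC.
  by rewrite ler_norml; lra.
have H6 : C * `|y - x0| <= e by rewrite mulrC -ler_pdivlMr // ltW.
have H7 := normr_ge0 (y - x0).
move: H2; rewrite ler_norml /C in H6 *; lra.
Qed.

End DirectionalDecay.

(** * Comparison functions *)

Section ComparisonFunctions.
Context {R : realType}.
Implicit Types f g : R -> R.

Lemma within_ge0_continuousP f :
  {within [set r | 0 <= r], continuous f} <->
  (forall x, 0 <= x -> forall e, 0 < e -> exists2 d, 0 < d &
     forall y, 0 <= y -> `|y - x| < d -> `|f y - f x| < e).
Proof.
split.
  move=> /subspace_continuousP H x x0 e e0.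
  have /cvgrPdist_lt /(_ _ e0) /nbhs_normP[d /= d0 Hd] := H x x0.
  exists d => // y y0 yx; rewrite distrC; apply: Hd => //=.
  by rewrite distrC.
move=> H; apply/subspace_continuousP => x x0; apply/cvgrPdist_lt => e e0.
have [d d0 Hd] := H x x0 e e0.
apply/nbhs_normP; exists d => //= y yx y0; rewrite distrC; apply: Hd => //.
by rewrite distrC.
Qed.

Lemma classK_le f : classK f -> forall x y, 0 <= x -> x <= y -> f x <= f y.
Proof.
move=> [_ _ inc] x y x0; rewrite le_eqVlt => /orP[/eqP->//|xy].
by apply: ltW; exact: inc.
Qed.

Lemma classK_ge0 f : classK f -> forall x, 0 <= x -> 0 <= f x.
Proof. by move=> Kf x x0; have [<- _ _] := Kf; exact: classK_le. Qed.

Lemma classK_comp f g : classK f -> classK g -> classK (fun r => f (g r)).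
Proof.
move=> Kf Kg; have [f0 fc finc] := Kf; have [g0 gc ginc] := Kg.
split; first by rewrite g0 f0.
- apply/within_ge0_continuousP => x x0 e e0.
  have /within_ge0_continuousP fc' := fc; have /within_ge0_continuousP gc' := gc.
  have [d d0 Hd] := fc' (g x) (classK_ge0 Kg x0) e e0.
  have [d' d'0 Hd'] := gc' x x0 d d0.
  by exists d' => // y y0 yx; apply: Hd; [exact: classK_ge0|exact: Hd'].
- by move=> r1 r2 r10 r12; apply: finc; [exact: classK_ge0|exact: ginc].
Qed.

Lemma classK_scale k f : 0 < k -> classK f -> classK (fun r => k * f r).
Proof.
move=> k0 [f0 fc finc]; split; first by rewrite f0 mulr0.
- apply/within_ge0_continuousP => x x0 e e0.
  move/within_ge0_continuousP: fc => /(_ x x0 _ (divr_gt0 e0 k0)) [d d0 Hd].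
  exists d => // y y0 yx; rewrite -mulrBr normrM gtr0_norm // mulrC.
  by rewrite -ltr_pdivlMr //; exact: Hd.
- by move=> r1 r2 r10 r12; rewrite ltr_pM2l //; exact: finc.
Qed.

Lemma classKinf_scale k f : 0 < k -> classKinf f -> classKinf (fun r => k * f r).
Proof.
move=> k0 [Kf uf]; split; first exact: classK_scale.
move=> K; have [r [r0 rK]] := uf (K / k); exists r; split=> //.
by rewrite mulrC -ler_pdivrMr.
Qed.

Lemma classKinf_comp f g : classKinf f -> classKinf g -> classKinf (fun r => f (g r)).
Proof.
move=> [Kf uf] [Kg ug]; split; first exact: classK_comp.
move=> K; have [r [r0 rK]] := uf K; have [s [s0 sr]] := ug r; exists s; split=> //.
by apply: le_trans rK _; exact: classK_le.
Qed.

Lemma classK_max f g : classK f -> classK g -> classK (fun r => Num.max (f r) (g r)).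
Proof.
move=> [f0 fc finc] [g0 gc ginc]; split; first by rewrite f0 g0 maxxx.
- apply/within_ge0_continuousP => x x0 e e0.
  move/within_ge0_continuousP: fc => /(_ x x0 _ e0) [d d0 Hd].
  move/within_ge0_continuousP: gc => /(_ x x0 _ e0) [d' d'0 Hd'].
  exists (Num.min d d'); first by rewrite lt_min d0.
  move=> y y0; rewrite lt_min => /andP[/(Hd y y0) + /(Hd' y y0)].
  by rewrite !ltr_norml; case: (leP (f y)); case: (leP (f x)); lra.
- by move=> r1 r2 r10 r12; rewrite gt_max !lt_max finc // ginc // orbT.
Qed.

Lemma classKinf_max f g : classKinf f -> classKinf g -> classKinf (fun r => Num.max (f r) (g r)).
Proof.
move=> [Kf uf] [Kg ug]; split; first exact: classK_max.
by move=> K; have [r [r0 rK]] := uf K; exists r; split=> //; rewrite le_max rK.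
Qed.

Lemma classKinf_inverse f : continuous f -> f 0 = 0 ->
  (forall x y, 0 <= x -> x < y -> f x < f y) ->
  (forall K, exists2 r, 0 <= r & K <= f r) ->
  exists2 g, classKinf g & forall r, 0 <= r -> g (f r) = r.
Proof.
move=> fc f0 finc fu.
have finj x y : 0 <= x -> 0 <= y -> f x = f y -> x = y.
  move=> x0 y0 fxy; case: (ltgtP x y) => // [xy|yx].
    by have := finc x y x0 xy; rewrite fxy ltxx.
  by have := finc y x y0 yx; rewrite fxy ltxx.
have ex v : exists r, 0 <= v -> 0 <= r /\ f r = v.
  case: (leP 0 v) => [v0|v0]; last by exists 0.
  have [r r0 vr] := fu v.
  have [||c /itvP cr fcv] := @IVT R f 0 r v r0.
  - by apply: continuous_subspaceT.
  - have f0r : 0 <= f r by lra.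
    by rewrite f0 (min_idPl f0r) (max_idPr f0r) v0.
  by exists c; split=> //; rewrite cr.
have [g Hg] := choice ex.
have gge0 v : 0 <= v -> 0 <= g v by case/Hg.
have fg v : 0 <= v -> f (g v) = v by case/Hg.
have fge0 r : 0 <= r -> 0 <= f r.
  rewrite le_eqVlt => /orP[/eqP <-|r0]; first by rewrite f0.
  by rewrite -[X in X <= _]f0 ltW // finc.
have gf r : 0 <= r -> g (f r) = r.
  by move=> r0; apply: finj; rewrite ?fg ?gge0 ?fge0.
have ginc v1 v2 : 0 <= v1 -> v1 < v2 -> g v1 < g v2.
  move=> v10 v12; have v20 : 0 <= v2 by lra.
  case: (ltP (g v1) (g v2)) => //; rewrite le_eqVlt => /orP[/eqP E|H].
    by move: v12; rewrite -(fg v1) // -(fg v2) // E ltxx.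
  by have := finc _ _ (gge0 _ v20) H; rewrite !fg //; lra.
exists g => //; split; last by move=> K; exists (f (Num.max 0 K)); rewrite gf ?fge0 ?le_max ?lexx ?orbT.
split=> //; first by rewrite -{1}f0 gf.
apply/within_ge0_continuousP => v v0 e e0.
set r := g v; have r0 : 0 <= r by exact: gge0.
have fr : f r = v by exact: fg.
have up : v < f (r + e) by rewrite -{1}fr finc //; lra.
have upb y : 0 <= y -> y < f (r + e) -> g y < r + e.
  move=> y0 yf; rewrite ltNge; apply/negP; rewrite le_eqVlt => /orP[/eqP E|H].
    by move: yf; rewrite E fg // ltxx.
  by have := finc _ _ _ H; rewrite fg // => /(_ ltac:(lra)); lra.
case: (ltP (r - e) 0) => re.
  exists (f (r + e) - v); first by lra.
  move=> y y0; rewrite ltr_norml => /andP[_ yv]; rewrite ltr_norml.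
  by have := upb y y0; have := gge0 y y0; lra.
have dn : f (r - e) < v by rewrite -{1}fr finc //; lra.
exists (Num.min (f (r + e) - v) (v - f (r - e))); first by rewrite lt_min; lra.
move=> y y0; rewrite lt_min ltr_norml => /andP[/andP[_ yv]].
rewrite ltr_norml => /andP[vy _]; rewrite ltr_norml.
have := upb y y0 ltac:(lra) => h1.
suff : r - e < g y by lra.
rewrite ltNge; apply/negP; rewrite le_eqVlt => /orP[/eqP E|H].
  by move: vy; rewrite -E fg //; lra.
by have := finc _ _ (gge0 y y0) H; rewrite fg //; lra.
Qed.

(* The lower bound of [B] by a class-Kinf function of [A] comes from the
   inf-convolution [r |-> inf_x (B x + max 0 (r - A x))], which is automatically
   1-Lipschitz and nondecreasing; the factor [r / (1 + r)] makes it strictly increasing. *)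
Lemma classKinf_majorant (X : Type) (A B : X -> R) (x0 : X) :
  (forall x, 0 <= A x) -> (forall x, 0 <= B x) -> B x0 = 0 ->
  (forall e, 0 < e -> exists2 d, 0 < d & forall x, B x < d -> A x < e) ->
  (forall K, exists K', forall x, K' <= A x -> K <= B x) ->
  exists2 psi, classKinf psi & forall x, A x <= psi (B x).
Proof.
move=> A0 B0 Bx0 small large.
pose S r := [set B x + Num.max 0 (r - A x) | x in [set: X]].
pose a r := inf (S r).
have S0 r : S r !=set0 by exists (B x0 + Num.max 0 (r - A x0)), x0.
have m0 (r : R) : 0 <= Num.max 0 r by rewrite le_max lexx.
have Slb r : has_lbound (S r) by exists 0 => _ [x _ <-]; rewrite addr_ge0.
have aB r x : a r <= B x + Num.max 0 (r - A x) by apply: ge_inf => //; exists x.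
have lea r y : (forall x, y <= B x + Num.max 0 (r - A x)) -> y <= a r.
  by move=> H; apply: lb_le_inf => // _ [x _ <-].
have a0 r : 0 <= a r by apply: lea => x; rewrite addr_ge0.
have aA x : a (A x) <= B x by apply: le_trans (aB _ x) _; rewrite subrr maxxx addr0.
have a00 : a 0 = 0.
  apply/eqP; rewrite eq_le a0 andbT; apply: le_trans (aB _ x0) _.
  by rewrite Bx0 add0r ge_max lexx sub0r oppr_le0 A0.
have amono r s : r <= s -> a r <= a s.
  move=> rs; apply: lea => x; apply: le_trans (aB r x) _.
  by rewrite lerD2l ge_max m0 le_max; apply/orP; right; lra.
have alip r s : r <= s -> a s <= a r + (s - r).
  move=> rs; rewrite -lerBlDr; apply: lea => x; rewrite lerBlDr.
  apply: le_trans (aB s x) _; rewrite -addrA lerD2l ge_max.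
  have h1 : 0 <= Num.max 0 (r - A x) by [].
  have h2 : r - A x <= Num.max 0 (r - A x) by rewrite le_max lexx orbT.
  by apply/andP; split; lra.
have apos r : 0 < r -> 0 < a r.
  move=> r0; have r20 : 0 < r / 2 by rewrite divr_gt0.
  have [d d0 Hd] := small _ r20.
  apply: (@lt_le_trans _ _ (Num.min d (r / 2))); first by rewrite lt_min d0.
  apply: lea => x; case: (ltP (B x) d) => [/Hd Ar|dB].
    rewrite ge_min; apply/orP; right; apply: le_trans (_ : _ <= Num.max 0 (r - A x)) _.
      by rewrite le_max; apply/orP; right; lra.
    by rewrite lerDr.
  by rewrite ge_min (le_trans dB) // lerDl.
have acont : continuous a.
  move=> r; apply/cvgrPdist_lt => e e0; apply/nbhs_normP; exists e => //= s rs.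
  apply: le_lt_trans rs; case: (leP r s) => rs'.
    by have := amono _ _ rs'; have := alip _ _ rs' => h1 h2; rewrite !ler0_norm; lra.
  by have := amono _ _ (ltW rs'); have := alip _ _ (ltW rs') => h1 h2; rewrite !ger0_norm; lra.
pose q (r : R) := 1 - (1 + `|r|)^-1.
pose f r := a r * q r.
have q1 (r : R) : 0 < 1 + `|r| by rewrite ltr_pwDl.
have fcont : continuous f.
  move=> r; apply: cvgM; first exact: acont.
  apply: cvgB; first exact: cvg_cst.
  apply: cvgV; first by rewrite gt_eqF.
  by apply: cvgD; [exact: cvg_cst|exact: norm_continuous].
have q0 r : 0 <= q r by rewrite subr_ge0 invf_le1 // lerDl.
have qlt1 r : q r < 1 by rewrite ltrBlDr ltrDl invr_gt0.
have qinc r s : 0 <= r -> r < s -> q r < q s.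
  move=> r0 rs; rewrite ltrD2l ltrN2 ltf_pV2 ?posrE // ltrD2l !ger0_norm //; lra.
have finc r s : 0 <= r -> r < s -> f r < f s.
  move=> r0 rs; rewrite /f; apply: le_lt_trans (_ : a s * q r < _).
    by rewrite ler_wpM2r // amono // ltW.
  by rewrite ltr_pM2l ?qinc // apos //; lra.
have funb K : exists2 r, 0 <= r & K <= f r.
  (* The factor [q r] is at least 1/2 as soon as [1 <= r]; hence twice the target. *)
  pose K1 := 2 * Num.max 0 K.
  have K10 : 0 <= K1 by rewrite mulr_ge0.
  have [K' HK'] := large K1.
  pose r := Num.max 1 (K' + K1).
  have r1 : 1 <= r by rewrite le_max lexx.
  have rK : K' + K1 <= r by rewrite le_max lexx orbT.
  exists r; first by lra.
  have aK : K1 <= a r.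
    apply: lea => x; case: (leP K' (A x)) => [/HK'|] h; first by rewrite (le_trans h) // lerDl.
    apply: le_trans (_ : r - A x <= _); first by lra.
    by rewrite (@le_trans _ _ (Num.max 0 (r - A x))) ?lerDr // le_max lexx orbT.
  have qr : 1 / 2 <= q r.
    have : (1 + `|r|)^-1 <= 2^-1.
      by rewrite lef_pV2 ?posrE // ger0_norm; lra.
    by rewrite /q; lra.
  have : K <= Num.max 0 K by rewrite le_max lexx orbT.
  have : K1 * (1 / 2) <= f r by rewrite /f ler_pM //; lra.
  by rewrite /K1; lra.
have f0 : f 0 = 0 by rewrite /f a00 mul0r.
have [psi Kpsi Hpsi] := classKinf_inverse fcont f0 finc funb.
exists psi => // x; rewrite -{1}(Hpsi _ (A0 x)).
apply: (classK_le Kpsi.1).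
  by rewrite /f mulr_ge0.
apply: le_trans (aA x).
by rewrite /f ler_piMr // ltW.
Qed.

End ComparisonFunctions.

(** * Integrals and the Picard iteration *)

Section BoundedIntegrals.
Context {R : realType}.
Notation mu := (@lebesgue_measure R).
Implicit Types (g h : R -> R) (a b c t : R).

(** [p n t] is the next point strictly after [t] of the grid of step [1 / n.+1]. So [g (p n t)] is
    constant on grid cells, hence measurable, and tends to [g t] because [p n t] approaches [t] from
    the right. *)
Lemma right_continuous_measurable g :
  (forall t, g s @[s --> t^'+] --> g t) -> measurable_fun setT g.
Proof.
move=> gr.
pose p n (t : R) : R := (Num.floor (t * n.+1%:R) + 1)%:~R / n.+1%:R.
have pt n t : t < p n t /\ p n t <= t + n.+1%:R^-1.
  have /andP[h1 h2] := floor_itv (t * n.+1%:R).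
  have n0 : (0 : R) < n.+1%:R by [].
  rewrite /p ltr_pdivlMr // h2; split=> //.
  by rewrite ler_pdivrMr // mulrDl mulVf ?gt_eqF // intrD lerD2r.
apply: (@measurable_fun_cvg _ _ _ _ (fun n t => g (p n t))) => [n|t _].
  move=> _ /= B mB; rewrite setTI.
  pose C (z : int) : set R := if `[< B (g ((z + 1)%:~R / n.+1%:R)) >]
    then [set t | z%:~R <= t * n.+1%:R < (z + 1)%:~R] else set0.
  have -> : (fun t => g (p n t)) @^-1` B = \bigcup_z C z.
    apply/seteqP; split=> t /=.
      move=> Bt; exists (Num.floor (t * n.+1%:R)) => //.
      by rewrite /C asboolT //=; exact: floor_itv.
    move=> [z _]; rewrite /C; case: asboolP => // Bz /= /floor_def zt.
    by rewrite /p zt.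
  apply: countable_bigcupT_measurable; first exact: countableP.
  move=> z; rewrite /C; case: asboolP => _ //.
  apply: is_interval_measurable => s t /= /andP[s1 s2] /andP[t1 t2] r /andP[sr rt].
  have : s * n.+1%:R <= r * n.+1%:R by rewrite ler_pM2r.
  have : r * n.+1%:R <= t * n.+1%:R by rewrite ler_pM2r.
  by move=> ? ?; apply/andP; split; lra.
apply/cvgrPdist_lt => e e0.
have /cvgrPdist_lt /(_ _ e0) [d /= d0 Hd] := gr t.
near=> n; apply: Hd => /=; last by case: (pt n t).
have [h1 h2] := pt n t.
rewrite ltr0_norm; last by lra.
apply: (@le_lt_trans _ _ n.+1%:R^-1); first by rewrite opprB lerBlDl.
near: n; have := near_infty_natSinv_lt (PosNum d0).
by apply.
Unshelve. all: by end_near. Qed.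

Lemma bounded_integrable g a b B : measurable_fun setT g ->
  (forall t, a <= t -> t <= b -> `|g t| <= B) -> mu.-integrable `[a, b]%classic (EFin \o g).
Proof.
move=> mg gB; apply: measurable_bounded_integrable.
- exact: measurable_itv.
- by rewrite /= lebesgue_measure_itv /=; case: ifP => _; rewrite ?ltry // -EFinB ltry.
- exact: measurable_funTS.
- exists B; split; first exact: num_real.
  move=> M BM t /=; rewrite in_itv /= => /andP[t1 t2].
  by apply: le_trans (gB t t1 t2) _; exact: ltW.
Qed.

Lemma Rintegral_cat g a b c : a <= b -> b <= c ->
  mu.-integrable `[a, c]%classic (EFin \o g) ->
  Rintegral mu `[a, c]%classic g = Rintegral mu `[a, b]%classic g + Rintegral mu `[b, c]%classic g.
Proof.
move=> ab bc ig.
have := @Rintegral_itvB R g (BLeft a) (BRight c) b ig.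
rewrite !bnd_simp => /(_ ab bc) H.
rewrite -[LHS](subrK (Rintegral mu `[a, b]%classic g)) H addrC; congr (_ + _).
apply: Rintegral_itv_obnd_cbnd; apply: integrableS ig; [exact: measurable_itv|exact: measurable_itv|].
by move=> x /=; rewrite !in_itv /=; lra.
Qed.

Lemma Rintegral_cst_itv a b (k : R) : a <= b -> Rintegral mu `[a, b]%classic (fun=> k) = k * (b - a).
Proof.
move=> ab; rewrite Rintegral_cst ?measurable_itv //=; congr (_ * _).
rewrite lebesgue_measure_itv /= lte_fin; case: ltP => /= ba; first by [].
lra.
Qed.

Lemma integrable_cst_itv a b (k : R) : mu.-integrable `[a, b]%classic (EFin \o (fun=> k)).
Proof. by apply: (@bounded_integrable _ _ _ `|k|) => // t _ _. Qed.

Lemma Rintegral_dist_le g a b (k e : R) : a <= b ->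
  mu.-integrable `[a, b]%classic (EFin \o g) ->
  (forall t, a <= t -> t <= b -> `|g t - k| <= e) ->
  `|Rintegral mu `[a, b]%classic g - k * (b - a)| <= e * (b - a).
Proof.
move=> ab ig H.
have ic k' := integrable_cst_itv a b k'.
have mI := measurable_itv `[a, b].
have h1 : Rintegral mu `[a, b]%classic g <= Rintegral mu `[a, b]%classic (fun=> k + e).
  apply: le_Rintegral => // t /=; rewrite in_itv /= => /andP[t1 t2].
  by have := H t t1 t2; rewrite ler_norml; lra.
have h2 : Rintegral mu `[a, b]%classic (fun=> k - e) <= Rintegral mu `[a, b]%classic g.
  apply: le_Rintegral => // t /=; rewrite in_itv /= => /andP[t1 t2].
  by have := H t t1 t2; rewrite ler_norml; lra.
by move: h1 h2; rewrite !Rintegral_cst_itv // ler_norml; lra.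
Qed.

Lemma Rintegral_expR a b (K : R) : 0 < K -> a <= b ->
  Rintegral mu `[a, b]%classic (fun s => expR (K * (s - a))) = (expR (K * (b - a)) - 1) / K.
Proof.
move=> K0; rewrite le_eqVlt => /orP[/eqP <-|ab].
  by rewrite set_itv1 Rintegral_set1 subrr mulr0 expR0 subrr mul0r.
pose G s := K^-1 * expR (K * (s - a)).
have dG (s : R) : is_derive s 1 G (expR (K * (s - a))).
  have d1 : is_derive s 1 (fun s => K * (s - a)) (K * 1).
    have -> : K * 1 = K *: ((1 : R) - 0) by rewrite subr0.
    by apply: is_deriveZ.
  have d2 := @is_derive1_comp R expR (fun s => K * (s - a)) s _ _ (is_derive_expR _) d1.
  have -> : expR (K * (s - a)) = K^-1 *: (expR (K * (s - a)) * (K * 1)).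
    by rewrite mulr1 /= [RHS]mulrCA mulVf ?mulr1 // gt_eqF.
  by apply: (@is_deriveZ _ _ _ _ K^-1 _ _ _ d2).
have cG (s : R) : {for s, continuous G}.
  by apply: differentiable_continuous; apply/derivable1_diffP; case: (dG s).
have -> : (expR (K * (b - a)) - 1) / K = G b - G a.
  by rewrite /G subrr mulr0 expR0 -mulrBr mulrC.
apply: EFin_inj; rewrite EFinB -(@continuous_FTC2 _ (fun s => expR (K * (s - a))) G a b ab).
- rewrite /Rintegral fineK //; apply: integrable_fin_num; first exact: measurable_itv.
  apply: continuous_compact_integrable; first exact: segment_compact.
  apply: continuous_subspaceT => s; apply: continuous_comp; last exact: continuous_expR.
  by apply: cvgM; [exact: cvg_cst|apply: cvgB; [exact: cvg_id|exact: cvg_cst]].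
- apply: continuous_subspaceT => s; apply: continuous_comp; last exact: continuous_expR.
  by apply: cvgM; [exact: cvg_cst|apply: cvgB; [exact: cvg_id|exact: cvg_cst]].
- split; first by move=> s _; case: (dG s).
    by apply: cvg_at_right_filter; exact: cG.
  by apply: cvg_at_left_filter; exact: cG.
- by move=> s _; rewrite derive1E; case: (dG s).
Qed.

End BoundedIntegrals.

(** * Picard iteration for bounded, globally Lipschitz fields *)

Section Picard.
Context {R : realType}.
Notation mu := (@lebesgue_measure R).

(** [q k] bounds the tail of the geometric series, so the intervals [[u k - q k, u k + q k]] are
    nested, and the supremum of their left ends lies in all of them. *)
Lemma geometric_limit (u : nat -> R) (C : R) :
  (forall k, `|u k.+1 - u k| <= C * 2^-1 ^+ k) ->
  exists l, forall k, `|l - u k| <= 2 * C * 2^-1 ^+ k.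
Proof.
move=> H; pose q k : R := 2 * C * 2^-1 ^+ k.
have C0 : 0 <= C by have := H 0%N; rewrite expr0 mulr1; apply: le_trans.
have q0 k : 0 <= q k by rewrite /q !mulr_ge0 // exprn_ge0.
have qS k : q k.+1 = q k - C * 2^-1 ^+ k by rewrite /q exprS; lra.
have vinc k : u k - q k <= u k.+1 - q k.+1.
  by have := H k; rewrite qS ler_norml; lra.
have winc k : u k.+1 + q k.+1 <= u k + q k.
  by have := H k; rewrite qS ler_norml; lra.
have vmono k d : u k - q k <= u (k + d)%N - q (k + d)%N.
  by elim: d => [|d IH]; rewrite ?addn0 ?addnS //; apply: le_trans IH _.
have wmono k d : u (k + d)%N + q (k + d)%N <= u k + q k.
  by elim: d => [|d IH]; rewrite ?addn0 ?addnS //; apply: le_trans IH.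
have vw k m : u k - q k <= u m + q m.
  have h1 := vmono k m; have h2 := wmono m k; rewrite addnC in h2.
  have := q0 (k + m)%N; lra.
pose S := [set u k - q k | k in [set: nat]].
have supS : has_sup S.
  split; first by exists (u 0%N - q 0%N), 0%N.
  by exists (u 0%N + q 0%N) => _ [k _ <-].
exists (sup S) => k; rewrite -/(q k).
have h1 : u k - q k <= sup S by apply: ub_le_sup; [case: supS|exists k].
have h2 : sup S <= u k + q k by apply: ge_sup; [case: supS|move=> _ [m _ <-]].
by rewrite ler_norml; lra.
Qed.

Section Flow.
Variables (N : nat) (F : R -> 'rV[R]_N -> 'rV[R]_N) (B L : R).
Hypothesis B_ge0 : 0 <= B.
Hypothesis L_ge1 : 1 <= L.
Hypothesis F_bounded : forall t x, `|F t x| <= B.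
Hypothesis F_lipschitz : forall t x y, `|F t x - F t y| <= L * `|x - y|.
Hypothesis F_rc : forall x t, F s x @[s --> t^'+] --> F t x.

(** The curves on which the Picard operator acts: their continuity makes [F s (x s)]
    right-continuous in [s], hence measurable. *)
Let lip (x : R -> 'rV[R]_N) := forall s t, s <= t -> `|x t - x s| <= B * (t - s).

Lemma field_measurable x j : lip x -> measurable_fun setT (fun s => F s (x s) 0 j).
Proof.
move=> lx; apply: right_continuous_measurable => t.
apply/cvgrPdist_lt => e e0.
have L0 : 0 < L by apply: lt_le_trans L_ge1.
have e20 : 0 < e / 2 by rewrite divr_gt0.
have B1 : 0 < B + 1 by rewrite ltr_wpDl.
have /cvgrPdist_lt /(_ _ e20) Hr := @F_rc (x t) t.
near=> s; have ts : t < s by near: s; exact: nbhs_right_gt.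
have h1 : `|F t (x t) - F s (x t)| < e / 2 by near: s.
have h2 := F_lipschitz s (x t) (x s).
have h3 := lx t s (ltW ts); rewrite distrC in h3.
have h4 : (B + 1) * (s - t) < e / 2 / L.
  rewrite mulrC -ltr_pdivlMr // ltrBlDl; near: s; apply: nbhs_right_lt.
  by rewrite ltrDl !divr_gt0.
have h5 : L * `|x t - x s| < e / 2.
  rewrite mulrC -ltr_pdivlMr //; apply: le_lt_trans h4; apply: le_trans h3 _.
  by rewrite ler_wpM2r ?lerDl // subr_ge0 ltW.
have := rV_coord_le (F t (x t) - F s (x s)) j; rewrite !mxE => h6.
apply: le_lt_trans h6 _.
rewrite -[F t _](subrK (F s (x t))) -addrA.
apply: le_lt_trans (ler_normD _ _) _; lra.
Unshelve. all: by end_near. Qed.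

Lemma field_integrable x j a b : lip x ->
  mu.-integrable `[a, b]%classic (EFin \o (fun s => F s (x s) 0 j)).
Proof.
move=> lx; apply: (@bounded_integrable _ _ _ _ B); first exact: field_measurable.
by move=> t _ _; apply: le_trans (rV_coord_le _ _) _.
Qed.

Variables (a : R) (x0 : 'rV[R]_N).

(** [Num.max a t] freezes the curve before [a], which keeps it Lipschitz on the whole line. *)
Definition picard (x : R -> 'rV[R]_N) (t : R) : 'rV[R]_N :=
  \row_j (x0 0 j + Rintegral mu `[a, Num.max a t]%classic (fun s => F s (x s) 0 j)).

Lemma picard_lip x : lip x -> lip (picard x).
Proof.
move=> lx s t st; apply/rV_norm_leP => [|j]; first by rewrite mulr_ge0 // subr_ge0.
set s' := Num.max a s; set t' := Num.max a t.
have as' : a <= s' by rewrite /s' le_max lexx.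
have st' : s' <= t' by rewrite /s' /t' ge_max !le_max lexx st orbT.
have ts : t' - s' <= t - s by rewrite /s' /t'; case: (leP a t) => ?; case: (leP a s) => ?; lra.
rewrite !mxE -/s' -/t' (@Rintegral_cat _ _ a s' t') //; last exact: field_integrable.
set I := Rintegral mu `[s', t']%classic (fun s => F s (x s) 0 j).
have -> : x0 0 j + (Rintegral mu `[a, s']%classic (fun s => F s (x s) 0 j) + I) -
   (x0 0 j + Rintegral mu `[a, s']%classic (fun s => F s (x s) 0 j)) = I by lra.
apply: (@le_trans _ _ (B * (t' - s'))); last by rewrite ler_wpM2l.
have := @Rintegral_dist_le R (fun s => F s (x s) 0 j) s' t' 0 B st'.
rewrite mul0r subr0; apply; first exact: field_integrable.
by move=> r _ _; rewrite subr0; apply: le_trans (rV_coord_le _ _) _.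
Qed.

(* The weight [expR (2 * L * (t - a))] makes the Picard operator a contraction of ratio 1/2
   on the whole half-line at once. *)
Lemma picard_contract x y D : lip x -> lip y -> 0 <= D ->
  (forall s, a <= s -> `|x s - y s| <= D * expR (2 * L * (s - a))) ->
  forall t, a <= t -> `|picard x t - picard y t| <= D / 2 * expR (2 * L * (t - a)).
Proof.
move=> lx ly D0 H t at_.
have L0 : 0 < L by apply: lt_le_trans L_ge1.
have L20 : 0 < 2 * L by rewrite mulr_gt0.
apply/rV_norm_leP => [|j]; first by rewrite !mulr_ge0 ?expR_ge0 // invr_ge0.
rewrite !mxE (max_idPr at_).
set Ix := Rintegral _ _ _; set Iy := Rintegral _ _ _.
have mI := measurable_itv `[a, t].
have ix := @field_integrable x j a t lx; have iy := @field_integrable y j a t ly.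
have E : Ix - Iy = Rintegral mu `[a, t]%classic (fun s => F s (x s) 0 j - F s (y s) 0 j).
  by rewrite RintegralB.
have -> : x0 0 j + Ix - (x0 0 j + Iy) = Ix - Iy by lra.
pose w s := L * D * expR (2 * L * (s - a)).
have ie : mu.-integrable `[a, t]%classic (EFin \o (fun s => expR (2 * L * (s - a)))).
  apply: continuous_compact_integrable; first exact: segment_compact.
  apply: continuous_subspaceT => s; apply: continuous_comp; last exact: continuous_expR.
  by apply: cvgM; [exact: cvg_cst|apply: cvgB; [exact: cvg_id|exact: cvg_cst]].
have iw : mu.-integrable `[a, t]%classic (EFin \o w).
  apply: continuous_compact_integrable; first exact: segment_compact.
  apply: continuous_subspaceT => s; apply: cvgM; first exact: cvg_cst.
  apply: continuous_comp; last exact: continuous_expR.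
  by apply: cvgM; [exact: cvg_cst|apply: cvgB; [exact: cvg_id|exact: cvg_cst]].
have ib : mu.-integrable `[a, t]%classic (EFin \o (fun s => F s (x s) 0 j - F s (y s) 0 j)).
  apply: (@bounded_integrable _ _ _ _ (2 * B)).
    by apply: measurable_funB; exact: field_measurable.
  move=> s _ _; apply: le_trans (ler_normB _ _) _.
  rewrite mulr_natl mulr2n lerD //; exact: le_trans (rV_coord_le _ _) _.
have H1 : `|Rintegral mu `[a, t]%classic (fun s => F s (x s) 0 j - F s (y s) 0 j)| <=
    Rintegral mu `[a, t]%classic (fun s => `|F s (x s) 0 j - F s (y s) 0 j|).
  by apply: le_normr_Rintegral => //; exact: measurable_itv.
rewrite E; apply: (le_trans H1).
apply: (@le_trans _ _ (Rintegral mu `[a, t]%classic w)).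
  apply: le_Rintegral => //; first exact: integrable_norm ib.
  move=> s /=; rewrite in_itv /= => /andP[as_ _].
  have := rV_coord_le (F s (x s) - F s (y s)) j; rewrite !mxE => h; apply: le_trans h _.
  apply: le_trans (F_lipschitz _ _ _) _; rewrite /w -mulrA ler_pM2l //; exact: H.
rewrite RintegralZl // Rintegral_expR //.
have -> : L * D * ((expR (2 * L * (t - a)) - 1) / (2 * L)) = D / 2 * (expR (2 * L * (t - a)) - 1).
  by field; rewrite gt_eqF.
by rewrite ler_wpM2l ?lerBlDr ?lerDl // divr_ge0.
Qed.

Lemma picard_solution : exists x : R -> 'rV[R]_N, lip x /\ forall t, a <= t -> forall j,
  mu.-integrable `[a, t]%classic (EFin \o (fun s => F s (x s) 0 j)) /\
  x t 0 j = x0 0 j + Rintegral mu `[a, t]%classic (fun s => F s (x s) 0 j).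
Proof.
have L0 : 0 < L by apply: lt_le_trans L_ge1.
pose X k := iter k picard (fun=> x0).
have lX k : lip (X k).
  elim: k => [|k IH]; last exact: picard_lip.
  by move=> s t st; rewrite subrr normr0 mulr_ge0 // subr_ge0.
pose w t := expR (2 * L * (t - a)).
have w0 t : 0 <= w t by rewrite expR_ge0.
have dX k t : a <= t -> `|X k.+1 t - X k t| <= B * 2^-1 ^+ k * w t.
  elim: k t => [|k IH] t at_.
    rewrite expr0 mulr1; apply: (@le_trans _ _ (B * (t - a))).
      (* The constant start equals the value of the first iterate at [a], so the Lipschitz property
         of that iterate bounds the first increment. *)
      have -> : X 0%N t = X 1%N a.
        apply/rowP => j; rewrite mxE maxxx set_itv1.
        by rewrite Rintegral_set1 addr0.
      exact: lX.
    rewrite ler_wpM2l //; apply: le_trans (expR_ge1Dx _).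
    have : 0 <= (L - 1) * (t - a) by rewrite mulr_ge0 // subr_ge0.
    by have : 0 <= t - a by [rewrite subr_ge0]; lra.
  have -> : B * 2^-1 ^+ k.+1 = (B * 2^-1 ^+ k) / 2 by rewrite exprS; lra.
  apply: picard_contract => //; [exact: (lX k.+1)|by rewrite mulr_ge0 // exprn_ge0].
have dXj k t j : `|X k.+1 (Num.max a t) 0 j - X k (Num.max a t) 0 j|
    <= B * w (Num.max a t) * 2^-1 ^+ k.
  have at_ : a <= Num.max a t by rewrite le_max lexx.
  have := dX k _ at_; rewrite mulrAC; apply: le_trans.
  by have := rV_coord_le (X k.+1 (Num.max a t) - X k (Num.max a t)) j; rewrite !mxE.
have lim t j := geometric_limit (fun k => dXj k t j).
have /choice[l Hl] : forall p : R * 'I_N, exists l, forall k,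
    `|l - X k (Num.max a p.1) 0 p.2| <= 2 * (B * w (Num.max a p.1)) * 2^-1 ^+ k.
  by move=> [t j]; exact: lim.
pose x t : 'rV[R]_N := \row_j l (t, j).
have xX k t : a <= t -> `|x t - X k t| <= 2 * B * 2^-1 ^+ k * w t.
  move=> at_; apply/rV_norm_leP => [|j]; first by rewrite !mulr_ge0 // exprn_ge0.
  by rewrite !mxE; have := Hl (t, j) k; rewrite /= (max_idPr at_); lra.
have small (p q C : R) : 0 <= C -> (forall k, p <= q + C * 2^-1 ^+ k) -> p <= q.
  move=> C0 H; apply/ler_addgt0Pr => e e0.
  have : (fun k => C * 2^-1 ^+ k : R) @ \oo --> (0 : R).
    rewrite -[X in _ --> X](mulr0 C); apply: cvgM; first exact: cvg_cst.
    by apply: cvg_expr; rewrite ger0_norm // invf_lt1 ?ltr1n.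
  move=> /cvgrPdist_lt /(_ _ e0) [k _ /(_ k (leqnn k))].
  by rewrite sub0r normrN ltr_norml => /= h; have := H k; lra.
(* The limits [l] are chosen separately for each time, so agreement with the value at [Num.max a t]
   has to come from the common iterates. *)
have xmax t : x t = x (Num.max a t).
  apply/rowP => j; rewrite !mxE.
  have m : Num.max a (Num.max a t) = Num.max a t by rewrite maxA maxxx.
  suff h p q : (forall k, `|l p - X k (Num.max a q.1) 0 q.2| <= 2 * (B * w (Num.max a q.1)) * 2^-1 ^+ k) ->
      l p <= l q.
    apply/eqP; rewrite eq_le; apply/andP; split; apply: h => k /=.
      by rewrite m; exact: (Hl (t, j)).
    by have := Hl (Num.max a t, j) k; rewrite /= m.
  move=> h; apply: (@small _ _ (4 * (B * w (Num.max a q.1)))); first by rewrite !mulr_ge0.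
  by move=> k; have := h k; have := Hl q k; rewrite !ler_norml; lra.
have lx : lip x.
  move=> s t st; apply: (@small _ _ (2 * B * w (Num.max a s) + 2 * B * w (Num.max a t))).
    by rewrite addr_ge0 // !mulr_ge0.
  move=> k; rewrite (xmax t) (xmax s).
  set s' := Num.max a s; set t' := Num.max a t.
  have as' : a <= s' by rewrite /s' le_max lexx.
  have at' : a <= t' by rewrite /t' le_max lexx.
  have st' : s' <= t' by rewrite /s' /t' ge_max !le_max lexx st orbT.
  have ts : t' - s' <= t - s by rewrite /s' /t'; case: (leP a t) => ?; case: (leP a s) => ?; lra.
  have h1 := xX k s' as'; have h2 := xX k t' at'; have h3 := lX k s' t' st'.
  have h4 : B * (t' - s') <= B * (t - s) by rewrite ler_wpM2l.
  have -> : x t' - x s' = (x t' - X k t') + ((X k t' - X k s') + (X k s' - x s')).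
    by rewrite !addrA !subrK.
  apply: le_trans (ler_normD _ _) _; apply: le_trans (lerD h2 (ler_normD _ _)) _.
  by rewrite (distrC (X k s')); lra.
exists x; split=> // t at_ j; split; first exact: field_integrable.
have px : `|x t - picard x t| <= 0.
  apply: (@small _ _ (2 * B * w t)); first by rewrite !mulr_ge0.
  move=> k; rewrite add0r.
  have h1 := xX k.+1 t at_.
  have h2 : `|X k.+1 t - picard x t| <= 2 * B * 2^-1 ^+ k / 2 * w t.
    rewrite distrC; apply: picard_contract => //; first by rewrite !mulr_ge0 // exprn_ge0.
    exact: xX.
  have -> : x t - picard x t = (x t - X k.+1 t) + (X k.+1 t - picard x t).
    by rewrite addrA subrK.
  apply: le_trans (ler_normD _ _) _; rewrite exprS in h1; lra.
move: px; rewrite normr_le0 subr_eq0 => /eqP ->.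
by rewrite mxE (max_idPr at_).
Qed.

End Flow.
End Picard.

(** * Uniform bounds on compact sets *)

Section CompactBounds.
Context {R : realType}.

(** Compactness in its near-covering form, along the filter of large parameters [L]: local
    thresholds merge into one. *)
Lemma compact_uniform (X : normedModType R) (K : set X) (P : R -> X -> Prop) :
  compact K ->
  (forall x, K x -> exists d M : R, 0 < d /\
     forall y L, `|y - x| < d -> M <= L -> P L y) ->
  exists M, forall L x, M <= L -> K x -> P L x.
Proof.
move=> /compact_near_coveringP cK H.
have [|M [_ HM]] := cK R (pinfty_nbhs R) P _.
  move=> x /H[d [M [d0 HP]]].
  exists (ball x d, [set L | M <= L]) => /=.
    split; first exact: nbhsx_ballx.
    exists M; split; first exact: num_real.
    by move=> L /ltW.
  move=> [y L] /= [xy ML]; apply: HP => //.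
  by move: xy; rewrite -ball_normE /= distrC.
exists (M + 1) => L x ML; apply: HM.
by apply: lt_le_trans ML; rewrite ltrDl.
Qed.

Lemma rV_ball_compact n (r : R) : compact [set x : 'rV[R]_n | `|x| <= r].
Proof.
apply: bounded_closed_compact.
  exists r; split; first exact: num_real.
  by move=> M rM x /= xr; apply: le_trans xr _; exact: ltW.
have -> : [set x : 'rV[R]_n | `|x| <= r] = (fun x => `|x|) @^-1` [set y | y <= r] by [].
apply: preimage_closed; first by move=> x _; exact: norm_continuous.
exact: closed_le.
Qed.

Lemma continuous_bounded_ball n (V : 'rV[R]_n -> R) (r : R) : continuous V ->
  exists M, forall x, `|x| <= r -> V x <= M.
Proof.
move=> cV; have [x _|M HM] := @compact_uniform _ _ (fun L x => V x <= L) (@rV_ball_compact n r).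
  have /cvgrPdist_lt /(_ 1 ltr01) /nbhs_normP[d /= d0 Hd] := cV x.
  exists d, (V x + 1); split=> // y L yx; apply: le_trans.
  have := Hd y; rewrite /= distrC => /(_ yx).
  by rewrite ltr_norml; lra.
by exists M => x xr; exact: HM.
Qed.

Lemma positive_on_shell n (V : 'rV[R]_n -> R) (e r : R) : continuous V ->
  (forall x, x != 0 -> 0 < V x) -> 0 < e ->
  exists2 m, 0 < m & forall x, e <= `|x| -> `|x| <= r -> m <= V x.
Proof.
move=> cV V0 e0.
(* The lower bound is sought as the inverse of a threshold; near 0 the premise [e <= |x|] fails. *)
have [x _|M HM] := @compact_uniform _ _ (fun L x => e <= `|x| -> L^-1 <= V x) (@rV_ball_compact n r).
  have [->|x0] := eqVneq x 0.
    exists e, 0; split=> // y L; rewrite subr0 => ye _ ey.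
    by move: (lt_le_trans ye ey); rewrite ltxx.
  have Vx := V0 x x0; have Vx2 : 0 < V x / 2 by rewrite divr_gt0.
  have /cvgrPdist_lt /(_ _ Vx2) /nbhs_normP[d /= d0 Hd] := cV x.
  exists d, (V x / 2)^-1; split=> // y L yx ML _.
  have L0 : 0 < L by apply: lt_le_trans ML; rewrite invr_gt0.
  apply: (@le_trans _ _ (V x / 2)); first by rewrite invf_ple ?posrE.
  have := Hd y; rewrite /= distrC => /(_ yx).
  by rewrite ltr_norml; lra.
exists (Num.max 1 M)^-1; first by rewrite invr_gt0 lt_max ltr01.
by move=> x ex xr; apply: HM => //; rewrite le_max lexx orbT.
Qed.

(** Compactness gives one [L] that bounds [h] and is a Lipschitz constant for arguments closer than
    [1 / L]. For arguments further apart, the trivial bound [2 * L] on the difference is at most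
    [2 * L * L] times their distance. *)
Lemma loc_lip2_on_balls n m p (h : 'rV[R]_n -> 'rV[R]_m -> 'rV[R]_p) (r : R) : loc_lip2 h ->
  exists2 L, 1 <= L & forall x y v w, `|x| <= r -> `|y| <= r -> `|v| <= r -> `|w| <= r ->
    `|h x v| <= L /\ `|h x v - h y w| <= L * (`|x - y| + `|v - w|).
Proof.
move=> lip.
pose K := [set z : 'rV[R]_n * 'rV[R]_m | `|z.1| <= r /\ `|z.2| <= r].
have cK : compact K by exact: compact_setX (@rV_ball_compact n r) (@rV_ball_compact m r).
pose P (L : R) (z : 'rV[R]_n * 'rV[R]_m) := `|h z.1 z.2| <= L /\
  forall y w, `|y - z.1| < L^-1 -> `|w - z.2| < L^-1 ->
  `|h y w - h z.1 z.2| <= L * (`|y - z.1| + `|w - z.2|).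
have [[x v] _|M HM] := @compact_uniform _ K P cK.
  have [d [L0 [d0 HL]]] := lip x v.
  have d20 : 0 < d / 2 by rewrite divr_gt0.
  pose L1 := Num.max 0 L0.
  have L1_ge0 : 0 <= L1 by rewrite le_max lexx.
  have L01 : L0 <= L1 by rewrite le_max lexx orbT.
  exists (d / 2), (Num.max (Num.max (d / 2)^-1 L1) (`|h x v| + L1 * d)); split=> // -[y w] L.
  rewrite prod_normE /= gt_max => /andP[yx wv]; rewrite !ge_max => /andP[/andP[Ld L1L] Lb].
  have L_gt0 : 0 < L by apply: lt_le_trans Ld; rewrite invr_gt0.
  have yd : `|y - x| < d by apply: lt_trans yx _; rewrite ltr_pdivrMr // ltr_pMr // ltr1n.
  have wd : `|w - v| < d by apply: lt_trans wv _; rewrite ltr_pdivrMr // ltr_pMr // ltr1n.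
  split=> /=.
    apply: le_trans Lb; rewrite -[h y w](subrK (h x v)).
    apply: le_trans (ler_normD _ _) _; rewrite addrC lerD2l.
    apply: le_trans (HL y x w v yd _ wd _) _; rewrite ?subrr ?normr0 //.
    apply: le_trans (_ : L1 * (`|y - x| + `|w - v|) <= _).
      by rewrite ler_wpM2r // addr_ge0.
    by rewrite ler_wpM2l //; lra.
  have LV : L^-1 <= d / 2 by rewrite invf_ple ?posrE.
  move=> y' w' y'y w'w.
  have y'd : `|y' - x| < d.
    have -> : y' - x = (y' - y) + (y - x) by rewrite addrA subrK.
    by apply: le_lt_trans (ler_normD _ _) _; lra.
  have w'd : `|w' - v| < d.
    have -> : w' - v = (w' - w) + (w - v) by rewrite addrA subrK.
    by apply: le_lt_trans (ler_normD _ _) _; lra.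
  apply: le_trans (HL _ _ _ _ y'd yd w'd wd) _.
  apply: ler_wpM2r; first by rewrite addr_ge0.
  by case/andP: L1L.
pose L := Num.max 1 M.
have L1 : 1 <= L by rewrite le_max lexx.
have L0 : 0 < L by lra.
have PL z : K z -> P L z by apply: HM; rewrite le_max lexx orbT.
exists (2 * L * L); first by nra.
move=> x y v w xr yr vr wr.
have [hx _] := PL (x, v) (conj xr vr); have [hy lipy] := PL (y, w) (conj yr wr).
rewrite /= in hx hy lipy.
have LL : L <= 2 * L * L by nra.
split; first exact: le_trans LL.
have s0 : 0 <= `|x - y| + `|v - w| by rewrite addr_ge0.
case: (ltP (`|x - y| + `|v - w|) L^-1) => sL.
  have h1 : `|x - y| < L^-1 by apply: le_lt_trans sL; rewrite lerDl.
  have h2 : `|v - w| < L^-1 by apply: le_lt_trans sL; rewrite lerDr.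
  by apply: le_trans (lipy x v h1 h2) _; rewrite ler_wpM2r.
apply: le_trans (ler_normB _ _) _.
apply: (@le_trans _ _ (2 * L)); first by lra.
rewrite -[X in X <= _]mulr1 -[2 * L * L * _]mulrA ler_pM2l ?mulr_gt0 //.
by rewrite mulrC -ler_pdivrMr // div1r.
Qed.

End CompactBounds.

(** * Solutions between and across impulses *)

Section Trajectories.
Context {R : realType}.
Notation mu := (@lebesgue_measure R).

Lemma cvg_rV n (I : Type) (F : set_system I) (FF : Filter F) (x : I -> 'rV[R]_n) (y : 'rV[R]_n) :
  (forall j, (fun s => x s 0 j) @ F --> y 0 j) -> x @ F --> y.
Proof.
move=> H; apply/cvgrPdist_le => e e0.
have : \forall s \near F, forall j, `|y 0 j - x s 0 j| <= e.
  by apply: filter_forall => j; move/cvgrPdist_le: (H j); exact.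
by apply: filterS => s Hs; apply/rV_norm_leP => [|j]; [exact: ltW|rewrite !mxE].
Qed.

Variables (NN MM : nat) (f : 'rV[R]_NN -> 'rV[R]_MM -> 'rV[R]_NN).

Definition flow_on (u : R -> 'rV[R]_MM) (x : R -> 'rV[R]_NN) (a b : R) : Prop :=
  forall a' b', a <= a' -> a' <= b' -> b' <= b -> forall j,
    mu.-integrable `[a', b']%classic (fun s => ((f (x s) (u s)) 0 j)%:E) /\
    x b' 0 j = x a' 0 j + Rintegral mu `[a', b']%classic (fun s => (f (x s) (u s)) 0 j).

Lemma flow_onW u x a b a' b' : a <= a' -> b' <= b -> flow_on u x a b -> flow_on u x a' b'.
Proof. by move=> aa' bb' H p q ap pq qb; apply: H; lra. Qed.

Lemma flow_coord_continuous u x a b j : a <= b -> flow_on u x a b ->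
  {within `[a, b]%classic, continuous (fun t => x t 0 j)}.
Proof.
move=> ab H; have [ig _] := H a b (lexx a) ab (lexx b) j.
have cI := parameterized_integral_continuous ab ig.
apply: (@subspace_eq_continuous _ _ _ (fun t => x a 0 j +
   Rintegral mu `[a, t]%classic (fun s => (f (x s) (u s)) 0 j))).
  move=> t; rewrite inE /= in_itv /= => /andP[t1 t2].
  have [_ E] := H a t (lexx a) t1 t2 j; exact: esym E.
move=> t; apply: cvgD; first exact: cvg_cst.
exact: cI.
Qed.

Lemma flow_cvg_left u x a b t : flow_on u x a b -> a < t -> t <= b ->
  x s @[s --> t^'-] --> x t.
Proof.
move=> H at_ tb; apply: cvg_rV => j.
have := @flow_coord_continuous u x a t j (ltW at_) (flow_onW (lexx a) tb H).
by move=> /(continuous_within_itvP _ at_)[].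
Qed.

Lemma flow_cvg_right u x a b t : flow_on u x a b -> a <= t -> t < b ->
  x s @[s --> t^'+] --> x t.
Proof.
move=> H at_ tb; apply: cvg_rV => j.
have := @flow_coord_continuous u x t b j (ltW tb) (flow_onW at_ (lexx b) H).
by move=> /(continuous_within_itvP _ tb)[].
Qed.

Lemma flow_right_derivative u x a b t : loc_lip2 f -> flow_on u x a b -> a <= t -> t < b ->
  u s @[s --> t^'+] --> u t ->
  forall e, 0 < e -> exists2 d, 0 < d & forall h, 0 < h -> h < d ->
    `|x (t + h) - (x t + h *: f (x t) (u t))| <= e * h.
Proof.
move=> lipf H at_ tb ur e e0.
have xr := flow_cvg_right H at_ tb.
have [r [L0 [r0 HL0]]] := lipf (x t) (u t).
pose L := Num.max 1 L0.
have L1 : 1 <= L by rewrite le_max lexx.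
have L_gt0 : 0 < L by lra.
have e2 : 0 < Num.min r (e / (2 * L)) by rewrite lt_min r0 !divr_gt0 // mulr_gt0.
have close : \forall s \near t^'+, `|f (x s) (u s) - f (x t) (u t)| <= e.
  move/cvgrPdist_lt: xr => /(_ _ e2); move/cvgrPdist_lt: ur => /(_ _ e2).
  apply: filterS2 => s; rewrite !lt_min => /andP[u1 u2] /andP[x1 x2].
  apply: le_trans (HL0 _ _ _ _ _ _ _ _) _; rewrite ?subrr ?normr0 //; try by rewrite distrC.
  apply: (@le_trans _ _ (L * (`|x s - x t| + `|u s - u t|))).
    by rewrite ler_wpM2r ?addr_ge0 // le_max lexx orbT.
  rewrite mulrC -ler_pdivlMr // (distrC (x s)) (distrC (u s)).
  move: u2 x2; rewrite invfM mulrA [e / 2 / L]mulrAC.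
  by move: (e / L) => q; lra.
move: close => [d /= d0 Hd].
exists (Num.min d (b - t)); first by rewrite lt_min d0 subr_gt0.
move=> h h0; rewrite lt_min => /andP[hd hb].
apply/rV_norm_leP => [|j]; first by rewrite mulr_ge0 // ltW.
have th : t <= t + h by lra.
have thb : t + h <= b by lra.
have [ig E] := H t (t + h) at_ th thb j.
rewrite !mxE E; set I := Rintegral _ _ _; set k := f (x t) (u t) 0 j.
have -> : x t 0 j + I - (x t 0 j + h * k) = I - k * (t + h - t) by lra.
rewrite [X in _ <= e * X](_ : h = t + h - t); last by lra.
apply: Rintegral_dist_le => // s ts sth.
case: (ltgtP t s) ts => // [ts _|<- _]; last by rewrite subrr normr0 ltW.
have := Hd s; rewrite /= ltr0_norm; last by lra.
move=> /(_ ltac:(lra) ts); apply: le_trans.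
by have := rV_coord_le (f (x s) (u s) - f (x t) (u t)) j; rewrite !mxE.
Qed.

End Trajectories.

(** * Decay of the Lyapunov function across impulses *)

Section ImpulsiveEstimate.
Context {R : realType}.
Variables (NN MM : nat) (f g : 'rV[R]_NN -> 'rV[R]_MM -> 'rV[R]_NN).
Variables (V : 'rV[R]_NN -> R) (gamma : R -> R) (c d : R).
Hypothesis lipf : loc_lip2 f.
Hypothesis LF : eISS_LF f g V gamma c d.
Hypothesis jumpV : forall x u, V (g x u) <= Num.max (expR (- d) * V x) (gamma `|u|).

Lemma eISS_LF_ge0 x : 0 <= V x.
Proof.
case: LF => -[_ _ [V0 Vpos] _ _] _ _.
by have [->|/Vpos/ltW//] := eqVneq x 0; rewrite V0.
Qed.

Lemma eISS_gain_ge0 (r : R) : 0 <= r -> 0 <= gamma r.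
Proof. by case: LF => -[_ _ _ _ [Kg _]] _ _; exact: classK_ge0. Qed.

Lemma eISS_gain_le (r r' : R) : 0 <= r -> r <= r' -> gamma r <= gamma r'.
Proof. by case: LF => -[_ _ _ _ [Kg _]] _ _; exact: classK_le. Qed.

Lemma flow_dini u x a b t : flow_on f u x a b -> a <= t -> t < b ->
  u s @[s --> t^'+] --> u t -> gamma `|u t| < V (x t) ->
  forall e, 0 < e -> exists2 del, 0 < del & forall h, 0 < h -> h < del ->
    V (x (t + h)) <= V (x t) + (- c * V (x t) + e) * h.
Proof.
move=> H at_ tb ur gV e e0.
have [[cV lipV [V0 Vpos] _ _] [E [nE dV]] _] := LF.
have xt0 : x t != 0.
  apply: contraTneq gV => ->; rewrite V0 -leNgt; exact: eISS_gain_ge0.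
have e20 : 0 < e / 2 by rewrite divr_gt0.
have [d1 d10 H1] := dini_decay_flow lipf lipV nE dV xt0 gV e20.
have [r [L0 [r0 HL]]] := lipV (x t) xt0.
pose L := Num.max 1 L0.
have L1 : 1 <= L by rewrite le_max lexx.
have L_gt0 : 0 < L by lra.
have eL : 0 < e / 2 / L by rewrite divr_gt0.
have [d2 d20 H2] := flow_right_derivative lipf H at_ tb ur eL.
set v := f (x t) (u t) in H1 H2.
have v1 : 0 < `|v| + 1 by rewrite ltr_wpDl.
(* [r / 2] for the Euler step and [r / 2] for its error keep both points in the ball where [V] is
   Lipschitz. *)
exists (Num.min (Num.min d1 d2) (Num.min (r / 2 / (`|v| + 1)) (r / 2 / (e / 2 / L)))).
  by rewrite !lt_min d10 d20 !divr_gt0.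
move=> h h0; rewrite !lt_min => /andP[/andP[hd1 hd2] /andP[]].
rewrite (ltr_pdivlMr _ _ v1) (ltr_pdivlMr _ _ eL) => hv he.
have D := H2 h h0 hd2.
have nhv : `|h *: v| < r / 2.
  rewrite normrZ gtr0_norm //; apply: le_lt_trans hv.
  by rewrite ler_pM2l // lerDl.
have near1 : `|x t + h *: v - x t| < r.
  by rewrite addrAC subrr add0r; lra.
have near2 : `|x (t + h) - x t| < r.
  have -> : x (t + h) - x t = (x (t + h) - (x t + h *: v)) + h *: v.
    by rewrite opprD addrA subrK.
  by apply: le_lt_trans (ler_normD _ _) _; lra.
have := HL _ _ near2 near1 => h3.
have h4 : L0 * `|x (t + h) - (x t + h *: v)| <= L * (e / 2 / L * h).
  apply: (@le_trans _ _ (L * `|x (t + h) - (x t + h *: v)|)).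
    by rewrite ler_wpM2r // le_max lexx orbT.
  by rewrite ler_pM2l.
have h5 : L * (e / 2 / L * h) = e / 2 * h by field; rewrite gt_eqF.
have := H1 h h0 hd1; move: h3; rewrite ler_norml; lra.
Qed.

Variables (t0 : R) (T : set R).
Hypothesis T_impulse : impulse_times t0 T.

(** A solution up to [b], with the jump at [b] already performed if [b] is an impulse time. The a
    priori bound is stated for these because existence applies it to pieces not yet known to
    extend. *)
Definition sol_upto (b : R) (u : R -> 'rV[R]_MM) (x : R -> 'rV[R]_NN) : Prop :=
  (forall a' b', t0 <= a' -> a' <= b' -> b' <= b -> (forall r, T r -> ~ (a' < r <= b')) ->
     flow_on f u x a' b') /\
  (forall t, T t -> t <= b -> exists xl ul,
     [/\ x s @[s --> t^'-] --> xl, u s @[s --> t^'-] --> ul & x t = g xl ul]).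

Lemma Nimp_exists a b : exists k, Nimp T b a k.
Proof.
case: T_impulse => _ /(_ a b) fin.
have fin2 : finite_set (T `&` [set r | a < r <= b]).
  apply: sub_finite_set fin => r [Tr /andP[ar rb]]; split=> //=.
  by rewrite in_itv /= (ltW ar).
have [l Hl] := (finite_seqP _).1 fin2.
exists (size (undup l)), (undup l); split=> //; first exact: undup_uniq.
move=> r; rewrite mem_undup.
have : (T `&` [set r | a < r <= b]) r <-> [set` l] r by rewrite Hl.
by move=> [h1 h2]; split; [exact: h2|exact: h1].
Qed.

(** The least impulse is split off for inductions on their number. The last clause serves a restart
    before [tau]: the shorter window still contains all [k.+1] impulses. *)
Lemma Nimp_first a b k : Nimp T b a k.+1 -> exists tau,
  [/\ T tau, a < tau, tau <= b, forall z, T z -> ~ (a < z < tau) &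
      Nimp T b tau k /\ forall s, a <= s -> s < tau -> Nimp T b s k.+1].
Proof.
move=> [l [ul Hl sl]].
have [tau taul taumin] : exists2 tau, tau \in l & forall z, z \in l -> tau <= z.
  case: l ul Hl sl => // z0 l ul Hl sl.
  pose m := \big[Num.min/z0]_(z <- z0 :: l) z.
  exists m; last by move=> z zl; exact: (ge_bigmin_seq z0 z xpredT (fun z => z) zl).
  rewrite /m big_seq; elim/big_ind: _ => //; first by rewrite mem_head.
  by move=> p q pl ql; rewrite minElt; case: ifP.
have [Ttau /andP[atau taub]] := (Hl tau).1 taul.
exists tau; split=> //.
  move=> z Tz /andP[az zt]; have zl : z \in l.
    by apply/Hl; split=> //; rewrite az /= ltW // (lt_le_trans zt).
  by have := taumin z zl; lra.
split.
  exists (rem tau l); split; first exact: rem_uniq.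
    move=> z; rewrite mem_rem_uniq // inE; split.
      move=> /andP[zt zl]; have [Tz /andP[az zb]] := (Hl z).1 zl; split=> //.
      by rewrite zb andbT lt_neqAle eq_sym zt taumin.
    move=> [Tz /andP[tz zb]]; rewrite gt_eqF //=; apply/Hl; split=> //.
    by rewrite zb (lt_trans atau).
  by rewrite size_rem // sl.
move=> s as_ st; exists l; split=> // z; split.
  move=> zl; have [Tz /andP[az zb]] := (Hl z).1 zl; split=> //.
  by rewrite zb andbT (lt_le_trans st) // taumin.
by move=> [Tz /andP[sz zb]]; apply/Hl; split=> //; rewrite zb (le_lt_trans as_).
Qed.

Lemma no_impulse_right t : exists2 e, 0 < e & forall r, T r -> ~ (t < r <= t + e).
Proof.
have [k [l [ul Hl sl]]] := Nimp_exists t (t + 1).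
pose e := \big[Num.min/1]_(r <- l) (r - t).
have e0 : 0 < e.
  rewrite /e big_seq; elim/big_ind: _ => //; first by move=> p q p0 q0; rewrite lt_min p0.
  by move=> r /Hl [_ /andP[tr _]]; rewrite subr_gt0.
have e1 : e <= 1 by rewrite /e; elim/big_rec: _ => // r y _ y1; rewrite ge_min y1 orbT.
exists (e / 2); first by rewrite divr_gt0.
move=> r Tr /andP[tr re].
have rl : r \in l by apply/Hl; split=> //; apply/andP; split=> //; lra.
have : e <= r - t by exact: (ge_bigmin_seq 1 r xpredT (fun r => r - t) rl).
lra.
Qed.

Lemma no_impulse_left t : t0 < t -> exists2 a, t0 <= a & a < t /\ forall r, T r -> ~ (a < r < t).
Proof.
move=> t0t; have [k [l [ul Hl sl]]] := Nimp_exists t0 t.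
(* The last impulse before [t], or [t0] if there is none; [t] itself may be an impulse and is
   excluded. *)
pose a := \big[Num.max/t0]_(r <- l | r != t) r.
exists a; first by rewrite /a; elim/big_rec: _ => // r y _ y1; rewrite le_max y1 orbT.
split.
  rewrite /a big_seq_cond; elim/big_ind: _ => //; first by move=> p q p0 q0; rewrite gt_max p0.
  by move=> r /andP[/Hl [_ /andP[tr rt]]] rnt; rewrite lt_neqAle rnt.
move=> r Tr /andP[ar rt].
have rl : r \in l.
  by apply/Hl; split=> //; case: T_impulse => /(_ r Tr) /= -> _; rewrite ltW.
have : r <= a by apply: (le_bigmax_seq t0 r (fun r => r != t) (fun r => r) rl); rewrite lt_eqF.
lra.
Qed.

Lemma sol_cvg_right b u x t : sol_upto b u x -> t0 <= t -> t < b -> x s @[s --> t^'+] --> x t.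
Proof.
move=> [H _] t0t tb; have [e e0 He] := no_impulse_right t.
pose q := Num.min b (t + e).
have [qb qe] : q <= b /\ q <= t + e by split; rewrite /q ge_min lexx ?orbT.
have tq : t < q by rewrite /q lt_min tb ltrDl.
apply: (@flow_cvg_right _ _ _ f u x t q t) => //.
apply: H => //; first exact: ltW.
by move=> r Tr /andP[tr rq]; apply: (He r Tr); rewrite tr /=; lra.
Qed.

Lemma sol_cvg_left b u x t : sol_upto b u x -> t0 < t -> t <= b -> ~ T t ->
  x s @[s --> t^'-] --> x t.
Proof.
move=> [H _] t0t tb nT; have [a t0a [at_ Ha]] := no_impulse_left t0t.
apply: (@flow_cvg_left _ _ _ f u x a t t) => //.
apply: H => //; first exact: ltW.
move=> r Tr /andP[ar]; rewrite le_eqVlt => /orP[/eqP E|rt]; first by apply: nT; rewrite -E.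
by apply: (Ha r Tr); rewrite ar.
Qed.

Lemma sol_dini b u x t : admissible_input u -> sol_upto b u x -> t0 <= t -> t < b ->
  gamma `|u t| < V (x t) ->
  forall e, 0 < e -> exists2 del, 0 < del & forall h, 0 < h -> h < del ->
    V (x (t + h)) <= V (x t) + (- c * V (x t) + e) * h.
Proof.
move=> au [H _] t0t tb; have [e' e0 He] := no_impulse_right t.
pose q := Num.min b (t + e').
have [qb qe] : q <= b /\ q <= t + e' by split; rewrite /q ge_min lexx ?orbT.
have tq : t < q by rewrite /q lt_min tb ltrDl.
apply: (@flow_dini u x t q t) => //; last by case: (au t).
apply: H => //; first exact: ltW.
by move=> r Tr /andP[tr rq]; apply: (He r Tr); rewrite tr /=; lra.
Qed.

(* [kappa] absorbs a jump occurring just after [V] was at most the input gain. *)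
Definition kappa : R := Num.max 1 (expR (- d)).

Lemma sol_estimate b u x U : admissible_input u -> sol_upto b u x -> t0 <= b ->
  (forall s, t0 <= s -> s <= b -> `|u s| <= U) ->
  forall k a, t0 <= a -> a <= b -> Nimp T b a k ->
  V (x b) <= expR (- d * k%:R - c * (b - a)) * V (x a) \/
  exists s k', [/\ a <= s, s <= b, Nimp T b s k' &
    V (x b) <= expR (- d * k'%:R - c * (b - s)) * (kappa * gamma U)].
Proof.
move=> au sx t0b uU.
have [[cV _ _ _ _] _ _] := LF.
have U0 : 0 <= U by apply: le_trans (uU t0 (lexx _) t0b).
set r := gamma U; have r0 : 0 <= r by exact: eISS_gain_ge0.
have k1 : 1 <= kappa by rewrite le_max lexx.
have kd : expR (- d) <= kappa by rewrite le_max lexx orbT.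
have rk : r <= kappa * r by rewrite ler_peMl.
have gu s : t0 <= s -> s <= b -> gamma `|u s| <= r by move=> s1 s2; apply: eISS_gain_le => //; exact: uU.
have flow p q w : t0 <= p -> p < q -> q <= b -> (forall z, T z -> ~ (p < z < q)) ->
    V (x s) @[s --> q^'-] --> w ->
    w <= expR (- c * (q - p)) * V (x p) \/
    exists s, [/\ p <= s, s <= q & w <= expR (- c * (q - s)) * r].
  move=> t0p pq qb nT lw; apply: (@dini_decay R c p q r w (fun t => V (x t))) => //.
  - move=> t pt tq; apply: (@cvg_comp _ _ _ x V); last exact: cV.
    by apply: sol_cvg_right sx _ _; lra.
  - move=> t pt tq; apply: (@cvg_comp _ _ _ x V); last exact: cV.
    apply: sol_cvg_left sx _ _ _; [lra|lra|].
    by move=> Tt; apply: (nT t Tt); rewrite pt.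
  - move=> t pt tq rV e e0.
    have [| | |del del0 Hd] := sol_dini au sx (t := t) _ _ _ e0; [lra|lra| |].
      by apply: le_lt_trans rV; apply: gu; lra.
    by exists del => // h h0 hd _; exact: Hd.
elim=> [|k IH] a t0a ab Nk.
  have nT z : T z -> ~ (a < z <= b).
    move=> Tz az; case: Nk => l [_ Hl /size0nil E].
    by have := (Hl z).2 (conj Tz az); rewrite E.
  rewrite mulr0 add0r -mulNr.
  case: (ltP a b) => [ab'|ba]; last first.
    have -> : a = b by lra.
    by left; rewrite subrr mulr0 expR0 mul1r.
  have lw : V (x s) @[s --> b^'-] --> V (x b).
    apply: (@cvg_comp _ _ _ x V); last exact: cV.
    apply: sol_cvg_left sx _ _ _; [lra|lra|].
    by move=> Tb; apply: (nT b Tb); rewrite ab' lexx.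
  have [||||h|[s [as_ sb h]]] := flow a b _ _ _ _ _ lw => //.
  - by move=> z Tz /andP[az zb]; apply: (nT z Tz); rewrite az ltW.
  - by left.
  - right; exists s, 0%N; split=> //.
      case: Nk => l [ul Hl sl]; exists l; split=> // z.
      split=> [/Hl [Tz az]|[Tz /andP[sz zb]]]; first by exfalso; exact: (nT z Tz az).
      by exfalso; apply: (nT z Tz); rewrite zb andbT; lra.
    rewrite mulr0 add0r -mulNr; apply: (le_trans h).
    by rewrite ler_pM2l ?expR_gt0.
have [tau [Ttau atau taub nT [Nk' Nl]]] := Nimp_first Nk.
have [_ /(_ tau Ttau taub) [xl [ulim [xlim ulim' xtau]]]] := sx.
have lw : V (x s) @[s --> tau^'-] --> V xl by apply: (@cvg_comp _ _ _ x V) xlim _; exact: cV.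
have ulU : `|ulim| <= U.
  have nu : `|u s| @[s --> tau^'-] --> `|ulim| by apply: cvg_norm.
  apply: (ler_cvg_to nu (cvg_cst U)); near=> s; apply: uU.
    by have : a <= s; [near: s; exact: nbhs_left_ge|lra].
  by have : s < tau; [near: s; exact: nbhs_left_lt|lra].
have Vtau : V (x tau) <= Num.max (expR (- d) * V xl) r.
  rewrite xtau; apply: le_trans (jumpV _ _) _; rewrite ge_max !le_max lexx /=.
  by apply/orP; right; exact: eISS_gain_le.
have t0tau : t0 <= tau by lra.
(* A restart found after [tau] is kept unchanged; otherwise the estimate from [tau] is continued
   backwards across the jump and the flow on [[a, tau]]. *)
case: (IH tau t0tau taub Nk') => [Hb|[s [k' [ts sb Ns Hs]]]]; last first.
  by right; exists s, k'; split=> //; lra.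
have eb : 0 < expR (- d * k%:R - c * (b - tau)) by exact: expR_gt0.
(* When the jump is bounded by the gain, [tau] itself is the restart time. *)
move: Vtau; rewrite le_max => /orP[Vt|Vt]; last first.
  right; exists tau, k; split=> //; first exact: ltW.
  by apply: (le_trans Hb); rewrite ler_pM2l //; lra.
case: (flow a tau (V xl) t0a atau taub nT lw) => [Vl|[s [as_ st Vl]]].
  left; apply: (le_trans Hb).
  apply: (@le_trans _ _ (expR (- d * k%:R - c * (b - tau)) * (expR (- d) * (expR (- c * (tau - a)) * V (x a))))).
    by rewrite ler_pM2l //; apply: (le_trans Vt); rewrite ler_pM2l ?expR_gt0.
  rewrite !mulrA -!expRD -natr1.
  rewrite (_ : - d * k%:R - c * (b - tau) + - d + - c * (tau - a) = - d * (k%:R + 1) - c * (b - a)) //.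
  by ring.
(* If the gain bound is known only for the left limit at [tau], the jump at [tau] is not among those
   counted after [tau], and its factor goes into [kappa]. For [s < tau] the jump is counted, whence
   [k.+1]. *)
move: st; rewrite le_eqVlt => /orP[/eqP st|st].
  right; exists tau, k; split=> //; first exact: ltW.
  apply: (le_trans Hb); rewrite ler_pM2l //; apply: (le_trans Vt).
  move: Vl; rewrite st subrr mulr0 expR0 mul1r => Vl.
  by rewrite ler_pM ?expR_ge0 // eISS_LF_ge0.
right; exists s, k.+1; split; [exact: as_|lra|exact: Nl|].
apply: (le_trans Hb).
apply: (@le_trans _ _ (expR (- d * k%:R - c * (b - tau)) * (expR (- d) * (expR (- c * (tau - s)) * r)))).
  by rewrite ler_pM2l //; apply: (le_trans Vt); rewrite ler_pM2l ?expR_gt0.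
rewrite !mulrA -!expRD -natr1.
rewrite (_ : - d * k%:R - c * (b - tau) + - d + - c * (tau - s) = - d * (k%:R + 1) - c * (b - s)); last by ring.
by rewrite -mulrA ler_pM2l ?expR_gt0.
Unshelve. all: by end_near. Qed.

(** The class condition is applied to the window from [t0], or to the window from a restart time
    [s]; in the latter case the factor [expR (- lam * (b - s))] is bounded by 1. *)
Lemma sol_bound mu lam b u x U : 0 < lam -> class_S t0 c d mu lam T ->
  admissible_input u -> sol_upto b u x -> t0 <= b ->
  (forall s, t0 <= s -> s <= b -> `|u s| <= U) ->
  V (x b) <= Num.max (expR (mu - lam * (b - t0)) * V (x t0)) (expR mu * (kappa * gamma U)).
Proof.
move=> lam0 [_ HS] au sx t0b uU.
have U0 : 0 <= U by apply: le_trans (uU t0 (lexx _) t0b).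
have [k Nk] := Nimp_exists t0 b.
rewrite le_max; case: (sol_estimate au sx t0b uU (lexx t0) t0b Nk) => [h|[s [k' [t0s sb Ns h]]]].
  apply/orP; left; apply: (le_trans h); rewrite ler_wpM2r ?eISS_LF_ge0 // ler_expR.
  by have := HS b t0 k (lexx _) t0b Nk; lra.
apply/orP; right; apply: (le_trans h); rewrite ler_wpM2r //.
  by rewrite mulr_ge0 ?eISS_gain_ge0 // le_max ler01.
rewrite ler_expR; have := HS b s k' t0s sb Ns.
have : 0 <= lam * (b - s) by rewrite mulr_ge0 ?subr_ge0 // ltW.
lra.
Qed.

End ImpulsiveEstimate.

(** * Concatenation of flows, clamping to balls, boundedness of inputs *)

Section Gluing.
Context {R : realType}.
Notation mu := (@lebesgue_measure R).

Lemma integrable_cat (g : R -> R) a b c : a <= b -> b <= c ->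
  mu.-integrable `[a, b]%classic (EFin \o g) -> mu.-integrable `[b, c]%classic (EFin \o g) ->
  mu.-integrable `[a, c]%classic (EFin \o g).
Proof.
move=> ab bc i1 i2.
have i3 : mu.-integrable `]b, c]%classic (EFin \o g).
  apply: integrableS i2; [exact: measurable_itv|exact: measurable_itv|].
  by move=> x /=; rewrite !in_itv /= => /andP[? ?]; apply/andP; split; lra.
have -> : `[a, c]%classic = `[a, b]%classic `|` `]b, c]%classic.
  apply/seteqP; split=> x /=; rewrite !in_itv /=.
    by move=> /andP[ax xc]; case: (leP x b) => xb; [left|right]; rewrite ?ax ?xb.
  by case=> /andP[h1 h2]; apply/andP; split; lra.
have /integrableP[m1 f1] := i1; have /integrableP[m3 f3] := i3.
have mU : measurable_fun (`[a, b]%classic `|` `]b, c]%classic) (EFin \o g).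
  by apply/measurable_funU; [exact: measurable_itv|exact: measurable_itv|].
apply/integrableP; split=> //.
rewrite ge0_integral_setU //=.
- by rewrite lte_add_pinfty.
- apply/measurable_EFinP; apply: measurableT_comp; first exact: normr_measurable.
  by apply/measurable_EFinP; exact: mU.
- rewrite disj_set2E; apply/disj_setPS => x [] /=; rewrite !in_itv /= => /andP[_ h1] /andP[h2 _]; lra.
Qed.

Variables (NN MM : nat) (f : 'rV[R]_NN -> 'rV[R]_MM -> 'rV[R]_NN).

Lemma flow_on_eq u x y a b : (forall t, a <= t -> t <= b -> x t = y t) ->
  flow_on f u x a b -> flow_on f u y a b.
Proof.
move=> xy H a' b' aa ab bb j; have [ig E] := H a' b' aa ab bb j.
have E2 : {in `[a', b']%classic, (fun s => f (x s) (u s) 0 j) =1 (fun s => f (y s) (u s) 0 j)}.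
  move=> s; rewrite inE /= in_itv /= => /andP[s1 s2]; rewrite xy //; lra.
split.
  apply: eq_integrable ig; first exact: measurable_itv.
  by move=> s /E2 /= ->.
have yb : y b' = x b' by rewrite xy; [by []|lra|lra].
have ya : y a' = x a' by rewrite xy; [by []|lra|lra].
by rewrite yb ya E; congr (_ + _); exact: eq_Rintegral.
Qed.

Lemma flow_on_point u x a : flow_on f u x a a.
Proof.
move=> p q ap pq qa j.
have [-> ->] : p = a /\ q = a by split; lra.
rewrite set_itv1 Rintegral_set1 addr0; split=> //.
rewrite -set_itv1; apply: eq_integrable (integrable_cst_itv a a (f (x a) (u a) 0 j)).
  exact: measurable_itv.
by move=> s; rewrite inE /= in_itv /= => /andP[s1 s2]; have -> : s = a by lra.
Qed.

Lemma flow_on_cat u x a b c : a <= b -> b <= c ->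
  flow_on f u x a b -> flow_on f u x b c -> flow_on f u x a c.
Proof.
move=> ab bc H1 H2 p q ap pq qc j.
case: (leP q b) => qb; first by apply: H1.
case: (leP b p) => bp; first by apply: H2.
have [i1 E1] := H1 p b ap (ltW bp) (lexx b) j.
have [i2 E2] := H2 b q (lexx b) (ltW qb) qc j.
have ig := integrable_cat (ltW bp) (ltW qb) i1 i2.
split=> //; rewrite E2 E1 -addrA -Rintegral_cat //; exact: ltW.
Qed.

(** A retraction onto the ball of the sup norm, for [0 <= r]. Composition with it makes a locally
    Lipschitz field bounded and globally Lipschitz, as the Picard iteration requires. *)
Definition clamp n (r : R) (x : 'rV[R]_n) : 'rV[R]_n := \row_j Num.max (- r) (Num.min r (x 0 j)).

Lemma clamp_norm n (r : R) (x : 'rV[R]_n) : 0 <= r -> `|clamp r x| <= r.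
Proof.
move=> r0; apply/rV_norm_leP => // j; rewrite mxE ler_norml le_max lexx /=.
by rewrite ge_max ge_min lexx andbT; lra.
Qed.

Lemma clamp_id n (r : R) (x : 'rV[R]_n) : `|x| <= r -> clamp r x = x.
Proof.
move=> xr; apply/rowP => j; rewrite mxE.
have := le_trans (rV_coord_le x j) xr; rewrite ler_norml => /andP[h1 h2].
by rewrite (min_idPr h2) (max_idPr h1).
Qed.

Lemma clamp_lip n (r : R) (x y : 'rV[R]_n) : `|clamp r x - clamp r y| <= `|x - y|.
Proof.
apply/rV_norm_leP => // j; rewrite !mxE.
have := rV_coord_le (x - y) j; rewrite !mxE; apply: le_trans.
move: (x 0 j) (y 0 j) => p q.
wlog pq : p q / p <= q.
  by move=> H; case: (leP p q) => [|/ltW] /H //; rewrite distrC (distrC p).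
have mm : 0 <= Num.min r q - Num.min r p <= q - p.
  by case: (leP r p) => h1; case: (leP r q) => h2; apply/andP; split; lra.
have MM1 : 0 <= Num.max (- r) (Num.min r q) - Num.max (- r) (Num.min r p) <= q - p.
  move: mm; move: (Num.min r p) (Num.min r q) => m1 m2 /andP[m12 mpq].
  by case: (leP (- r) m1) => h1; case: (leP (- r) m2) => h2; apply/andP; split; lra.
by rewrite distrC (distrC p) !ger0_norm; lra.
Qed.

(** Near [t] the input is within 1 of its left limit before [t], and of [u t] after it; compactness
    of the interval concludes. *)
Lemma admissible_bounded (u : R -> 'rV[R]_MM) a b : admissible_input u ->
  exists U, forall s, a <= s -> s <= b -> `|u s| <= U.
Proof.
move=> au.
have [t _|M HM] := @compact_uniform _ _ _ (fun L t => `|u t| <= L) (@segment_compact R a b).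
  have [/cvgrPdist_lt /(_ 1 ltr01) [d1 /= d10 H1]] := au t.
  move=> [l /cvgrPdist_lt /(_ 1 ltr01) [d2 /= d20 H2]].
  exists (Num.min d1 d2), (Num.max (`|u t| + 1) (`|l| + 1)).
  split; first by rewrite lt_min d10.
  move=> s L; rewrite lt_min distrC => /andP[s1 s2]; rewrite ge_max => /andP[L1 L2].
  have tri (p : 'rV[R]_MM) : `|p - u s| < 1 -> `|u s| <= `|p| + 1.
    move=> ps; rewrite -[u s](subrK p) addrC; apply: le_trans (ler_normD _ _) _.
    by rewrite lerD2l distrC ltW.
  case: (ltgtP s t) => [st|ts|->]; last by lra.
    by apply: le_trans L2; apply: tri; exact: H2.
  by apply: le_trans L1; apply: tri; exact: H1.
exists M => s as_ sb; apply: HM => //=.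
by rewrite in_itv /= as_.
Qed.

End Gluing.

(** * Existence of global solutions *)

Section Existence.
Context {R : realType}.
Notation mu := (@lebesgue_measure R).
Variables (NN MM : nat) (f g : 'rV[R]_NN -> 'rV[R]_MM -> 'rV[R]_NN).
Variables (V : 'rV[R]_NN -> R) (gamma : R -> R) (c d : R).
Hypothesis lipf : loc_lip2 f.
Hypothesis LF : eISS_LF f g V gamma c d.
Hypothesis jumpV : forall x u, V (g x u) <= Num.max (expR (- d) * V x) (gamma `|u|).
Variables (m lam t0 : R) (T : set R).
Hypothesis lam_gt0 : 0 < lam.
Hypothesis T_class : class_S t0 c d m lam T.
Variable u : R -> 'rV[R]_MM.
Hypothesis au : admissible_input u.

Definition glue (b : R) (x y : R -> 'rV[R]_NN) (t : R) := if t <= b then x t else y t.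

Lemma glue_flow x y a b e : a <= b -> b <= e -> y b = x b ->
  flow_on f u x a b -> flow_on f u y b e -> flow_on f u (glue b x y) a e.
Proof.
move=> ab be yb fx fy; apply: (flow_on_cat ab be).
  by apply: flow_on_eq fx => t _ tb; rewrite /glue tb.
apply: flow_on_eq fy => t bt _; rewrite /glue; case: ifP => // tb.
by have -> : t = b by lra.
Qed.

Lemma glue_cvg_left x y b t (l : 'rV[R]_NN) : t <= b -> x s @[s --> t^'-] --> l ->
  glue b x y s @[s --> t^'-] --> l.
Proof.
move=> tb; apply: cvg_trans; apply: near_eq_cvg.
near=> s; rewrite /glue; have st : s < t by near: s; exact: nbhs_left_lt.
by rewrite (le_trans (ltW st)).
Unshelve. all: by end_near. Qed.

Lemma sol_glue x y b e : t0 <= b -> b <= e -> y b = x b ->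
  sol_upto f g t0 T b u x -> flow_on f u y b e -> (forall r, T r -> ~ (b < r <= e)) ->
  sol_upto f g t0 T e u (glue b x y).
Proof.
move=> t0b be yb [H1 H2] fy nT; split.
  move=> p q tp pq qe nTpq.
  case: (leP q b) => qb.
    by apply: flow_on_eq (H1 p q tp pq qb nTpq) => t _ tq; rewrite /glue (le_trans tq).
  case: (leP b p) => bp.
    apply: flow_on_eq (flow_onW bp qe fy) => t pt tq; rewrite /glue; case: ifP => // tb.
    by have -> : t = b by lra.
  apply: glue_flow; [exact: ltW|exact: ltW|exact: yb| |exact: flow_onW fy].
  apply: H1 => //; first exact: ltW.
  by move=> r Tr /andP[pr rb]; apply: (nTpq r Tr); rewrite pr; lra.
move=> t Tt te; case: (leP t b) => tb.
  have [xl [ul [xlim ulim xt]]] := H2 t Tt tb.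
  by exists xl, ul; split=> //; [exact: glue_cvg_left|rewrite /glue tb].
by exfalso; apply: (nT t Tt); rewrite tb.
Qed.

(* The field is clamped to the balls given by the a priori bound on [V] and the bound on [u];
   real induction along the Picard solution shows that the clamps are never active. *)
Lemma flow_extend x b tau : t0 <= b -> b < tau -> sol_upto f g t0 T b u x ->
  (forall r, T r -> ~ (b < r < tau)) ->
  exists2 y, y b = x b & flow_on f u y b tau.
Proof.
move=> t0b btau sx nT.
have T_imp : impulse_times t0 T by case: T_class.
have [[cV _ _ ruV _] _ _] := LF.
have [U uU] := admissible_bounded t0 tau au.
have U0 : 0 <= U by apply: le_trans (uU t0 (lexx _) _); [exact: normr_ge0|lra].
(* A bound common to all times up to [tau]: the factor [expR (- lam * (b' - t0))] of the a priori
   estimate is dropped. *)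
pose Bd := Num.max (expR m * V (x t0)) (expR m * (kappa d * gamma U)).
have bound b' z : t0 <= b' -> b' <= tau -> z t0 = x t0 -> sol_upto f g t0 T b' u z ->
    V (z b') <= Bd.
  move=> t0b' b'tau z0 sz.
  have uU' s : t0 <= s -> s <= b' -> `|u s| <= U by move=> s1 s2; apply: uU; lra.
  apply: le_trans (sol_bound lipf LF jumpV T_imp lam_gt0 T_class au sz t0b' uU') _.
  rewrite z0 ge_max /Bd !le_max lexx orbT andbT; apply/orP; left.
  rewrite ler_wpM2r ?(eISS_LF_ge0 LF) // ler_expR gerBl mulr_ge0 ?subr_ge0 //; exact: ltW.
(* The margin 1 turns [V z <= Bd] into the strict inequality [|z| < rho], an open condition that
   persists a little to the right. *)
have [r0 Hr0] := ruV (Bd + 1).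
pose rho := Num.max 0 r0.
have rho0 : 0 <= rho by rewrite le_max lexx.
have small z : V z <= Bd -> `|z| < rho.
  move=> Vz; have : `|z| < r0 by rewrite ltNge; apply/negP => /Hr0; lra.
  by move=> /lt_le_trans; apply; rewrite le_max lexx orbT.
have [L L1 HL] := loc_lip2_on_balls (Num.max rho U) lipf.
have L0 : 0 < L by lra.
pose F (t : R) (z : 'rV[R]_NN) := f (clamp rho z) (clamp U (u t)).
have cx (z : 'rV[R]_NN) : `|clamp rho z| <= Num.max rho U by rewrite le_max clamp_norm.
have cu t : `|clamp U (u t)| <= Num.max rho U by rewrite le_max clamp_norm // orbT.
have FB t z : `|F t z| <= L by case: (HL _ _ _ _ (cx z) (cx z) (cu t) (cu t)).
have FL t z w : `|F t z - F t w| <= L * `|z - w|.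
  have [_] := HL _ _ _ _ (cx z) (cx w) (cu t) (cu t); rewrite subrr normr0 addr0.
  by move=> /le_trans; apply; rewrite ler_pM2l // clamp_lip.
have Frc z t : F s z @[s --> t^'+] --> F t z.
  apply/cvgrPdist_lt => e e0; have [/cvgrPdist_lt /(_ _ (divr_gt0 e0 L0)) Hu _] := au t.
  apply: filterS Hu => s us.
  have [_] := HL _ _ _ _ (cx z) (cx z) (cu t) (cu s); rewrite subrr normr0 add0r.
  move=> /le_lt_trans; apply; rewrite mulrC -ltr_pdivlMr //.
  by apply: le_lt_trans us; exact: clamp_lip.
have [y [ly Hy]] := picard_solution (ltW L0) L1 FB FL Frc b (x b).
have yb : y b = x b.
  apply/rowP => j; have [_ ->] := Hy b (lexx b) j.
  by rewrite set_itv1 Rintegral_set1 addr0.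
have flowb q : b <= q -> q <= tau -> (forall r, b <= r -> r <= q -> `|y r| <= rho) ->
    flow_on f u y b q.
  move=> bq qtau yr p q' bp pq' q'q j.
  have E : {in `[p, q']%classic, (fun s => F s (y s) 0 j) =1 (fun s => f (y s) (u s) 0 j)}.
    move=> s; rewrite inE /= in_itv /= => /andP[s1 s2].
    rewrite /F clamp_id; last by apply: yr; lra.
    by rewrite clamp_id //; apply: uU; lra.
  have ig : mu.-integrable `[p, q']%classic (EFin \o (fun s => F s (y s) 0 j)).
    exact: (field_integrable (ltW L0) L1 FB FL Frc).
  split.
    apply: eq_integrable ig; first exact: measurable_itv.
    by move=> s /E /= ->.
  have <- : Rintegral mu `[p, q']%classic (fun s => F s (y s) 0 j) =
      Rintegral mu `[p, q']%classic (fun s => f (y s) (u s) 0 j) by exact: eq_Rintegral.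
  have bq' : b <= q' by lra.
  have [igq ->] := Hy q' bq' j; have [_ ->] := Hy p bp j.
  by rewrite -addrA -(Rintegral_cat bp pq').
have ycont s : y t @[t --> s] --> y s.
  apply/cvgrPdist_lt => e e0; have eL : 0 < e / L by rewrite divr_gt0.
  apply/nbhs_normP; exists (e / L) => //= t /=; rewrite ltr_pdivlMr // mulrC => st.
  apply: le_lt_trans st; case: (leP s t) => st.
    by rewrite distrC ler0_norm ?opprB ?ly // subr_le0.
  by rewrite ger0_norm ?ly ?subr_ge0 // ltW.
have VB : forall s, b <= s -> s <= tau -> V (y s) <= Bd.
  apply: (@real_induction R b tau (fun s => V (y s) <= Bd)).
  - by rewrite yb; apply: bound => //; exact: ltW.
  - move=> s bs stau Hs.
    have ys : `|y s| < rho by apply: small; apply: Hs.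
    have ny : `|y t| @[t --> s] --> `|y s| by apply: cvg_norm; exact: ycont.
    have /cvgr_lt /(_ _ ys) /nbhs_normP[e /= e0 He] := ny.
    exists (Num.min e (tau - s)); first by rewrite lt_min e0 subr_gt0.
    move=> t st; rewrite -ltrBlDl lt_min => /andP[te tt] _.
    have tt' : t < tau by lra.
    have bt : b <= t by lra.
    have fy : flow_on f u y b t.
      apply: flowb => //; first exact: ltW.
      move=> r br rt; case: (leP r s) => rs; first by apply/ltW/small; apply: Hs.
      by apply/ltW/He; rewrite /= ltr0_norm; lra.
    have nTt r : T r -> ~ (b < r <= t).
      by move=> Tr /andP[br rt]; apply: (nT r Tr); rewrite br; lra.
    have := bound t _ (le_trans t0b bt) (ltW tt') _ (sol_glue t0b bt yb sx fy nTt).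
    rewrite /glue t0b => /(_ erefl); case: (leP t b) => // tb.
    by exfalso; lra.
  - move=> s bs stau Hs.
    have Vy : V (y t) @[t --> s^'-] --> V (y s).
      by apply: cvg_at_left_filter; apply: (@cvg_comp _ _ _ y V); [exact: ycont|exact: cV].
    apply: (ler_cvg_to Vy (cvg_cst Bd)); near=> t; apply: Hs; near: t.
      exact: nbhs_left_ge.
    exact: nbhs_left_lt.
exists y => //; apply: flowb; [exact: ltW|exact: lexx|].
by move=> r br rt; apply/ltW/small; exact: VB.
Unshelve. all: by end_near. Qed.

Lemma sol_extend_first x b tau : t0 <= b -> b < tau -> sol_upto f g t0 T b u x ->
  (forall r, T r -> ~ (b < r < tau)) ->
  exists2 z, sol_upto f g t0 T tau u z & forall t, t <= b -> z t = x t.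
Proof.
move=> t0b btau sx nT.
have [y yb fy] := flow_extend t0b btau sx nT.
case: (pselect (T tau)) => Ttau; last first.
  exists (glue b x y); last by move=> t tb; rewrite /glue tb.
  apply: sol_glue => //; first exact: ltW.
  move=> r Tr /andP[br]; rewrite le_eqVlt => /orP[/eqP E|rt]; first by apply: Ttau; rewrite -E.
  by apply: (nT r Tr); rewrite br.
have [_ [ul ulim]] := au tau.
pose w := glue b x y.
(* The Picard curve already continues the flow up to [tau]; only its value there is replaced by the
   jump from the left limits. *)
pose z t := if t == tau then g (y tau) ul else w t.
have zw t : t < tau -> z t = w t by move=> tt; rewrite /z lt_eqF.
have sw q : b <= q -> q < tau -> sol_upto f g t0 T q u w.
  move=> bq qt; apply: sol_glue => //; first exact: flow_onW (lexx b) (ltW qt) fy.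
  by move=> r Tr /andP[br rq]; apply: (nT r Tr); rewrite br; lra.
exists z; last by move=> t tb; rewrite zw /w /glue ?tb //; lra.
split.
  move=> p q t0p pq qtau nTpq; case: (ltP q tau) => qt; last first.
    have qE : q = tau by lra.
    case: (ltP p q) => pq'; first by exfalso; apply: (nTpq tau Ttau); rewrite -qE pq' lexx.
    have -> : p = q by lra.
    exact: flow_on_point.
  have [H _] := sw (Num.max b q) ltac:(by rewrite le_max lexx) ltac:(by rewrite gt_max btau).
  have qm : q <= Num.max b q by rewrite le_max lexx orbT.
  by apply: flow_on_eq (H p q t0p pq qm nTpq) => t _ tq; rewrite zw //; lra.
move=> t Tt; rewrite le_eqVlt => /orP[/eqP ->|tt].
  exists (y tau), ul; split=> //; last by rewrite /z eqxx.
  apply: cvg_trans (flow_cvg_left fy btau (lexx tau)); apply: near_eq_cvg.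
  near=> s; rewrite zw; last by near: s; exact: nbhs_left_lt.
  rewrite /w /glue leNgt; suff -> : b < s by [].
  by near: s; exact: nbhs_left_gt.
have [_ H] := sw (Num.max b t) ltac:(by rewrite le_max lexx) ltac:(by rewrite gt_max btau).
have tm : t <= Num.max b t by rewrite le_max lexx orbT.
have [xl [ul' [xlim ulim' xt]]] := H t Tt tm.
exists xl, ul'; split=> //; last by rewrite zw.
apply: cvg_trans xlim; apply: near_eq_cvg; near=> s; rewrite zw //.
by apply: lt_trans tt; near: s; exact: nbhs_left_lt.
Unshelve. all: by end_near. Qed.

Lemma sol_extend x b b' : t0 <= b -> b <= b' -> sol_upto f g t0 T b u x ->
  exists2 z, sol_upto f g t0 T b' u z & forall t, t <= b -> z t = x t.
Proof.
have T_imp : impulse_times t0 T by case: T_class.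
have [k] := Nimp_exists T_imp b b'.
elim: k x b => [|k IH] x b Nk t0b bb' sx.
  case: (ltP b b') => lt_b; last first.
    by exists x => //; have -> : b' = b by lra.
  apply: sol_extend_first => // r Tr /andP[br rb].
  case: Nk => l [_ Hl /size0nil E].
  have : r \in l by apply/Hl; split=> //; rewrite br ltW.
  by rewrite E.
have [tau [Ttau btau taub nT [Nk' _]]] := Nimp_first Nk.
have [y sy yx] := sol_extend_first t0b btau sx nT.
have [z sz zy] := IH y tau Nk' ltac:(lra) taub sy.
exists z => // t tb; rewrite zy ?yx //; lra.
Qed.

Lemma sol_exists x0 : exists x, is_solution f g t0 T u x0 x.
Proof.
have T_imp : impulse_times t0 T by case: T_class.
(* A total choice of extensions by one time unit; the claim is void for functions that are not
   solutions. *)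
have /choice[F HF] : forall p : nat * (R -> 'rV[R]_NN), exists z,
    sol_upto f g t0 T (t0 + p.1%:R) u p.2 ->
    sol_upto f g t0 T (t0 + p.1.+1%:R) u z /\ forall t, t <= t0 + p.1%:R -> z t = p.2 t.
  move=> [k x] /=; case: (pselect (sol_upto f g t0 T (t0 + k%:R) u x)) => [sx|]; last by exists x.
  have [||z sz zx] := @sol_extend x (t0 + k%:R) (t0 + k.+1%:R) _ _ sx.
  - by rewrite lerDl.
  - by rewrite lerD2l ler_nat.
  by exists z.
pose X := fix X k := if k is k'.+1 then F (k', X k') else (fun=> x0).
have sX k : sol_upto f g t0 T (t0 + k%:R) u (X k).
  elim: k => [|k IH]; last by have [] := HF (k, X k) IH.
  rewrite addr0; split=> [p q tp pq qt _|t Tt tt].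
    have [-> ->] : p = t0 /\ q = t0 by split; lra.
    exact: flow_on_point.
  by case: T_imp => /(_ t Tt) /=; lra.
have XS k t : t <= t0 + k%:R -> X k.+1 t = X k t by have [_] := HF (k, X k) (sX k); apply.
have XD k i t : t <= t0 + k%:R -> X (k + i)%N t = X k t.
  move=> tk; elim: i => [|i IH]; first by rewrite addn0.
  rewrite addnS XS // (le_trans tk) // lerD2l ler_nat leq_addr //.
pose K t := (Num.truncn (t - t0)).+1.
have tK t : t <= t0 + (K t)%:R by rewrite -lerBlDl ltW // truncnS_gt.
pose x t := X (K t) t.
have xX k t : t <= t0 + k%:R -> x t = X k t.
  move=> tk; rewrite /x; case: (leqP (K t) k) => Kk.
    by rewrite -(subnKC Kk) XD.
  by rewrite -(subnKC (ltnW Kk)) XD.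
exists x; split.
- rewrite (xX 0%N) //; first by rewrite addr0.
- move=> p q tp pq nT j.
  have [H _] := sX (K q).
  have := flow_on_eq (y := x) _ (H p q tp pq (tK q) nT).
  move=> /(_ _)/wrap[].
    by move=> t _ tq; rewrite (xX (K q)) // (le_trans tq).
  by move=> /(_ p q (lexx p) pq (lexx q) j).
- move=> t Tt; have [_ H] := sX (K t).
  have [xl [ul [xlim ulim xt]]] := H t Tt (tK t).
  exists xl, ul; split=> //.
  apply: cvg_trans xlim; apply: near_eq_cvg; near=> s.
  rewrite (xX (K t)) // (le_trans _ (tK t)) // ltW //.

Unshelve. all: by end_near. Qed.

End Existence.

(** * Uniform input-to-state stability *)

Section UniformISS.
Context {R : realType}.
Variables (NN MM : nat) (f g : 'rV[R]_NN -> 'rV[R]_MM -> 'rV[R]_NN).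

(** Small values of [V] force small |x|: on bounded shells [V] has a positive lower bound, and far
    away it is at least 1 by radial unboundedness. *)
Lemma norm_le_classKinf (V : 'rV[R]_NN -> R) :
  continuous V -> pos_def V -> radially_unbounded V ->
  exists2 psi, classKinf psi & forall x, `|x| <= psi (V x).
Proof.
move=> cV [V0 Vpos] ruV.
have V_nneg x : 0 <= V x by have [->|/Vpos/ltW//] := eqVneq x 0; rewrite V0.
apply: (@classKinf_majorant R _ (fun x : 'rV[R]_NN => `|x|) V 0) => //.
move=> e e0; have [r Hr] := ruV 1.
have [m m0 Hm] := @positive_on_shell _ _ V e r cV Vpos e0.
exists (Num.min m 1); first by rewrite lt_min m0 ltr01.
move=> x; rewrite lt_min => /andP[Vm V1]; rewrite ltNge; apply/negP => ex.
case: (leP `|x| r) => xr; first by have := Hm x ex xr; lra.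
by have := Hr x (ltW xr); lra.
Qed.

Lemma classKinf_ge_pos_def (V : 'rV[R]_NN -> R) :
  continuous V -> pos_def V -> exists2 chi, classKinf chi & forall x, V x <= chi `|x|.
Proof.
move=> cV [V0 Vpos].
have V_nneg x : 0 <= V x by have [->|/Vpos/ltW//] := eqVneq x 0; rewrite V0.
apply: (@classKinf_majorant R _ V (fun x : 'rV[R]_NN => `|x|) 0) => //.
- exact: normr0.
- move=> e e0; have /cvgrPdist_lt /(_ _ e0) /nbhs_normP[d /= d0 Hd] := cV 0.
  exists d => // x xd; have := Hd x; rewrite /= sub0r normrN V0 sub0r normrN => /(_ xd).
  exact: le_lt_trans (ler_norm _).
- move=> K; have [M HM] := @continuous_bounded_ball _ _ V K cV.
  exists (M + 1) => x Vx; rewrite leNgt; apply/negP => /ltW/HM; lra.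
Qed.

Lemma classKL_exp (psi chi : R -> R) (m lam : R) : 0 < lam -> classKinf psi -> classKinf chi ->
  classKL (fun r t => psi (expR (m - lam * t) * chi r)).
Proof.
move=> lam0 [Kp _] [Kc _].
have chi0 r : 0 <= r -> 0 <= chi r by exact: classK_ge0.
have [psi0 /within_ge0_continuousP cpsi _] := Kp.
split=> [t t0|r r0].
  by apply: (classK_comp Kp); apply: classK_scale => //; exact: expR_gt0.
have arg0 t : 0 <= expR (m - lam * t) * chi r by rewrite mulr_ge0 ?expR_ge0 ?chi0.
split.
- apply/within_ge0_continuousP => t t0 e e0.
  have [d d0 Hd] := cpsi _ (arg0 t) e e0.
  have ce : {for t, continuous (fun t => expR (m - lam * t) * chi r)}.
    apply: cvgM; last exact: cvg_cst.
    apply: continuous_comp; last exact: continuous_expR.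
    by apply: cvgB; [exact: cvg_cst|apply: cvgM; [exact: cvg_cst|exact: cvg_id]].
  move/cvgrPdist_lt: ce => /(_ _ d0) /nbhs_normP[d' /= d'0 Hd'].
  exists d' => // s s0 st; apply: Hd => //.
  by rewrite distrC; apply: Hd' => /=; rewrite distrC.
- move=> t1 t2 t10 t12; apply: classK_le => //.
  rewrite ler_wpM2r ?chi0 // ler_expR lerD2l lerN2 ler_pM2l //.
- apply/cvgrPdist_lt => e e0.
  have [d d0 Hd] := cpsi 0 (lexx 0) e e0.
  pose C := expR m * chi r.
  have C0 : 0 <= C by rewrite mulr_ge0 ?expR_ge0 ?chi0.
  (* Beyond this time [C < d * (lam * t)], and [lam * t <= expR (lam * t)]. *)
  exists (C / d / lam); split; first exact: num_real.
  move=> t Ct; rewrite distrC -psi0; apply: Hd => //.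
  rewrite subr0 ger0_norm // expRD mulrAC -/C expRN ltr_pdivrMr ?expR_gt0 //.
  have lt : C < d * (lam * t) by move: Ct; rewrite ltr_pdivrMr // ltr_pdivrMr // mulrC (mulrC t).
  apply: (lt_le_trans lt); rewrite ler_pM2l //.
  by apply: le_trans (expR_ge1Dx _); lra.
Qed.

(** [psi] and [chi] compare [V] with the norm. The impulse sequence enters only through the class
    bound, so the comparison functions are common to the class. *)
Lemma eISS_UISS (V : 'rV[R]_NN -> R) (gamma : R -> R) (c d m lam t0 : R) :
  loc_lip2 f -> eISS_LF f g V gamma c d ->
  (forall x u, V (g x u) <= Num.max (expR (- d) * V x) (gamma `|u|)) ->
  0 < lam -> UISS f g t0 (class_S t0 c d m lam).
Proof.
move=> lipf LF jumpV lam0.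
have [[cV _ pV ruV Kg] _ _] := LF.
have [psi Kpsi Hpsi] := norm_le_classKinf cV pV ruV.
have [chi Kchi Hchi] := classKinf_ge_pos_def cV pV.
have kap0 : 0 < kappa d by rewrite lt_max ltr01.
exists (fun r t => psi (expR (m - lam * t) * chi r)).
exists (fun r => psi (expR m * (kappa d * gamma r))).
split; first exact: classKL_exp.
  apply: (classKinf_comp Kpsi); apply: classKinf_scale; first exact: expR_gt0.
  exact: classKinf_scale.
move=> T ST x0 u au; split.
  exact: (sol_exists lipf LF jumpV lam0 ST au).
move=> x [xt0 xflow ximp] t t0t.
have T_imp : impulse_times t0 T by case: ST.
have sx : sol_upto f g t0 T t u x.
  split=> [p q tp pq qt nT p' q' pp' pq' qq' j|s Ts _]; last exact: ximp.
  apply: xflow => //; first lra.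
  by move=> r Tr /andP[pr rq]; apply: (nT r Tr); apply/andP; split; lra.
set S := [set `|u s| | s in `[t0, t]%classic].
have uS s : t0 <= s -> s <= t -> `|u s| <= sup S.
  move=> s1 s2; apply: ub_le_sup; last by exists s => //=; rewrite in_itv /= s1.
  have [U HU] := admissible_bounded t0 t au.
  exists U => _ [r /= + <-]; rewrite in_itv /= => /andP[]; exact: HU.
have S0 : 0 <= sup S by apply: le_trans (uS t0 (lexx _) t0t).
have := sol_bound lipf LF jumpV T_imp lam0 ST au sx t0t uS.
rewrite xt0 !le_max => /orP[h|h]; apply/orP; [left|right];
  apply: (le_trans (Hpsi _)); apply: (classK_le Kpsi.1); rewrite ?(eISS_LF_ge0 LF) //.
by apply: (le_trans h); rewrite ler_pM2l ?expR_gt0.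
Qed.

End UniformISS.

(** * The interconnection *)

Section FiniteExtrema.
Context {R : realType} {n : nat}.
Hypothesis n_gt0 : (0 < n)%N.
Implicit Type F : 'I_n -> R.

(** The default of the big maximum is itself a value [F i0], so it does not change the maximum. The
    index [i0] is the same for all [F], which lets a family depending on a parameter be treated at
    once. *)
Lemma fmaxE : exists i0 : 'I_n, forall F, fmax F = \big[Num.max/F i0]_(i < n) F i.
Proof.
pose j0 : 'I_n := Ordinal n_gt0.
exists (head j0 (enum 'I_n)) => F; rewrite /fmax.
suff -> : head 0 [seq F i | i <- enum 'I_n] = F (head j0 (enum 'I_n)) by [].
have := mem_enum 'I_n j0; rewrite inE.
by case: (enum _).
Qed.

Lemma fminE : exists i0 : 'I_n, forall F, fmin F = \big[Num.min/F i0]_(i < n) F i.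
Proof.
pose j0 : 'I_n := Ordinal n_gt0.
exists (head j0 (enum 'I_n)) => F; rewrite /fmin.
suff -> : head 0 [seq F i | i <- enum 'I_n] = F (head j0 (enum 'I_n)) by [].
have := mem_enum 'I_n j0; rewrite inE.
by case: (enum _).
Qed.

Lemma fmax_ge F i : F i <= fmax F.
Proof. by have [i0 ->] := fmaxE; exact: le_bigmax. Qed.

Lemma fmax_attained F : exists i, fmax F = F i.
Proof.
have [i0 ->] := fmaxE.
elim/big_ind: _ => [|x y [i ->] [j ->]|i _]; [by exists i0| |by exists i].
by case: (leP (F i) (F j)) => _; [exists j|exists i].
Qed.

Lemma fmin_le F i : fmin F <= F i.
Proof. by have [i0 ->] := fminE; exact: bigmin_le. Qed.

Lemma classKinf_fmax (F : 'I_n -> R -> R) : (forall i, classKinf (F i)) ->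
  classKinf (fun r => fmax (fun i => F i r)).
Proof.
move=> KF; have [i0 E] := fmaxE.
have -> : (fun r => fmax (fun i => F i r)) = (fun r => \big[Num.max/F i0 r]_(i < n) F i r).
  by apply/funext => r; rewrite E.
elim: (index_enum _) => [|i l IH].
  by have -> : (fun r => \big[Num.max/F i0 r]_(i <- [::]) F i r) = F i0
    by [apply/funext => r; rewrite big_nil|].
have -> : (fun r => \big[Num.max/F i0 r]_(j <- i :: l) F j r) =
  (fun r => Num.max (F i r) (\big[Num.max/F i0 r]_(j <- l) F j r)).
  by apply/funext => r; rewrite big_cons.
exact: classKinf_max.
Qed.

Lemma common_radius (I : finType) (P : I -> R -> Prop) :
  (forall i r r', r' <= r -> P i r -> P i r') ->
  (forall i, exists2 r, 0 < r & P i r) -> exists2 r, 0 < r & forall i, P i r.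
Proof.
move=> mono H.
have /choice[r Hr] : forall i, exists r, 0 < r /\ P i r.
  by move=> i; have [r] := H i; exists r.
exists (\big[Num.min/1]_i r i).
  by elim/big_ind: _ => // [x y x0 y0|i _]; [rewrite lt_min x0|case: (Hr i)].
by move=> i; apply: mono (Hr i).2; exact: bigmin_le.
Qed.

Lemma common_bound (I : finType) (P : I -> R -> Prop) :
  (forall i r r', r <= r' -> P i r -> P i r') ->
  (forall i, exists r, P i r) -> exists2 r, 0 <= r & forall i, P i r.
Proof.
move=> mono /choice[r Hr]; exists (\big[Num.max/0]_i r i).
  exact: bigmax_ge_id.
by move=> i; apply: mono (Hr i); exact: le_bigmax.
Qed.

End FiniteExtrema.

(** * Block decomposition of states and inputs *)

Section Blocks.
Context {R : realType} {n : nat}.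

(** [blk] as a linear map, convertible to it, which gives access to its continuity and its
    differential. *)
Definition blk_linear (N : 'I_n -> nat) (i : 'I_n) :
  {linear 'rV[R]_(\sum_(j < n) N j) -> 'rV[R]_(N i)} := mxsub id (tagnat.Rank i).

Lemma blkB N (x y : 'rV[R]_(\sum_(j < n) N j)) i : blk (x - y) i = blk x i - blk y i.
Proof. exact: submxrowB. Qed.

Lemma blk_norm_le N (x : 'rV[R]_(\sum_(j < n) N j)) i : `|blk x i| <= `|x|.
Proof. by apply/rV_norm_leP => // k; rewrite mxE; exact: rV_coord_le. Qed.

Lemma norm_le_blk N (x : 'rV[R]_(\sum_(j < n) N j)) r : 0 <= r ->
  (forall i, `|blk x i| <= r) -> `|x| <= r.
Proof.
move=> r0 H; apply/rV_norm_leP => // j.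
have -> : x 0 j = blk x (tagnat.sig1 j) 0 (tagnat.sig2 j).
  by rewrite /blk -{1}(submxrowK x) mxE.
exact: le_trans (rV_coord_le _ _) (H _).
Qed.

Lemma blk_linear_continuous N i : continuous (@blk_linear N i).
Proof.
apply/linear_bounded_continuous/linear_boundedP.
exists 1; split; first exact: num_real.
move=> r r1 x; apply: le_trans (blk_norm_le x i) _.
by rewrite ler_peMl // ltW.
Qed.

Lemma blk_eq0 N (x : 'rV[R]_(\sum_(j < n) N j)) : (forall i, blk x i = 0) -> x = 0.
Proof. by move=> H; apply/mxrowP => i; rewrite submxrow0; exact: H. Qed.

Lemma stack_blk (N M : 'I_n -> nat)
  (hs : forall i, 'rV[R]_(\sum_(j < n) N j) -> 'rV[R]_(M i) -> 'rV[R]_(N i)) x u i :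
  blk (stack hs x u) i = hs i x (blk u i).
Proof. by rewrite /blk /stack mxrowK. Qed.

Lemma stack_loc_lip2 (N M : 'I_n -> nat)
  (hs : forall i, 'rV[R]_(\sum_(j < n) N j) -> 'rV[R]_(M i) -> 'rV[R]_(N i)) :
  (forall i, loc_lip2 (hs i)) -> loc_lip2 (stack hs).
Proof.
move=> H x u.
have /choice[rL HrL] : forall i, exists rL : R * R, 0 < rL.1 /\
    forall y1 y2 v1 v2, `|y1 - x| < rL.1 -> `|y2 - x| < rL.1 -> `|v1 - blk u i| < rL.1 ->
    `|v2 - blk u i| < rL.1 -> `|hs i y1 v1 - hs i y2 v2| <= rL.2 * (`|y1 - y2| + `|v1 - v2|).
  by move=> i; have [r [L HL]] := H i x (blk u i); exists (r, L).
have [r r0 Hr] : exists2 r, 0 < r & forall i, r <= (rL i).1.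
  apply: (@common_radius R _ (fun i r => r <= (rL i).1)) => [i p q qp|i]; first exact: le_trans.
  by exists (rL i).1 => //; case: (HrL i).
have [L L0 HL] : exists2 L, 0 <= L & forall i, (rL i).2 <= L.
  apply: (@common_bound R _ (fun i r => (rL i).2 <= r)) => [i p q qp|i]; last by exists (rL i).2.
  by move=> h; exact: le_trans qp.
exists r, L; split=> // y1 y2 v1 v2 y1r y2r v1r v2r.
have s0 : 0 <= `|y1 - y2| + `|v1 - v2| by rewrite addr_ge0.
apply: norm_le_blk => [|i]; first by rewrite mulr_ge0.
rewrite blkB !stack_blk.
have [_ Hi] := HrL i.
have b (v : 'rV[R]_(\sum_(j < n) M j)) : `|v - u| < r -> `|blk v i - blk u i| < (rL i).1.
  move=> vr; rewrite -blkB; apply: le_lt_trans (blk_norm_le _ _) _.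
  exact: lt_le_trans vr (Hr i).
apply: le_trans (Hi _ _ _ _ _ _ (b _ v1r) (b _ v2r)) _.
- exact: lt_le_trans y1r (Hr i).
- exact: lt_le_trans y2r (Hr i).
apply: (@le_trans _ _ (L * (`|y1 - y2| + `|blk v1 i - blk v2 i|))).
  by rewrite ler_wpM2r // addr_ge0.
by rewrite ler_wpM2l // lerD2l -blkB blk_norm_le.
Qed.

End Blocks.

Lemma continuous_of_norm (R : realType) (W : normedModType R) (V : W -> R) :
  (forall x e, 0 < e -> exists2 r, 0 < r & forall y, `|y - x| < r -> `|V y - V x| < e) ->
  continuous V.
Proof.
move=> H x; apply/cvgrPdist_lt => e e0; have [r r0 Hr] := H x e e0.
apply/nbhs_normP; exists r => //= y /=; rewrite distrC => yx.
by rewrite distrC; exact: Hr.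
Qed.

(** * The weighted maximum of the subsystem Lyapunov functions *)

Section Interconnection.
Context {R : realType} {n : nat}.
Variables (N M : 'I_n -> nat).
Notation NN := (\sum_(j < n) N j)%N.
Notation MM := (\sum_(j < n) M j)%N.
Variables (fs gs : forall i : 'I_n, 'rV[R]_NN -> 'rV[R]_(M i) -> 'rV[R]_(N i)).
Variables (Vs : forall i : 'I_n, 'rV[R]_(N i) -> R).
Variables (G : 'I_n -> 'I_n -> R) (gam : 'I_n -> R -> R) (c d s : 'I_n -> R).
Hypothesis n_gt0 : (0 < n)%N.
Hypothesis N_gt0 : forall i, (0 < N i)%N.
Hypothesis G_ge0 : forall i j, 0 <= G i j.
Hypothesis subLF : forall i, sub_eISS_LF fs gs Vs G gam c d i.
Hypothesis s_gt0 : forall i, 0 < s i.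
Hypothesis Gamma_s : forall i, Gamma_op G s i < s i.

Definition scaled i (x : 'rV[R]_NN) : R := Vs (blk x i) / s i.
Definition maxV (x : 'rV[R]_NN) : R := fmax (fun i => scaled i x).
(** Pairs with [G i j = 0] are left out because [- ln 0] stands for an infinite rate, which
    constrains nothing. *)
Definition rate_d : R := fmin (fun i => \big[Num.min/d i]_(j < n | (j != i) && (0 < G i j))
                              (- ln (s j / s i * G i j))).
Definition max_gain (r : R) : R := fmax (fun i => gam i r / s i).
(** The factor [expR rate_d] lets [expR (- rate_d) * maxV x] dominate the input term of a jump; the
    factor 1 makes the gain dominate [max_gain], as flows require. *)
Definition gain (r : R) : R := Num.max (expR rate_d) 1 * max_gain r.

Lemma Vs_ge0 i (y : 'rV[R]_(N i)) : 0 <= Vs y.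
Proof.
case: (subLF i) => -[_ [V0 Vpos] _ _ _] _ _.
by have [->|/Vpos/ltW//] := eqVneq y 0; rewrite V0.
Qed.

Lemma scaled_ge0 i x : 0 <= scaled i x.
Proof. by rewrite divr_ge0 ?Vs_ge0 // ltW. Qed.

Lemma scaled_le i x : scaled i x <= maxV x.
Proof. exact: (fmax_ge n_gt0 (fun i => scaled i x)). Qed.

Lemma maxV_attained x : exists i, maxV x = scaled i x.
Proof. exact: (fmax_attained n_gt0 (fun i => scaled i x)). Qed.

Lemma Vs_le i x : Vs (blk x i) <= s i * maxV x.
Proof. by rewrite mulrC -ler_pdivrMr //; exact: scaled_le. Qed.

Lemma maxV_ge0 x : 0 <= maxV x.
Proof. by have [i ->] := maxV_attained x; exact: scaled_ge0. Qed.

Lemma gam_ge0 i (r : R) : 0 <= r -> 0 <= gam i r.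
Proof. by case: (subLF i) => -[_ _ _ _ [Kg _]] _ _; exact: classK_ge0. Qed.

Lemma gam_le i (r : R) : gam i r <= s i * max_gain r.
Proof. by rewrite mulrC -ler_pdivrMr //; exact: (fmax_ge n_gt0 (fun i => gam i r / s i)). Qed.

Lemma max_gain_ge0 (r : R) : 0 <= r -> 0 <= max_gain r.
Proof.
move=> r0; have [i E] := fmax_attained n_gt0 (fun i => gam i r / s i).
by rewrite /max_gain E divr_ge0 ?gam_ge0 // ltW.
Qed.

Lemma max_gain_le_gain (r : R) : 0 <= r -> max_gain r <= gain r.
Proof. by move=> r0; rewrite /gain ler_peMl ?max_gain_ge0 // le_max lexx orbT. Qed.

Lemma gain_classKinf : classKinf gain.
Proof.
apply: classKinf_scale; first by rewrite lt_max ltr01 orbT.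
apply: (classKinf_fmax n_gt0) => i.
have -> : (fun r => gam i r / s i) = (fun r => (s i)^-1 * gam i r).
  by apply/funext => r; rewrite mulrC.
apply: classKinf_scale; first by rewrite invr_gt0.
by case: (subLF i) => -[].
Qed.

Lemma interaction_le x i : interaction Vs G x i <= s i * maxV x.
Proof.
apply: bigmax_le => [|j _]; first by rewrite mulr_ge0 ?maxV_ge0 // ltW.
apply: (@le_trans _ _ (G i j * (s j * maxV x))); first by rewrite ler_wpM2l // Vs_le.
rewrite mulrA ler_wpM2r ?maxV_ge0 //; apply: le_trans (ltW (Gamma_s i)).
exact: (bigmax_sup j).
Qed.

(** For a positive gain, [rate_d <= - ln (s j / s i * G i j)] says exactly that
    [G i j * s j <= s i * expR (- rate_d)]. *)
Lemma interaction_le_rate x i : interaction Vs G x i <= s i * (expR (- rate_d) * maxV x).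
Proof.
have r0 : 0 <= s i * (expR (- rate_d) * maxV x).
  by rewrite !mulr_ge0 ?expR_ge0 ?maxV_ge0 // ltW.
apply: bigmax_le => // j ji.
case: (ltP 0 (G i j)) => [Gij|G0]; last first.
  have -> : G i j = 0 by apply/eqP; rewrite eq_le G0 G_ge0.
  by rewrite mul0r.
have q0 : 0 < s j / s i * G i j by rewrite mulr_gt0 // divr_gt0.
have dq : rate_d <= - ln (s j / s i * G i j).
  apply: le_trans (fmin_le n_gt0 _ i) _; apply: bigmin_le_cond.
  by rewrite ji.
apply: (@le_trans _ _ (G i j * (s j * maxV x))); first by rewrite ler_wpM2l // Vs_le.
rewrite !mulrA ler_wpM2r ?maxV_ge0 //.
have -> : G i j * s j = s i * (s j / s i * G i j) by field; rewrite gt_eqF.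
by rewrite ler_pM2l // -[leLHS]lnK ?posrE // ler_expR; lra.
Qed.

Lemma maxV_jump x (u : 'rV[R]_MM) :
  maxV (stack gs x u) <= Num.max (expR (- rate_d) * maxV x) (max_gain `|u|).
Proof.
have [i ->] := maxV_attained (stack gs x u).
rewrite /scaled stack_blk ler_pdivrMr // mulrC.
case: (subLF i) => _ _ /(_ x (blk u i)) /le_trans; apply.
set m := Num.max _ (max_gain _).
have h1 : expR (- rate_d) * maxV x <= m by rewrite le_max lexx.
have h2 : max_gain `|u| <= m by rewrite le_max lexx orbT.
rewrite !ge_max; apply/and3P; split.
- apply: (@le_trans _ _ (s i * (expR (- rate_d) * maxV x))); last by rewrite ler_pM2l.
  rewrite mulrCA; apply: ler_pM; rewrite ?expR_ge0 ?Vs_ge0 ?Vs_le // ler_expR lerN2.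
  by apply: le_trans (fmin_le n_gt0 _ i) _; exact: bigmin_le_id.
- by apply: le_trans (interaction_le_rate x i) _; rewrite ler_pM2l.
- apply: (@le_trans _ _ (gam i `|u|)).
    by case: (subLF i) => -[_ _ _ _ [Kg _]] _ _; apply: classK_le => //; exact: blk_norm_le.
  by apply: le_trans (gam_le i _) _; rewrite ler_pM2l.
Qed.

Lemma maxV_jump_gain x (u : 'rV[R]_MM) :
  maxV (stack gs x u) <= Num.max (expR (- rate_d) * maxV x) (gain `|u|).
Proof.
apply: le_trans (maxV_jump x u) _.
by rewrite ge_max !le_max lexx max_gain_le_gain ?orbT.
Qed.

Lemma maxV_jump_decay x (u : 'rV[R]_MM) : gain `|u| <= maxV x ->
  maxV (stack gs x u) <= expR (- rate_d) * maxV x.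
Proof.
move=> gV; apply: le_trans (maxV_jump x u) _; rewrite ge_max lexx /=.
have e0 := expR_gt0 rate_d.
rewrite expRN mulrC ler_pdivlMr // mulrC; apply: le_trans gV.
by rewrite /gain ler_wpM2r ?max_gain_ge0 // le_max lexx.
Qed.

Lemma scaled_continuous i : continuous (scaled i).
Proof.
case: (subLF i) => -[cV _ _ _ _] _ _ x.
have h : (fun y => Vs (blk y i)) y @[y --> x] --> Vs (blk x i).
  apply: (@cvg_comp _ _ _ (fun y => blk y i) (@Vs i)); last exact: cV.
  exact: (@blk_linear_continuous R n N i x).
exact: cvgM h (cvg_cst (s i)^-1).
Qed.

Lemma scaled_near x e : 0 < e -> exists2 r, 0 < r & forall i y, `|y - x| < r ->
  `|scaled i y - scaled i x| < e.
Proof.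
move=> e0; apply: common_radius => [i r r' rr' H y yr|i].
  by apply: H; exact: lt_le_trans rr'.
have /cvgrPdist_lt /(_ _ e0) /nbhs_normP[r /= r0 Hr] := @scaled_continuous i x.
exists r => // y yx; rewrite distrC; apply: Hr => /=.
by rewrite distrC.
Qed.

Lemma maxV_near x e : 0 < e -> exists2 r, 0 < r & forall y, `|y - x| < r ->
  `|maxV y - maxV x| < e.
Proof.
move=> e0; have [r r0 Hr] := scaled_near x e0; exists r => // y yx.
have [i Ei] := maxV_attained y; have [j Ej] := maxV_attained x.
have := Hr i y yx; have := Hr j y yx.
have := scaled_le j y; have := scaled_le i x.
by rewrite Ei Ej !ltr_norml; lra.
Qed.

Lemma maxV_continuous : continuous maxV.
Proof. exact: continuous_of_norm maxV_near. Qed.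

Lemma maxV_pos_def : pos_def maxV.
Proof.
split.
  have [i ->] := maxV_attained 0; rewrite /scaled.
  have -> : blk (0 : 'rV[R]_NN) i = 0 by rewrite /blk submxrow0.
  by case: (subLF i) => -[_ [-> _] _ _ _] _ _; rewrite mul0r.
move=> x x0; have [i xi0] : exists i, blk x i != 0.
  apply: contrapT => H; move/eqP: x0; apply; apply: blk_eq0 => i.
  by apply/eqP/negP => /negP xi; apply: H; exists i.
apply: lt_le_trans (scaled_le i x); rewrite divr_gt0 //.
by case: (subLF i) => -[_ [_ H] _ _ _] _ _; exact: H.
Qed.

Lemma maxV_radially_unbounded : radially_unbounded maxV.
Proof.
move=> K.
have [r r0 Hr] : exists2 r, 0 <= r & forall i, forall y : 'rV[R]_(N i), r <= `|y| -> K * s i <= Vs y.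
  apply: common_bound => [i p q pq H y qy|i]; first by apply: H; exact: le_trans qy.
  by case: (subLF i) => -[_ _ /(_ (K * s i)) [r Hr] _ _] _ _; exists r.
exists (r + 1) => x rx.
have [i ri] : exists i, r <= `|blk x i|.
  apply: contrapT => H; suff : `|x| <= r by lra.
  apply: norm_le_blk => // i; rewrite leNgt; apply/negP => /ltW ri; apply: H.
  by exists i.
apply: le_trans (scaled_le i x); rewrite ler_pdivlMr //; exact: Hr.
Qed.

(** A component [Vs i] need not be Lipschitz near 0, and a nonzero [x] may have a zero block. Near
    [x] such a component stays below half of [maxV x], so it is never a maximizer and needs no
    Lipschitz bound. *)
Lemma maxV_loc_lip : loc_lip_off0 maxV.
Proof.
move=> x x0; have V0 : 0 < maxV x by case: maxV_pos_def => _; apply.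
have V20 : 0 < maxV x / 2 by rewrite divr_gt0.
have [r1 r10 H1] := maxV_near x V20.
have /choice[rL HrL] : forall i, exists rL : R * R, 0 < rL.1 /\
    forall y z, `|y - x| < rL.1 -> `|z - x| < rL.1 ->
      maxV x / 2 < scaled i y -> `|scaled i y - scaled i z| <= rL.2 * `|y - z|.
  move=> i; have [xi0|xi0] := eqVneq (blk x i) 0.
    have [r r0 Hr] := scaled_near x V20.
    exists (r, 0); split=> // y z yx _; have := Hr i y yx.
    rewrite /scaled xi0; case: (subLF i) => -[_ [-> _] _ _ _] _ _.
    by rewrite mul0r subr0 ltr_norml; lra.
  case: (subLF i) => -[_ _ _ /(_ _ xi0) [r [L [r0 HL]]] _] _ _.
  exists (r, Num.max 0 L / s i); split=> // y z yx zx _.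
  have bi (w : 'rV[R]_NN) : `|w - x| < r -> `|blk w i - blk x i| < r.
    by rewrite -blkB; apply: le_lt_trans; exact: blk_norm_le.
  rewrite /scaled -mulrBl normrM (gtr0_norm (_ : 0 < (s i)^-1)) ?invr_gt0 //.
  rewrite mulrAC ler_pM2r ?invr_gt0 //.
  have h := HL _ _ (bi y yx) (bi z zx).
  have b := blk_norm_le (y - z) i; rewrite blkB in b.
  apply: (le_trans h); apply: (@le_trans _ _ (Num.max 0 L * `|blk y i - blk z i|)).
    by rewrite ler_wpM2r // le_max lexx orbT.
  by rewrite ler_wpM2l // le_max lexx.
have [r r0 Hr] : exists2 r, 0 < r & forall i, r <= (rL i).1.
  apply: (@common_radius R _ (fun i r => r <= (rL i).1)) => [i p q qp|i]; first exact: le_trans.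
  by exists (rL i).1 => //; case: (HrL i).
have [L L0 HL] : exists2 L, 0 <= L & forall i, (rL i).2 <= L.
  apply: (@common_bound R _ (fun i r => (rL i).2 <= r)) => [i p q qp|i]; last by exists (rL i).2.
  by move=> h; exact: le_trans qp.
exists (Num.min r r1), L; split; first by rewrite lt_min r0.
(* A maximizer at [y] is large enough for its Lipschitz estimate to apply, which gives one side;
   exchanging [y] and [z] gives the other. *)
have half y z : `|y - x| < Num.min r r1 -> `|z - x| < Num.min r r1 -> maxV y - maxV z <= L * `|y - z|.
  rewrite !lt_min => /andP[yr yr1] /andP[zr _].
  have [i Ei] := maxV_attained y.
  have [_ Hi] := HrL i.
  have := Hi y z (lt_le_trans yr (Hr i)) (lt_le_trans zr (Hr i)).
  rewrite -Ei; have := H1 y yr1; rewrite ltr_norml => h /(_ ltac:(lra)).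
  have : (rL i).2 * `|y - z| <= L * `|y - z| by rewrite ler_wpM2r.
  have := scaled_le i z; rewrite ler_norml; lra.
move=> y z yr zr; have := half y z yr zr; have := half z y zr yr.
by rewrite (distrC z) ler_norml; lra.
Qed.

Lemma scaled_diff i x : differentiable (@Vs i) (blk x i) ->
  differentiable (scaled i) x /\
  forall w, 'd (scaled i) x w = 'd (@Vs i) (blk x i) (blk w i) / s i.
Proof.
move=> dV.
have cb := @blk_linear_continuous R n N i.
have db : differentiable (@blk_linear R n N i) x by exact: linear_differentiable.
have dV' : differentiable (@Vs i) (@blk_linear R n N i x) by exact: dV.
have E : scaled i = (s i)^-1 *: (@Vs i \o @blk_linear R n N i).
  by apply/funext => y; rewrite /scaled mulrC.
have dc := differentiable_comp db dV'.
rewrite E; split; first exact: differentiableZ.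
by move=> w; rewrite diffZ //= diff_comp //= diff_lin //= mulrC.
Qed.

(** A maximizer at a point near [x] is also one at [x], since the other components lag behind by a
    gap; by [tie], all maximizers at [x] have the same first-order expansion there. *)
Lemma maxV_diff x :
  (forall i, differentiable (scaled i) x) ->
  (forall i j, scaled i x = scaled j x -> forall w, 'd (scaled i) x w = 'd (scaled j) x w) ->
  forall i, maxV x = scaled i x ->
  differentiable maxV x /\ 'd maxV x = 'd (scaled i) x :> ('rV[R]_NN -> R).
Proof.
move=> ds tie i0 E0.
apply: diff_of_norm_le; first exact: diff_continuous.
move=> e e0.
have [r r0 Hr] : exists2 r, 0 < r & forall j, forall y, `|y - x| < r ->
    if scaled j x == maxV x then `|scaled j y - maxV x - 'd (scaled i0) x (y - x)| <= e * `|y - x|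
    else scaled j y < maxV y.
  apply: common_radius => [j p q qp H y yq|j]; first by apply: H; exact: lt_le_trans qp.
  case: eqP => [Ej|/eqP nEj].
    have [r r0 Hr] := differentiable_norm_le (ds j) e0; exists r => // y yx.
    have Eji : scaled j x = scaled i0 x by rewrite Ej E0.
    by rewrite -(tie j i0 Eji) -Ej; exact: Hr.
  have gap : 0 < (maxV x - scaled j x) / 2.
    by rewrite divr_gt0 // subr_gt0 lt_neqAle nEj scaled_le.
  have [r r0 Hr] := scaled_near x gap; have [r' r'0 Hr'] := maxV_near x gap.
  exists (Num.min r r'); first by rewrite lt_min r0.
  move=> y; rewrite lt_min => /andP[/(Hr j y) + /(Hr' y)].
  by rewrite !ltr_norml; lra.
exists r => // y yx; have [j Ej] := maxV_attained y.
by have := Hr j y yx; case: eqP => _; rewrite -Ej // ltxx.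
Qed.

(* Off the null set of regular ties, all the maximizing components share one differential,
   which is then that of the maximum. *)
Lemma maxV_flow_decay : exists E : set 'rV[R]_NN, Defs.null_set E /\
  forall x, ~ E x -> differentiable maxV x /\
    forall u : 'rV[R]_MM, gain `|u| <= maxV x ->
      'd maxV x (stack fs x u) <= - fmin c * maxV x.
Proof.
have NN_gt0 : (0 < NN)%N.
  by rewrite (bigD1 (Ordinal n_gt0)) //= addn_gt0 N_gt0.
have /choice[E HE] : forall i, exists E : set 'rV[R]_NN, Defs.null_set E /\
     forall x, ~ E x -> differentiable (@Vs i) (blk x i) /\
       forall ui : 'rV[R]_(M i), Num.max (interaction Vs G x i) (gam i `|ui|) <= Vs (blk x i) ->
         'd (@Vs i) (blk x i) (fs x ui) <= - c i * Vs (blk x i).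
  by move=> i; case: (subLF i).
pose A (p : 'I_n * 'I_n) := [set x | [/\ (scaled p.1 - scaled p.2) x = 0,
  differentiable (scaled p.1 - scaled p.2) x &
  exists v, 'd (scaled p.1 - scaled p.2) x v != 0]].
pose B (q : 'I_n + 'I_n * 'I_n) := match q with inl i => E i | inr p => A p end.
exists (\bigcup_q B q); split.
  apply: null_set_bigcup => // -[i|p]; first by case: (HE i).
  exact: null_set_zero_regular.
move=> x nBx.
have nE i : ~ E i x by move=> Ei; apply: nBx; exists (inl i).
have dV i : differentiable (@Vs i) (blk x i) by case: (HE i) => _ /(_ x (nE i)) [].
have ds i : differentiable (scaled i) x by case: (scaled_diff (dV i)).
have tie i j : scaled i x = scaled j x -> forall w, 'd (scaled i) x w = 'd (scaled j) x w.
  move=> sij w; apply/eqP; rewrite -subr_eq0; apply: contrapT => /negP dw.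
  apply: nBx; exists (inr (i, j)) => //; split=> /=.
  - by rewrite !fctE sij subrr.
  - exact: differentiableB.
  - by exists w; rewrite diffB.
have [i0 E0] := maxV_attained x.
have [dM dME] := maxV_diff ds tie E0.
split=> // u gV; rewrite dME.
have [_ ->] := scaled_diff (dV i0); rewrite stack_blk.
have VsE : Vs (blk x i0) = s i0 * maxV x by rewrite E0 /scaled mulrC divfK // gt_eqF.
have cond : Num.max (interaction Vs G x i0) (gam i0 `|blk u i0|) <= Vs (blk x i0).
  rewrite ge_max VsE interaction_le /=.
  apply: (@le_trans _ _ (gam i0 `|u|)).
    by case: (subLF i0) => -[_ _ _ _ [Kg _]] _ _; apply: classK_le => //; exact: blk_norm_le.
  apply: le_trans (gam_le i0 _) _; rewrite ler_pM2l //.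
  by apply: le_trans gV; exact: max_gain_le_gain.
have [_ /(_ x (nE i0)) [_ /(_ _ cond) H]] := HE i0.
rewrite ler_pdivrMr //; apply: (le_trans H); rewrite VsE.
have -> : - fmin c * maxV x * s i0 = - fmin c * (s i0 * maxV x) by ring.
rewrite ler_wpM2r //; first by rewrite mulr_ge0 ?maxV_ge0 // ltW.
by rewrite lerN2; exact: fmin_le.
Qed.

Lemma maxV_eISS_LF : eISS_LF (stack fs) (stack gs) maxV gain (fmin c) rate_d.
Proof.
split; last exact: maxV_jump_decay.
  split; [exact: maxV_continuous|exact: maxV_loc_lip|exact: maxV_pos_def|
          exact: maxV_radially_unbounded|exact: gain_classKinf].
exact: maxV_flow_decay.
Qed.

End Interconnection.

Unset Implicit Arguments.
Set Strict Implicit.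

Theorem theorem4 (R : realType) (n : nat) (N M : 'I_n -> nat)
  (fs gs : forall i : 'I_n, 'rV[R]_(\sum_(j < n) N j) -> 'rV[R]_(M i) -> 'rV[R]_(N i))
  (Vs : forall i : 'I_n, 'rV[R]_(N i) -> R)
  (G : 'I_n -> 'I_n -> R) (gam : 'I_n -> R -> R) (c d : 'I_n -> R)
  (s : 'I_n -> R) :
  (0 < n)%N ->
  (forall i, 0 < N i)%N ->
  (forall i, loc_lip2 (fs i)) ->
  (forall i j, 0 <= G i j) ->
  (forall i, G i i = 0) ->
  (forall i, d i != 0) ->
  (forall i, sub_eISS_LF fs gs Vs G gam c d i) ->
  small_gain G ->
  (forall i, 0 < s i) ->
  (forall i, Gamma_op G s i < s i) ->
  let V := fun x : 'rV[R]_(\sum_(j < n) N j) => fmax (fun i => Vs i (blk x i) / s i) in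
  let cc := fmin c in
  let dd := fmin (fun i => \big[Num.min/d i]_(j < n | (j != i) && (0 < G i j))
                              (- ln (s j / s i * G i j))) in
  let gamma := fun r : R => Num.max (expR dd) 1 * fmax (fun i => gam i r / s i) in
  eISS_LF (stack fs) (stack gs) V gamma cc dd /\
  (forall mu lam : R, 0 < mu -> 0 < lam ->
     forall t0 : R, UISS (stack fs) (stack gs) t0 (class_S t0 cc dd mu lam)).
Proof.
move=> n0 N0 lipf G0 _ _ subLF _ s0 Gs V cc dd gamma.
have LF : eISS_LF (stack fs) (stack gs) V gamma cc dd.
  exact: (maxV_eISS_LF n0 N0 G0 subLF s0 Gs).
split=> // mu lam _ lam0 t0.
have jump := maxV_jump_gain n0 G0 subLF s0.
exact: (eISS_UISS mu t0 (stack_loc_lip2 lipf) LF jump lam0).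
Qed.
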